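(* Let $\mu>0$, let $\sigma\in(0,1]$, and let $n\ge1$, with $n\ge2$ if $\sigma\ge1/2$. Consider the Cauchy problem $$u_{tt}-\Delta u+\mu(-\Delta)^\sigma u_t=|u|^p,\quad t\ge0,\ x\in\mathbb{R}^n,\qquad u(0,x)=u_0(x),\quad u_t(0,x)=u_1(x).$$ Assume that the data $u_0,u_1\in\mathcal{C}_0^\infty(\mathbb{R}^n)$ satisfy $$\int_{\mathbb{R}^n}\bigl(u_1(x)+\mu(-\Delta)^\sigma u_0(x)\bigr)\,dx>0.$$ If $$1<p\le\begin{cases}1+\dfrac{2}{n-2\sigma}&\text{if }\sigma\in(0,1/2],\\[2mm]1+\dfrac{2}{n-1}&\text{if }\sigma\in[1/2,1],\end{cases}$$ then there exists no global (i.e. defined for all $t\in[0,\infty)$), sufficiently regular, non-negative solution $u$ to this Cauchy problem.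
   Context: The operator $(-\Delta)^\sigma$ is the Fourier multiplier with symbol $|\xi|^{2\sigma}$. Data and solutions are real-valued. ''Sufficiently regular'' may be read as: $u\in\mathcal{C}([0,\infty),H^2(\mathbb{R}^n))\cap\mathcal{C}^1([0,\infty),H^{2\sigma}(\mathbb{R}^n))\cap\mathcal{C}^2([0,\infty),L^2(\mathbb{R}^n))$, with the equation satisfied in $L^2(\mathbb{R}^n)$ for every $t\ge0$ and the initial conditions attained. ''Non-negative'' means $u(t,x)\ge0$ for all $t\ge0$ and (almost) all $x\in\mathbb{R}^n$. *)

(* Defs.v *)
From HB Require Import structures.
From mathcomp Require Import all_boot all_order all_algebra.
From mathcomp Require Import all_classical all_reals all_analysis.
From mathcomp Require Import complex.

Set Implicit Arguments.
Unset Strict Implicit.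
Unset Printing Implicit Defensive.

Import Order.TTheory GRing.Theory Num.Theory.
Import numFieldNormedType.Exports.

Local Open Scope classical_set_scope.
Local Open Scope ring_scope.

Definition rV_display : measure_display.
Proof. exact: default_measure_display. Qed.

Section measurable_rV.
Context {R : realType} (n : nat).

Definition rV_coord (i : 'I_n) (x : 'rV[R]_n) : R := x ord0 i.

Let rV_set0 : g_sigma_preimage rV_coord set0.
Proof. exact: sigma_algebra0. Qed.

Let rV_setC A : g_sigma_preimage rV_coord A -> g_sigma_preimage rV_coord (~` A).
Proof. exact: sigma_algebraC. Qed.

Let rV_bigcup (F : _^nat) : (forall i, g_sigma_preimage rV_coord (F i)) ->
  g_sigma_preimage rV_coord (\bigcup_i (F i)).
Proof. exact: sigma_algebra_bigcup. Qed.

(* Generated by the coordinate maps, hence the Borel sigma-algebra of R^n. *)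
HB.instance Definition _ := @isMeasurable.Build rV_display
  'rV[R]_n (g_sigma_preimage rV_coord) rV_set0 rV_setC rV_bigcup.

Lemma measurable_rV_coord (i : 'I_n) :
  measurable_fun [set: 'rV[R]_n] (rV_coord i).
Proof.
move=> _ Y mY; rewrite setTI; apply: sub_sigma_algebra => /=.
rewrite -bigcup_seq/=; exists i => /=; first by rewrite mem_index_enum.
by exists Y => //; rewrite setTI.
Qed.

Lemma measurable_fun_rVP d (T : measurableType d) (f : T -> 'rV[R]_n) :
  (forall i, measurable_fun [set: T] (rV_coord i \o f)) ->
  measurable_fun [set: T] f.
Proof.
move=> mf; have sub : g_sigma_preimage (fun i => rV_coord i \o f) `<=` measurable.
  apply: smallest_sub; first exact: sigma_algebra_measurable.
  rewrite -bigcup_seq; apply: bigcup_sub => i _ A [B mB <-].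
  exact: mf.
move=> _ A mA; rewrite setTI; apply: sub.
rewrite g_sigma_preimage_comp; exists A => //.
by rewrite setTI.
Qed.

End measurable_rV.

Section lebesgue_rV.
Context {R : realType}.

Definition cons_rV n (p : R * 'rV[R]_n) : 'rV[R]_n.+1 :=
  \row_i (if unlift ord0 i is Some j then p.2 ord0 j else p.1).

Definition uncons_rV n (x : 'rV[R]_n.+1) : R * 'rV[R]_n :=
  (x ord0 ord0, \row_j x ord0 (lift ord0 j)).

Lemma cons_rVK n : cancel (@cons_rV n) (@uncons_rV n).
Proof.
move=> [a v]; rewrite /uncons_rV /cons_rV mxE unlift_none; congr (_, _).
by apply/rowP => j; rewrite !mxE liftK.
Qed.

Lemma uncons_rVK n : cancel (@uncons_rV n) (@cons_rV n).
Proof.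
move=> x; apply/rowP => i; rewrite mxE.
by case: unliftP => [j ->|->] //=; rewrite mxE.
Qed.

Lemma measurable_cons_rV n :
  measurable_fun [set: R * 'rV[R]_n] (@cons_rV n).
Proof.
apply: measurable_fun_rVP => i; rewrite /rV_coord /comp /cons_rV.
case: (unliftP ord0 i) => [j ->|->].
  rewrite [X in measurable_fun _ X](_ : _ = rV_coord j \o snd).
    by apply: measurableT_comp => //; exact: measurable_rV_coord.
  by apply/funext => p; rewrite mxE liftK.
rewrite [X in measurable_fun _ X](_ : _ = fst) //.
by apply/funext => p; rewrite mxE unlift_none.
Qed.

Lemma measurable_uncons_rV n :
  measurable_fun [set: 'rV[R]_n.+1] (@uncons_rV n).
Proof.
apply/measurable_fun_pairP; split; first exact: (measurable_rV_coord ord0).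
apply: measurable_fun_rVP => i.
rewrite [X in measurable_fun _ X](_ : _ = rV_coord (lift ord0 i)).
  exact: measurable_rV_coord.
by apply/funext => x; rewrite /rV_coord /= mxE.
Qed.

Section lebesgue_cons.
Variables (n : nat) (L : {sigma_finite_measure set 'rV[R]_n -> \bar R}).

Definition lebesgue_cons : set 'rV[R]_n.+1 -> \bar R :=
  pushforward (@lebesgue_measure R \x L)%E (@cons_rV n).

Let lebesgue_cons0 : lebesgue_cons set0 = 0%E.
Proof. by rewrite /lebesgue_cons /pushforward preimage_set0 measure0. Qed.

Let lebesgue_cons_ge0 A : (0 <= lebesgue_cons A)%E.
Proof. by rewrite /lebesgue_cons /pushforward; exact: measure_ge0. Qed.

Let lebesgue_cons_sigma_additive : semi_sigma_additive lebesgue_cons.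
Proof.
move=> F mF tF mUF; rewrite /lebesgue_cons /pushforward preimage_bigcup.
apply: measure_semi_sigma_additive.
- by move=> k; rewrite -[X in measurable X]setTI; exact: measurable_cons_rV.
- apply/trivIsetP => /= i j _ _ ij; rewrite -preimage_setI.
  by move/trivIsetP : tF => /(_ _ _ _ _ ij) ->//; rewrite preimage_set0.
- rewrite -preimage_bigcup -[X in measurable X]setTI.
  exact: measurable_cons_rV.
Qed.

HB.instance Definition _ := isMeasure.Build _ _ _ lebesgue_cons
  lebesgue_cons0 lebesgue_cons_ge0 lebesgue_cons_sigma_additive.

Let lebesgue_cons_sigma_finite : sigma_finite setT lebesgue_cons.
Proof.
have /sigma_finiteP[F [TF ndF Foo]] := sigma_finiteT (@lebesgue_measure R).
have /sigma_finiteP[G [TG ndG Goo]] := sigma_finiteT L.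
exists (fun k => uncons_rV (n:=n) @^-1` (F k `*` G k)).
  rewrite -preimage_bigcup (_ : \bigcup_k _ = setT) ?preimage_setT//.
  rewrite -setXTT TF TG predeqE => -[x y]; split.
    by move=> [k _ []/= ? ?]; split; exists k.
  move=> [/= [k _ Fkx] [l _ Gly]]; exists (maxn k l) => //; split.
  - by move: x Fkx; exact/subsetPset/ndF/leq_maxl.
  - by move: y Gly; exact/subsetPset/ndG/leq_maxr.
move=> k; have [mF Fkoo] := Foo k; have [mG Gkoo] := Goo k; split.
  rewrite -[X in measurable X]setTI; apply: measurable_uncons_rV => //.
  exact: measurableX.
rewrite /lebesgue_cons /pushforward -comp_preimage.
rewrite (_ : _ \o _ = id) ?preimage_id; last first.
  by apply/funext => p /=; rewrite cons_rVK.
by rewrite product_measure1E// lte_mul_pinfty// ge0_fin_numE.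
Qed.

HB.instance Definition _ := Measure_isSigmaFinite.Build _ _ _ lebesgue_cons
  lebesgue_cons_sigma_finite.

End lebesgue_cons.

(* Iterated product of the one-dimensional Lebesgue measure; see also
   [lebesgue_rV_box]. *)
Fixpoint lebesgue_rV n : {sigma_finite_measure set 'rV[R]_n -> \bar R} :=
  match n with
  | 0 => dirac (0 : 'rV[R]_0)
  | n'.+1 => lebesgue_cons (lebesgue_rV n')
  end.

Lemma lebesgue_rV_box n (A : 'I_n -> set R) : (forall i, measurable (A i)) ->
  lebesgue_rV n [set x | forall i, A i (x ord0 i)] =
  (\prod_(i < n) lebesgue_measure (A i))%E.
Proof.
elim: n A => [|n IH] A mA /=.
  by rewrite big_ord0 diracE (_ : _ \in _)// inE => -[].
rewrite big_ord_recl /= -IH; last by move=> i; exact: mA.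
rewrite /lebesgue_cons /pushforward -product_measure1E//; first last.
- rewrite [X in measurable X](_ : _ =
      \bigcap_(i in [set: 'I_n]) ((@rV_coord R n i) @^-1` A (lift ord0 i))).
    apply: fin_bigcap_measurable => [|i _]; first exact: finite_finset.
    rewrite -[X in measurable X]setTI.
    exact: measurable_rV_coord.
  by apply/seteqP; split => x /= Ax i; [move=> _; exact: Ax|exact: (Ax i I)].
- exact: mA.
congr (product_measure1 _ _ _); apply/seteqP; split => -[a v] /=.
  move=> Av; split => /=; first by have := Av ord0; rewrite mxE unlift_none.
  by move=> i; have := Av (lift ord0 i); rewrite mxE liftK.
move=> [Aa Av] i; rewrite mxE.
by case: (unliftP ord0 i) => [j ->|->] //; exact: Av.
Qed.

End lebesgue_rV.

Section spaces.
Context {R : realType} {n : nat}.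
Local Notation E := 'rV[R]_n.
Local Notation leb := (@lebesgue_rV R n).
Implicit Types (f g h : E -> R) (x xi : E).

Definition dot x xi : R := \sum_(i < n) x ord0 i * xi ord0 i.

(* The library norm on ['rV[R]_n] is the sup norm. *)
Definition enorm x : R := Num.sqrt (dot x x).

Definition partial (i : 'I_n) f : E -> R := 'D_(delta_mx ord0 i) f.

Definition partials (s : seq 'I_n) f : E -> R := foldr partial f s.

Definition smooth f := forall s : seq 'I_n,
  continuous (partials s f) /\
  forall (i : 'I_n) x, derivable (partials s f) x (delta_mx ord0 i).

Definition Cc_infty f := smooth f /\ compact (closure [set x | f x != 0]).

Definition laplacian f x : R := \sum_(i < n) partial i (partial i f) x.

Definition L2 f := f \in Lfun leb 2%:E.

Definition L2_norm f : \bar R := 'N[leb]_2%:E[EFin \o f].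

Definition L2C (F : E -> R[i]) :=
  L2 (fun xi => complex.Re (F xi)) /\ L2 (fun xi => complex.Im (F xi)).

(* Integral of [f x * exp (- i <x, xi>)] over the ball of radius [r]. *)
Definition fourier_ball f (r : R) xi : R[i] :=
  Complex (\int[leb]_(x in [set x | enorm x <= r]) (f x * cos (dot x xi)))
          (- \int[leb]_(x in [set x | enorm x <= r]) (f x * sin (dot x xi))).

(* Plancherel's extension: the Fourier transform of [f] is the limit in L^2 of
   the truncated Fourier integrals; [F] is any representative of it. *)
Definition fourier_L2 f (F : E -> R[i]) := [/\ L2 f, L2C F &
  L2_norm (fun xi => Normc.normc (F xi - fourier_ball f r xi))
    @[r --> +oo] --> 0%E].

(* [g = (-Delta)^sigma f] for [f] and [g] in L^2: the Fourier multiplier with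
   symbol |xi|^(2 sigma), as a relation since it is unbounded on L^2. The result
   [g] is unique almost everywhere. *)
Definition frac_laplacian (sigma : R) f g := exists2 F, fourier_L2 f F &
  fourier_L2 g (fun xi => (enorm xi `^ (2 * sigma))%:C%C * F xi).

(* [g = Delta f] in the sense of distributions, for [f] and [g] in L^2. *)
Definition weak_laplacian f g := [/\ L2 f, L2 g & forall phi, Cc_infty phi ->
  \int[leb]_x (f x * laplacian phi x) = \int[leb]_x (g x * phi x)].

(* The Fourier transform is unique almost everywhere, so that the infimum is
   over a singleton when [f] is in L^2, and is [+oo] otherwise. *)
Definition sobolev_norm (s : R) f : \bar R := ereal_inf
  [set L2_norm (fun xi => (1 + enorm xi ^+ 2) `^ (s / 2) *
                          Normc.normc (F xi)) | F in fourier_L2 f].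

(* A normed space of (representatives of) functions on R^n. *)
Record fspace := FSpace { carrier : set (E -> R); fnorm : (E -> R) -> \bar R }.

Definition L2_space : fspace := FSpace [set f | L2 f] L2_norm.

Definition sobolev (s : R) : fspace :=
  FSpace [set f | (sobolev_norm s f < +oo)%E] (sobolev_norm s).

Local Notation "[0,oo[" := [set t : R | 0 <= t].

Definition time_continuous (X : fspace) (u : R -> E -> R) :=
  (forall t, 0 <= t -> carrier X (u t)) /\
  forall t, 0 <= t ->
    fnorm X (u s \- u t) @[s --> within [0,oo[ (nbhs t)] --> 0%E.

(* [v] is the derivative of [u : [0, oo) -> X] (one-sided at [0]). *)
Definition time_derivative (X : fspace) (u v : R -> E -> R) :=
  (forall t, 0 <= t -> carrier X (u t) /\ carrier X (v t)) /\
  forall t, 0 <= t ->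
    fnorm X (fun x => (s - t)^-1 * (u s x - u t x) - v t x)
      @[s --> within [0,oo[ t^'] --> 0%E.

Fixpoint time_Ck (k : nat) (X : fspace) (u : R -> E -> R) : Prop :=
  match k with
  | 0 => time_continuous X u
  | k'.+1 => exists2 v, time_derivative X u v & time_Ck k' X v
  end.

Definition sufficiently_regular (sigma : R) (u : R -> E -> R) :=
  [/\ time_Ck 0 (sobolev 2) u, time_Ck 1 (sobolev (2 * sigma)) u
    & time_Ck 2 L2_space u].

(* The derivatives [u_t] and [u_tt] are taken in L^2, where they are unique
   almost everywhere; the equation holds in L^2 because its left-hand side is
   made of L^2 functions. *)
Definition global_solution (mu sigma p : R) (u0 u1 : E -> R)
    (u : R -> E -> R) :=
  exists ut utt : R -> E -> R,
    [/\ time_derivative L2_space u ut, time_derivative L2_space ut utt,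
        {ae leb, forall x, u 0 x = u0 x}, {ae leb, forall x, ut 0 x = u1 x}
      & forall t, 0 <= t -> exists Lap_u Frac_ut,
        [/\ weak_laplacian (u t) Lap_u, frac_laplacian sigma (ut t) Frac_ut
          & {ae leb, forall x,
              utt t x - Lap_u x + mu * Frac_ut x = `|u t x| `^ p}]].

Definition nonnegative (u : R -> E -> R) :=
  forall t, 0 <= t -> {ae leb, forall x, 0 <= u t x}.

End spaces.

(* Main.v *)
Require Import Defs.
From mathcomp Require Import all_boot all_order all_algebra.
From mathcomp Require Import all_classical all_reals all_analysis.
From mathcomp Require Import measurable_realfun complex ring lra.
Import Order.TTheory GRing.Theory Num.Theory.
Import numFieldNormedType.Exports.
Local Open Scope classical_set_scope.
Local Open Scope ring_scope.

Set Implicit Arguments.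
Unset Strict Implicit.
Unset Printing Implicit Defensive.

(** The solution is tested against the Gaussians [psi x = exp (- |x|^2 / (4 r^2))]
    of integer width [r] (the functions [profile r]). With
    [U = \int u psi], [g = \int |u|^p psi] and [D = \int u Delta psi], the
    equation says that [W = U' + mu \int u (-Delta)^sigma psi] satisfies
    [W' = g + D]: the operators have been moved to [psi], and only ordinary
    differential equations in time are left. As [r] grows, [W 0] tends to the
    integral of [u1 + mu (-Delta)^sigma u0], so that it stays above some
    [eps > 0].

    Gaussians are chosen because [(-Delta)^sigma] is not local: applied to a
    compactly supported cut-off it would leave tails that the cut-off does not
    control. A Gaussian controls its own images pointwise,
    [- Delta psi <= (n / (2 r^2)) psi] (lemma [lap_profile_ge]) and
    [(-Delta)^sigma psi <= (n / (2 r^2)) ^ sigma psi] (lemma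
    [riesz_profile_le]), and since [u >= 0] the integrals of [u] against these
    images are at most such multiples of [U]. The second bound comes from
    the heat flow, which satisfies [exp (s Delta) psi >= exp (- s c) psi] with
    [c = n / (2 r^2)] (lemma [gaussF_decay]), and from the representation of
    [y ^ sigma] as a positive mixture of the functions [1 - exp (- s y)] (lemma
    [bernstein_le]).

    What remains is a family, indexed by [r], of differential inequalities in
    time (lemma [no_global_growth]). They are tested with a power of
    [1 - t / T] on [[0, T]], for [T = r ^ kappa] and
    [kappa = max 1 (2 - 2 sigma)], the time scale on which every linear term
    is of order [r^-2 U]. Young's inequality, [U] being at most [lam g] plus
    a constant times [lam ^ (- 1 / (p - 1)) r ^ n], absorbs these terms in [g] up
    to an error whose integral over [[0, T]] is of order
    [r ^ (n + kappa - 2 - 2 / (p - 1))]; it is bounded exactly under the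
    assumption on [p] (lemma [critical_exponent]). So the space-time integral
    of [g] is bounded uniformly in [r]; since [g] increases with [r], most of
    it lies in a fixed time interval [[0, K]] for all large [r]. On [[0, K]] the
    error is small because [K] is small compared with [T]; on [[K, T]] the
    remaining mass of [g] is so small that [lam] may be taken large, which
    makes the error small. Hence [W 0] is smaller than [eps], a contradiction.

    The tests with Gaussians have to be justified. The fractional Laplacian is
    given by L^2 Fourier transforms, and the pairing is transferred to the
    Fourier side by truncation to balls and Fubini (lemmas [fourier_pairing]
    and [frac_laplacian_pairing]). The distributional Laplacian is only known
    against compactly supported functions, so Gaussians are cut off
    coordinatewise by a smooth bump (lemma [weak_laplacian_gauss]). *)

(** * Integrals, square-integrable functions and coordinates *)

Section integration.
Context d (T : measurableType d) (R : realType).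
Variable mu : {measure set T -> \bar R}.
Implicit Types f g h : T -> R.

Lemma integrable_measurable f :
  mu.-integrable setT (EFin \o f) -> measurable_fun setT f.
Proof. by move=> /measurable_int/measurable_EFinP. Qed.

Lemma integrable_dominated f g : measurable_fun setT f ->
  (forall x, `|f x| <= g x) -> mu.-integrable setT (EFin \o g) ->
  mu.-integrable setT (EFin \o f).
Proof.
move=> mf fg; apply: le_integrable => //; first exact/measurable_EFinP.
move=> x _ /=; rewrite lee_fin.
by rewrite [leRHS]ger0_norm// (le_trans _ (fg x)).
Qed.

Lemma Rintegral_dct (f_ : nat -> T -> R) f g :
  (forall n, measurable_fun setT (f_ n)) ->
  (forall x, f_ n x @[n --> \oo] --> f x) ->
  (forall n x, `|f_ n x| <= g x) -> mu.-integrable setT (EFin \o g) ->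
  mu.-integrable setT (EFin \o f) /\
  \int[mu]_x f_ n x @[n --> \oo] --> \int[mu]_x f x.
Proof.
move=> mf_ f_f f_g ig.
have mf : measurable_fun setT f.
  by apply: (measurable_fun_cvg (h := f_)) => // x _; exact: f_f.
have [|||||i1 _ i2] :=
  @dominated_convergence _ _ _ mu setT measurableT (fun n => EFin \o f_ n)
    (EFin \o f) (EFin \o g).
- by move=> n; exact/measurable_EFinP.
- exact/measurable_EFinP.
- by apply/aeW => x _; apply: cvg_EFin; [exact: nearW|exact: f_f].
- exact: ig.
- by apply/aeW => x n _ /=; rewrite lee_fin.
split=> //; apply: fine_cvg.
rewrite /Rintegral fineK; first exact: i2.
exact: integrable_fin_num.
Qed.

Lemma ae_eq_Rintegral f g : measurable_fun setT f -> measurable_fun setT g ->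
  {ae mu, forall x, f x = g x} -> \int[mu]_x f x = \int[mu]_x g x.
Proof.
move=> mf mg fg; congr fine; apply: ae_eq_integral => //.
- exact/measurable_EFinP.
- exact/measurable_EFinP.
- by apply: filterS fg => x /= -> _.
Qed.

Lemma ae_integrable f g : measurable_fun setT f -> measurable_fun setT g ->
  {ae mu, forall x, f x = g x} ->
  mu.-integrable setT (EFin \o f) -> mu.-integrable setT (EFin \o g).
Proof.
move=> mf mg fg /integrableP[_ fi]; apply/integrableP.
split; first exact/measurable_EFinP.
rewrite (ae_eq_integral (fun x => `|(f x)%:E|)%E) //.
- by apply/measurable_EFinP; exact: measurableT_comp.
- by apply/measurable_EFinP; exact: measurableT_comp.
- by apply: filterS fg => x /= -> _.
Qed.

Lemma ae_Rintegral_ge0 f : measurable_fun setT f ->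
  {ae mu, forall x, 0 <= f x} -> 0 <= \int[mu]_x f x.
Proof.
move=> mf f0; rewrite (ae_eq_Rintegral (g := fun x => `|f x|)) //.
- by apply: Rintegral_ge0 => x _; exact: normr_ge0.
- exact: measurableT_comp.
- by apply: filterS f0 => x fx; rewrite ger0_norm.
Qed.

Lemma Lfun2P f : f \in Lfun mu 2%:E <->
  measurable_fun setT f /\ mu.-integrable setT (EFin \o (fun x => f x ^+ 2)).
Proof.
split=> [lf|[mf if2]].
  split; last exact: Lfun2_integrable_sqr.
  by move: lf; rewrite inE => /andP[/[!inE]].
rewrite inE; apply/andP; split; rewrite inE//= /finite_norm unlock.
apply: poweR_lty; move/integrableP : if2 => [_]; apply: le_lt_trans.
rewrite le_eqVlt; apply/orP; left; apply/eqP.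
apply: eq_integral => x _ /=.
by rewrite normrX powR_mulrn.
Qed.

Lemma Lfun2_measurable f : f \in Lfun mu 2%:E -> measurable_fun setT f.
Proof. by move/Lfun2P => []. Qed.

Lemma Lfun2_dominated f g : measurable_fun setT f ->
  (forall x, `|f x| <= g x) -> g \in Lfun mu 2%:E -> f \in Lfun mu 2%:E.
Proof.
move=> mf fg /Lfun2P[mg ig]; apply/Lfun2P; split=> //.
apply: integrable_dominated ig; first exact: measurable_funX.
move=> x; rewrite normrX lerXn2r// ?nnegrE//.
exact: le_trans (fg x).
Qed.

Lemma Lfun2_mul_integrable f g : f \in Lfun mu 2%:E -> g \in Lfun mu 2%:E ->
  mu.-integrable setT (EFin \o (fun x => f x * g x)).
Proof. by move=> lf lg; apply/Lfun1_integrable; exact: Lfun2_mul_Lfun1. Qed.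

Lemma Lfun2_norm_fin f : f \in Lfun mu 2%:E ->
  exists2 r : R, 0 <= r & 'N[mu]_2%:E[EFin \o f]%E = r%:E.
Proof.
rewrite inE => /andP[_]; rewrite inE/= => lf.
exists (fine ('N[mu]_2%:E[EFin \o f])%E); first by rewrite fine_ge0// Lnorm_ge0.
by rewrite fineK// ge0_fin_numE// Lnorm_ge0.
Qed.

Lemma cauchy_schwarz f g : f \in Lfun mu 2%:E -> g \in Lfun mu 2%:E ->
  (`|\int[mu]_x (f x * g x)|%:E <=
     'N[mu]_2%:E[EFin \o f] * 'N[mu]_2%:E[EFin \o g])%E.
Proof.
move=> lf lg; have ifg := Lfun2_mul_integrable lf lg.
have mf := Lfun2_measurable lf; have mg := Lfun2_measurable lg.
apply: le_trans (hoelder mu mf mg _ _ _) => //; last first.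
  by rewrite [RHS]splitr !div1r.
rewrite EFin_normr_Rintegral// Lnorm1.
apply: (le_trans (le_abse_integral _ _ _)) => //.
by case/integrableP : ifg.
Qed.

Lemma real_integrableZl f c : mu.-integrable setT (EFin \o f) ->
  mu.-integrable setT (EFin \o (fun x => c * f x)).
Proof.
move=> intf; rewrite (_ : EFin \o _ = (fun x => (c%:E * (f x)%:E)%E)).
  exact: integrableZl.
by apply/funext => x /=; rewrite EFinM.
Qed.

Lemma Lfun2Zl f c : f \in Lfun mu 2%:E -> (fun x => c * f x) \in Lfun mu 2%:E.
Proof.
move=> /Lfun2P[mf if2]; apply/Lfun2P; split; first exact: measurable_funM.
rewrite (_ : (fun x => _) = (fun x => (c ^+ 2) * f x ^+ 2)).
  exact: real_integrableZl.
by apply/funext => x; rewrite exprMn.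
Qed.

Lemma Lfun2_abs f : f \in Lfun mu 2%:E -> (fun x => `|f x|) \in Lfun mu 2%:E.
Proof.
move=> lf; have mf := Lfun2_measurable lf.
have /Lfun2P[_ ih] := lf; apply/Lfun2P; split; first exact: measurableT_comp.
rewrite (_ : (fun x => _) = (fun x => f x ^+ 2))//.
by apply/funext => x; rewrite real_normK// num_real.
Qed.

Lemma real_integrableD f g : mu.-integrable setT (EFin \o f) ->
  mu.-integrable setT (EFin \o g) -> mu.-integrable setT (EFin \o (fun x => f x + g x)).
Proof. by move=> intf intg; exact: (integrableD measurableT intf intg). Qed.

Lemma real_integrableB f g : mu.-integrable setT (EFin \o f) ->
  mu.-integrable setT (EFin \o g) -> mu.-integrable setT (EFin \o (fun x => f x - g x)).
Proof. by move=> intf intg; exact: (integrableB measurableT intf intg). Qed.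

Lemma Lfun2B f g : f \in Lfun mu 2%:E -> g \in Lfun mu 2%:E ->
  (fun x => f x - g x) \in Lfun mu 2%:E.
Proof.
move=> /Lfun2P[mf if2] /Lfun2P[mg ig2]; have mfg := measurable_funB mf mg.
apply/Lfun2P; split=> //.
apply: (integrable_dominated (g := fun x => 2 * f x ^+ 2 + 2 * g x ^+ 2)).
- exact: measurable_funX.
- move=> x; rewrite ger0_norm ?sqr_ge0//.
  by have := sqr_ge0 (f x + g x); rewrite !expr2; nra.
- by apply: real_integrableD; exact: real_integrableZl.
Qed.

(** By the inequality of Cauchy and Schwarz. Limits in the norm of L^2, in
    particular derivatives in time, thus become limits of numbers. *)
Lemma Lfun2_pair_cvg (I : Type) (F : set_system I) {FF : Filter F}
    (f_ : I -> T -> R) g :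
  (\near F, f_ F \in Lfun mu 2%:E) -> g \in Lfun mu 2%:E ->
  ('N[mu]_2%:E[EFin \o f_ i] @[i --> F] --> 0)%E ->
  \int[mu]_x (f_ i x * g x) @[i --> F] --> 0.
Proof.
move=> lf lg f0; have [r r0 gr] := Lfun2_norm_fin lg.
apply/cvgr0Pnorm_le => e e0.
have e1 : 0 < e / (r + 1) by rewrite divr_gt0// ltr_wpDl.
have := f0; move/fine_cvgP => [ffin] /cvgr0Pnorm_le /(_ _ e1) ne.
near=> i.
have lfi : f_ i \in Lfun mu 2%:E by near: i.
have := cauchy_schwarz lfi lg; rewrite gr.
have [s s0 fs] := Lfun2_norm_fin lfi.
rewrite fs -EFinM lee_fin => /le_trans; apply.
have : `|fine ('N[mu]_2%:E[EFin \o f_ i])%E| <= e / (r + 1) by near: i.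
rewrite fs/= ger0_norm// => sle.
rewrite (@le_trans _ _ (e / (r + 1) * r))// ?ler_wpM2r//.
rewrite mulrAC ler_pdivrMr ?ltr_wpDl// ler_wpM2l// ?ltW//.
by rewrite ltrDl.
Unshelve. all: by end_near. Qed.

End integration.

Section tensor.
Local Open Scope ereal_scope.
Context d1 d2 (T1 : measurableType d1) (T2 : measurableType d2) (R : realType).
Variable m1 : {sigma_finite_measure set T1 -> \bar R}.
Variable m2 : {sigma_finite_measure set T2 -> \bar R}.

Lemma integrable_tensor (f : T1 -> R) (g : T2 -> R) :
  m1.-integrable setT (EFin \o f) -> m2.-integrable setT (EFin \o g) ->
  (m1 \x m2).-integrable setT (fun p : T1 * T2 => (f p.1 * g p.2)%:E).
Proof.
move=> intf intg.
have mf := integrable_measurable intf; have mg := integrable_measurable intg.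
have mfg : measurable_fun setT (fun p : T1 * T2 => f p.1 * g p.2)%R.
  by apply: measurable_funM; exact: measurableT_comp.
apply/integrable12ltyP; first exact/measurable_EFinP.
under eq_integral => x _.
  under eq_integral => y _ do rewrite /= normrM EFinM.
  rewrite ge0_integralZl//; last first.
    by apply/measurable_EFinP; exact: measurableT_comp.
  over.
rewrite ge0_integralZr//; last 2 first.
- by apply/measurable_EFinP; exact: measurableT_comp.
- by apply: integral_ge0 => ? _; rewrite lee_fin.
case/integrableP : intf => _ if1; case/integrableP : intg => _ ig1.
by rewrite lte_mul_pinfty// ?ge0_fin_numE ?integral_ge0.
Qed.

End tensor.

Section lebesgue_rV_theory.
Context {R : realType}.
Implicit Types n : nat.

Local Notation lam n := (@lebesgue_rV R n).
Local Notation leb := (@lebesgue_measure R).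

Lemma integrable_cons n (f : 'rV[R]_n.+1 -> \bar R) :
  measurable_fun setT f ->
  (leb \x lam n)%E.-integrable setT (f \o @cons_rV R n) ->
  (lam n.+1).-integrable setT f.
Proof.
move=> mf intf.
by apply: integrable_pushforward => //; exact: measurable_cons_rV.
Qed.

Lemma integral_cons n (f : 'rV[R]_n.+1 -> \bar R) :
  measurable_fun setT f ->
  (leb \x lam n)%E.-integrable setT (f \o @cons_rV R n) ->
  (\int[lam n.+1]_x f x = \int[leb \x lam n]_p f (cons_rV p))%E.
Proof.
move=> mf intf.
by rewrite /= integral_pushforward//; exact: measurable_cons_rV.
Qed.

Definition behead_rV n (x : 'rV[R]_n.+1) : 'rV[R]_n :=
  \row_j x ord0 (lift ord0 j).

Lemma measurable_behead_rV n : measurable_fun setT (@behead_rV n).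
Proof.
apply: measurable_fun_rVP => i.
rewrite [X in measurable_fun _ X](_ : _ = rV_coord (lift ord0 i)).
  exact: measurable_rV_coord.
by apply/funext => x; rewrite /rV_coord /= mxE.
Qed.

(** Fubini for a product of a function of the first coordinate and a function of
    the others: the induction step of [Rintegral_prod]. *)
Lemma Rintegral_cons_mul n (f : R -> R) (g : 'rV[R]_n -> R) :
  leb.-integrable setT (EFin \o f) -> (lam n).-integrable setT (EFin \o g) ->
  let h := fun x : 'rV[R]_n.+1 => f (x ord0 ord0) * g (behead_rV x) in
  (lam n.+1).-integrable setT (EFin \o h) /\
  \int[lam n.+1]_x h x = (\int[leb]_y f y) * (\int[lam n]_v g v).
Proof.
move=> intf intg h.
have mf := integrable_measurable intf; have mg := integrable_measurable intg.
have mh : measurable_fun setT h.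
  apply: measurable_funM; apply: measurableT_comp => //.
    exact: (measurable_rV_coord ord0).
  exact: measurable_behead_rV.
have hE : h \o @cons_rV R n = fun p => f p.1 * g p.2.
  apply/funext => -[a v]; rewrite /h/=; congr (f _ * g _).
    by rewrite mxE unlift_none.
  by apply/rowP => j; rewrite !mxE liftK.
have ifg := integrable_tensor intf intg.
have ih : (leb \x lam n)%E.-integrable setT ((EFin \o h) \o @cons_rV R n).
  by rewrite -compA hE.
split; first by apply: integrable_cons => //; exact/measurable_EFinP.
rewrite {1}/Rintegral integral_cons//; last exact/measurable_EFinP.
rewrite (_ : (fun p => (EFin \o h) (cons_rV p)) =
    (fun p : R * 'rV[R]_n => (f p.1 * g p.2)%:E)); last first.
  by apply/funext => p; rewrite -[(EFin \o h) _]/(((h \o @cons_rV R n) p)%:E) hE.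
rewrite -integral12_prod_meas1// /fubini_F/=.
under eq_integral => x _.
  under eq_integral => y _ do rewrite /= EFinM.
  rewrite integralZl//. over.
have fg : (\int[lam n]_x (g x)%:E)%E \is a fin_num by exact: integrable_fin_num.
rewrite -(fineK fg) integralZr//= fineM//.
exact: integrable_fin_num.
Qed.

Lemma Rintegral_rV0 (f : 'rV[R]_0 -> R) : measurable_fun setT f ->
  (lam 0).-integrable setT (EFin \o f) /\ \int[lam 0]_x f x = f 0.
Proof.
move=> mf; have mf' : measurable_fun setT (EFin \o f) by exact/measurable_EFinP.
split; last by rewrite /Rintegral integral_dirac// diracT mul1e.
apply/integrableP; split => //.
rewrite integral_dirac// ?diracT ?mul1e ?ltry//; exact: measurableT_comp.
Qed.

Lemma measurable_prod_coord n (h : 'I_n -> R -> R) :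
  (forall i, measurable_fun setT (h i)) ->
  measurable_fun setT (fun x : 'rV[R]_n => \prod_i h i (x ord0 i)).
Proof.
move=> mh; apply: measurable_prod => i _.
by apply: measurableT_comp => //; exact: (measurable_rV_coord i).
Qed.

Lemma Rintegral_prod n (h : 'I_n -> R -> R) :
  (forall i, leb.-integrable setT (EFin \o h i)) ->
  let f := fun x : 'rV[R]_n => \prod_i h i (x ord0 i) in
  (lam n).-integrable setT (EFin \o f) /\
  \int[lam n]_x f x = \prod_i \int[leb]_y h i y.
Proof.
elim: n h => [|n IH] h ih f.
  have [|f1 f2] := @Rintegral_rV0 f.
    by apply: measurable_prod_coord => -[].
  by rewrite f2 /f !big_ord0.
have [ig Eg] := IH (fun i => h (lift ord0 i)) (fun i => ih _).
have [] := Rintegral_cons_mul (ih ord0) ig.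
rewrite Eg; set F := fun x => _.
rewrite (_ : F = f) ?big_ord_recl//.
apply/funext => x; rewrite /F /f big_ord_recl; congr (_ * _).
by apply: eq_bigr => i _; rewrite mxE.
Qed.

Lemma measurable_coord n (i : 'I_n) :
  measurable_fun setT (fun x : 'rV[R]_n => x ord0 i).
Proof. exact: (measurable_rV_coord i). Qed.

(** The sigma-algebra is generated by the coordinates, not by the open sets. A
    continuous [f] is the pointwise limit of its values at the lower corners of
    the cells of the grids of mesh [1 / (k + 1)], and these approximations take
    countably many values, each on a union of measurable boxes. *)
Lemma continuous_measurable_rV n (f : 'rV[R]_n -> R) :
  continuous f -> measurable_fun setT f.
Proof.
move=> cf.
pose q (k : nat) (x : 'rV[R]_n) : 'rV[int]_n :=
  \row_i Num.floor (k.+1%:R * x ord0 i).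
pose e (k : nat) (z : 'rV[int]_n) : 'rV[R]_n := \row_i ((z ord0 i)%:~R / k.+1%:R).
have mq k (z : 'rV[int]_n) : measurable (q k @^-1` [set z]).
  rewrite (_ : q k @^-1` _ = \bigcap_(i in [set: 'I_n])
     [set x | x ord0 i \in `[(z ord0 i)%:~R / k.+1%:R,
                             ((z ord0 i) + 1)%:~R / k.+1%:R[ ]).
    apply: fin_bigcap_measurable; first exact: finite_finset.
    move=> i _; rewrite -[X in measurable X]setTI.
    exact: (@measurable_coord n i measurableT `[_, _[%classic (measurable_itv _)).
  apply/seteqP; split=> x /=.
    move=> <- i _ /=; rewrite in_itv/= !mxE ler_pdivrMr// mulrC ltr_pdivlMr//.
    exact: floor_itv.
  move=> H; apply/rowP => i; rewrite !mxE; apply: floor_def.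
  have := H i I; rewrite /= in_itv/= ler_pdivrMr// ltr_pdivlMr//.
  by rewrite mulrC [X in X < _]mulrC.
apply: (measurable_fun_cvg (h := fun k => f \o e k \o q k)) => // [k|x _].
  move=> _ Y mY; rewrite setTI.
  rewrite (_ : _ @^-1` Y =
     \bigcup_(z in [set z | Y (f (e k z))]) (q k @^-1` [set z])).
    rewrite bigcup_mkcond; apply: countable_bigcupT_measurable => // z.
    by case: ifPn => // _; exact: mq.
  apply/seteqP; split=> x /=; first by move=> Yx; exists (q k x).
  by move=> [z Yz] /= ->.
apply: (@cvg_comp _ _ _ (fun k => e k (q k x)) f _ (nbhs x)); last exact: cf.
apply/cvg_ballP => eps eps0; near=> k; split=> // i j; rewrite (ord1 i) /ball/= !mxE.
have k0 : 0 < k.+1%:R :> R by [].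
have /andP[h1 h2] := floor_itv (k.+1%:R * x ord0 j).
have : k.+1%:R^-1 < eps by near: k; exact: (near_infty_natSinv_lt (PosNum eps0)).
set F := _%:~R in h1 *; rewrite intrD -/F in h2; apply: le_lt_trans.
have kn0 : k.+1%:R != 0 :> R by rewrite gt_eqF.
rewrite (_ : x 0 j - F / k.+1%:R = (k.+1%:R * x ord0 j - F) / k.+1%:R); last first.
  by field.
rewrite normrM normfV (gtr0_norm k0) -[leRHS]mul1r ler_wpM2r ?invr_ge0 ?ltW//.
by rewrite ger0_norm ?subr_ge0// ltrBlDr addrC.
Unshelve. all: by end_near. Qed.

End lebesgue_rV_theory.

(** * A system of ordinary differential inequalities *)

Section half_line.
Context {R : realType}.
Implicit Types f df : R -> R.

(** Continuity at [0] stands for a one-sided derivative there: it is all that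
    the mean value theorem on [[0, b]] asks for, and it leaves [df 0] free. *)
Definition half_line_derive f df :=
  (f x @[x --> 0^'+] --> f 0) /\ forall t : R, 0 < t -> is_derive t 1 f (df t).

Lemma half_line_cvg_left f df b : half_line_derive f df -> 0 < b ->
  f x @[x --> b^'-] --> f b.
Proof.
move=> [_ df_] b0; apply: cvg_at_left_filter.
apply: differentiable_continuous; apply/derivable1_diffP.
by have [] := df_ b b0.
Qed.

Lemma half_line_LRcontinuous f df a b : half_line_derive f df ->
  0 <= a -> a < b -> derivable_oo_LRcontinuous f a b.
Proof.
move=> fdf; have [f0 df_] := fdf => a0 ab; split.
- move=> t; rewrite in_itv/= => /andP[at_ _].
  by have [] := df_ t (le_lt_trans a0 at_).
- move: a0; rewrite le_eqVlt => /predU1P[<-//|a0].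
  apply: cvg_at_right_filter.
  apply: differentiable_continuous; apply/derivable1_diffP.
  by have [] := df_ a a0.
- exact: half_line_cvg_left fdf (le_lt_trans a0 ab).
Qed.

Lemma half_line_continuous f df a b : half_line_derive f df ->
  0 <= a -> a < b -> {within `[a, b], continuous f}.
Proof.
move=> h a0 ab; apply: derivable_oo_LRcontinuous_within.
exact: half_line_LRcontinuous h a0 ab.
Qed.

Lemma half_line_increment f df a b m : half_line_derive f df ->
  0 <= a -> a <= b -> (forall t, a < t -> t < b -> m <= df t) ->
  m * (b - a) <= f b - f a.
Proof.
move=> fdf a0; rewrite le_eqVlt => /predU1P[->|ab] mdf.
  by rewrite !subrr mulr0.
have [||c] := @MVT R f df a b ab.
- move=> x; rewrite in_itv/= => /andP[ax _].
  by apply: fdf.2; exact: le_lt_trans ax.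
- exact: half_line_continuous fdf a0 ab.
rewrite in_itv/= => /andP[ac cb] ->; rewrite ler_wpM2r ?mdf//.
by rewrite subr_ge0 ltW.
Qed.

Lemma half_line_deriveB f df g dg : half_line_derive f df ->
  half_line_derive g dg ->
  half_line_derive (fun t => f t - g t) (fun t => df t - dg t).
Proof.
move=> [f0 fd] [g0 gd]; split; first exact: cvgB.
by move=> t t0; have := fd t t0; have := gd t t0 => *; exact: is_deriveB.
Qed.

Lemma half_line_deriveD f df g dg : half_line_derive f df ->
  half_line_derive g dg ->
  half_line_derive (fun t => f t + g t) (fun t => df t + dg t).
Proof.
move=> [f0 fd] [g0 gd]; split; first exact: cvgD.
by move=> t t0; have := fd t t0; have := gd t t0 => *; exact: is_deriveD.
Qed.

Lemma half_line_deriveM f df g dg : half_line_derive f df ->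
  half_line_derive g dg ->
  half_line_derive (fun t => f t * g t) (fun t => f t * dg t + df t * g t).
Proof.
move=> [f0 fd] [g0 gd]; split; first exact: cvgM.
move=> t t0; have ? := fd t t0; have ? := gd t t0.
by apply: is_derive_eq; rewrite /GRing.scale/= [g t * _]mulrC.
Qed.

Lemma half_line_derive_eq f df dg : half_line_derive f df ->
  (forall t, 0 < t -> df t = dg t) -> half_line_derive f dg.
Proof.
by move=> [f0 fd] e; split=> // t t0; rewrite -e//; exact: fd.
Qed.

Lemma half_line_deriveX f df i : half_line_derive f df ->
  half_line_derive (fun t => f t ^+ i.+1) (fun t => i.+1%:R * f t ^+ i * df t).
Proof.
move=> fdf; elim: i => [|i IH].
  by apply: (half_line_derive_eq fdf) => t _; rewrite expr0 !mul1r.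
have := half_line_deriveM fdf IH.
rewrite (_ : (fun t => f t * f t ^+ i.+1) = (fun t => f t ^+ i.+2)); last first.
  by apply/funext => t; rewrite [RHS]exprS.
by move/half_line_derive_eq; apply => t _; rewrite !exprS -[in RHS]natr1; ring.
Qed.

Lemma half_line_derive_cst c : half_line_derive (fun=> c) (fun=> 0).
Proof. by split => [|t _]; [exact: cvg_cst | exact: is_derive_cst]. Qed.

Lemma half_line_deriveZ c f df : half_line_derive f df ->
  half_line_derive (fun t => c * f t) (fun t => c * df t).
Proof.
move=> h; have := half_line_deriveM (half_line_derive_cst c) h.
rewrite (_ : (fun t => c * df t + 0 * f t) = (fun t => c * df t))//.
by apply/funext => t; rewrite mul0r addr0.
Qed.

Lemma half_line_antiderivative f df : half_line_derive f df ->
  exists2 F, half_line_derive F f & F 0 = 0.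
Proof.
move=> fdf; pose F x := \int[lebesgue_measure]_(t in `[0, x]) f t.
have intf u : 0 < u -> lebesgue_measure.-integrable `[0, u] (EFin \o f).
  move=> u0; apply: continuous_compact_integrable; first exact: segment_compact.
  exact: half_line_continuous fdf _ u0.
have F0 : F 0 = 0 by rewrite /F set_itv1 Rintegral_set1.
exists F => //; split.
  rewrite F0; apply: cvg_at_right_filter.
  exact: (@parameterized_integral_cvg_left _ 0 1 f ltr01 (intf _ ltr01)).
move=> t t0.
have tt1 : t < t + 1 by rewrite ltrDl.
have [|dF F't] := @continuous_FTC1_closed _ f 0 t (t + 1) tt1
  (intf _ (addr_gt0 t0 ltr01)) t0.
  apply: differentiable_continuous; apply/derivable1_diffP.
  by have [] := fdf.2 t t0.
by rewrite -F't derive1E; exact: DeriveDef.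
Qed.

End half_line.

Section blowup.
Context {R : realType}.
Variables (mu sigma p nu c1 c2 c3 eps : R).
Variables (U U1 V D W g : nat -> R -> R) (k0 : nat).
Let r k : R := k.+1%:R.
Let q := (p - 1)^-1.
Let kappa := Num.max 1 (2 - 2 * sigma).
Hypotheses (mu_gt0 : 0 < mu) (sigma_gt0 : 0 < sigma) (p_gt1 : 1 < p).
Hypothesis p_crit : nu + kappa - 2 <= 2 * q.
Hypotheses (c1_ge0 : 0 <= c1) (c2_ge0 : 0 <= c2) (c3_ge0 : 0 <= c3).
Hypothesis eps_gt0 : 0 < eps.
Hypothesis dU : forall k, half_line_derive (U k) (U1 k).
Hypothesis dW : forall k, half_line_derive (W k) (fun t => g k t + D k t).
Hypothesis cD : forall k, exists D1, half_line_derive (D k) D1.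
Hypothesis WE : forall k t, 0 <= t -> W k t = U1 k t + mu * V k t.
Hypothesis U_ge0 : forall k t, 0 <= t -> 0 <= U k t.
Hypothesis D_ge : forall k t, 0 <= t -> - D k t <= c1 * r k ^- 2 * U k t.
Hypothesis V_le : forall k t, 0 <= t ->
  V k t <= c2 * r k `^ (- (2 * sigma)) * U k t.
Hypothesis g_ge0 : forall k t, 0 <= t -> 0 <= g k t.
Hypothesis g_mono : forall k l t, (k <= l)%N -> 0 <= t -> g k t <= g l t.
Hypothesis U_le : forall k t lam, 0 <= t -> 0 < lam ->
  U k t <= lam * g k t + lam `^ (- q) * c3 * r k `^ nu.
Hypothesis W0_ge : forall k, (k0 <= k)%N -> eps <= W k 0.

(* [T k] is the smallest time scale on which differentiating a cut-off in time
   costs at most [r^-2], both in the wave part ([T^-2 <= r^-2]) and in the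
   damping ([T^-1 r ^ (- 2 sigma) <= r^-2]). *)
Let T k := r k `^ kappa.
(* Testing with [s ^ m] costs up to two derivatives, and Young's inequality
   divides by [s ^ (2 q)]: the power of [s] left over must be nonnegative. *)
Let m0 := (Num.truncn (2 * q)).+1.
Let m := m0.+2.
Let s k t := 1 - t / T k.
(* [C0 r^-2 s ^ m0 U] bounds all the linear terms, and [C lam / T] is the error
   left when they are absorbed in [lam s ^ m g]. *)
Let C0 := c1 + mu * m%:R * c2 + m%:R * m%:R.
Let C lam := C0 * c3 * (lam / C0) `^ (- q).
(* An antiderivative of [s ^ m g] up to linear terms in [U], [V] and [D]: the
   term in [U] integrates by parts the derivative [U1] contained in [W]. *)
Let F k t := s k t ^+ m * W k t + (m%:R / T k * s k t ^+ m.-1) * U k t.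

Let q_gt0 : 0 < q. Proof. by rewrite invr_gt0 subr_gt0. Qed.
Let r_ge1 k : 1 <= r k. Proof. by rewrite /r ler1n. Qed.
Let r_gt0 k : 0 < r k. Proof. by rewrite /r. Qed.
Let kappa_ge1 : 1 <= kappa. Proof. by rewrite /kappa le_max lexx. Qed.
Let kappa_ge : 2 - 2 * sigma <= kappa.
Proof. by rewrite /kappa le_max lexx orbT. Qed.
Let T_gt0 k : 0 < T k. Proof. exact: powR_gt0. Qed.
Let m0_ge : 2 * q <= m0%:R.
Proof. by rewrite ltW// truncnS_gt. Qed.
Let C0_gt0 : 0 < C0.
Proof.
rewrite /C0 ltr_wpDl// ?addr_ge0// ?mulr_ge0// ?ltW//.
by rewrite mulr_gt0.
Qed.
Let C_ge0 lam : 0 <= C lam.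
Proof. by rewrite /C mulr_ge0 ?powR_ge0// mulr_ge0// ltW. Qed.

Let s_bnd k t : 0 < t -> t < T k -> 0 < s k t <= 1.
Proof.
move=> t0 tT; rewrite /s subr_gt0 ltr_pdivrMr// mul1r tT/= gerBl.
by rewrite divr_ge0// ltW.
Qed.

Let ds k : half_line_derive (s k) (fun=> - (T k)^-1).
Proof.
split.
  apply: cvg_at_right_filter; apply: cvgB; first exact: cvg_cst.
  by apply: cvgMl; exact: cvg_id.
move=> t t0; rewrite /s.
apply: is_derive_eq; rewrite /GRing.scale/=; ring.
Qed.

Let dsX k i : half_line_derive (fun t => s k t ^+ i.+1)
  (fun t => - (i.+1%:R / T k * s k t ^+ i)).
Proof.
apply: (half_line_derive_eq (half_line_deriveX i (ds k))) => t t0.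
by field; rewrite gt_eqF.
Qed.

Let F' k t := s k t ^+ m * g k t + s k t ^+ m * D k t
  - m%:R / T k * s k t ^+ m.-1 * (mu * V k t)
  - m%:R / T k * (m.-1%:R / T k) * s k t ^+ m0 * U k t.

Let dF k : exists F1 : R -> R, half_line_derive (F k) F1 /\  forall t, 0 < t -> F1 t = F' k t.
Proof.
eexists; split.
  apply: half_line_deriveD; first by apply: half_line_deriveM; [exact: dsX|exact: dW].
  apply: half_line_deriveM; last exact: dU.
  by apply: half_line_deriveZ; exact: dsX.
move=> t t0 /=; rewrite WE ?(ltW t0)// /F' /m /=; ring.
Qed.

(** Young's inequality with the parameter [lam r^2 s^2 / C0], chosen so that the
    coefficient of [g] is [lam s ^ m]. The remaining power of [r] is
    [nu - 2 - 2 q], which is at most [- kappa] by [p_crit]. *)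
Let loss k t lam : 0 < t -> t < T k -> 0 < lam ->
  C0 * r k ^- 2 * s k t ^+ m0 * U k t <= lam * (s k t ^+ m * g k t) + C lam / T k.
Proof.
move=> t0 tT lam0; have /andP[s0 s1] := s_bnd t0 tT.
have r2 : 0 < r k ^+ 2 by rewrite exprn_gt0.
have l0 : 0 < lam * r k ^+ 2 * s k t ^+ 2 / C0.
  by rewrite divr_gt0// mulr_gt0 ?exprn_gt0// mulr_gt0.
have := U_le k (ltW t0) l0.
have A0 : 0 < C0 * r k ^- 2 * s k t ^+ m0.
  by rewrite mulr_gt0 ?exprn_gt0// mulr_gt0// invr_gt0.
rewrite -(ler_pM2l A0) => /le_trans; apply.
rewrite mulrDr; apply: lerD.
  rewrite le_eqVlt; apply/orP; left; apply/eqP; rewrite /m !exprS.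
  by field; rewrite !gt_eqF.
rewrite /C (_ : _ * s k t ^+ 2 / C0 = (lam / C0) * (r k ^+ 2 * s k t ^+ 2)); last first.
  by field; rewrite gt_eqF.
have s2 : 0 < s k t ^+ 2 by rewrite exprn_gt0.
rewrite powRM ?(ltW (divr_gt0 lam0 C0_gt0)) ?(ltW (mulr_gt0 r2 s2))//.
rewrite powRM ?(ltW r2) ?(ltW s2)//.
rewrite -!powR_mulrn ?(ltW s0) ?(ltW (r_gt0 k))// -!powRrM.
rewrite -powRN /T -powRN.
set L := (lam / C0) `^ (- q).
rewrite (_ : _ * _ * _ * (_ * _ * _ * _) =
   C0 * c3 * L * (r k `^ (- 2%:R) * r k `^ (2%:R * - q) * r k `^ nu) *
   (s k t `^ m0%:R * s k t `^ (2%:R * - q))); last by ring.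
rewrite -!powRD ?(gt_eqF (r_gt0 k)) ?implybT ?(gt_eqF s0) ?implybT//.
have L0 : 0 <= C0 * c3 * L by rewrite mulr_ge0 ?powR_ge0// mulr_ge0// (ltW C0_gt0).
rewrite -[leRHS]mulr1; apply: ler_pM.
- by rewrite mulr_ge0 ?powR_ge0.
- exact: powR_ge0.
- rewrite ler_wpM2l// ler_powR//; have := p_crit.
  by move: (kappa) (q) (nu) => a b c ?; lra.
- rewrite -[leRHS](powRr0 (s k t)) ger_powR ?s0//; have := m0_ge.
  by move: (q) (m0%:R) => a b ?; lra.
Qed.

Let F'_ge k t lam : 0 < t -> t < T k -> 0 < lam ->
  (1 - lam) * (s k t ^+ m * g k t) - C lam / T k <= F' k t.
Proof.
move=> t0 tT lam0; have L := loss t0 tT lam0; have /andP[s0 s1] := s_bnd t0 tT.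
have t0' := ltW t0; have U0 := U_ge0 k t0'.
have r1 := r_ge1 k; have r0 := r_gt0 k.
have sm1 : s k t ^+ m.-1 <= s k t ^+ m0.
  by rewrite /m/= exprS ler_piMl// exprn_ge0// ltW.
have sm2 : s k t ^+ m <= s k t ^+ m0.
  by rewrite /m exprS (le_trans _ sm1)// ler_piMl// exprn_ge0// ltW.
have sm00 : 0 <= s k t ^+ m0 by rewrite exprn_ge0// ltW.
have r2 : r k ^- 2 = r k `^ (- 2%:R) by rewrite powR_invn// ltW.
have B1 : s k t ^+ m * - D k t <= c1 * r k ^- 2 * s k t ^+ m0 * U k t.
  apply: (@le_trans _ _ (s k t ^+ m * (c1 * r k ^- 2 * U k t))).
    by rewrite ler_wpM2l ?D_ge// exprn_ge0// ltW.
  rewrite (_ : c1 * _ * _ * _ = s k t ^+ m0 * (c1 * r k ^- 2 * U k t)); last by ring.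
  by rewrite ler_wpM2r// mulr_ge0// mulr_ge0// invr_ge0 exprn_ge0// (ltW r0).
have B2 : m%:R / T k * s k t ^+ m.-1 * (mu * V k t) <=
    mu * m%:R * c2 * r k ^- 2 * s k t ^+ m0 * U k t.
  rewrite (_ : _ * (mu * V k t) = mu * m%:R * s k t ^+ m.-1 / T k * V k t); last by ring.
  have P : 0 <= mu * m%:R * s k t ^+ m.-1 / T k.
    apply: divr_ge0 (ltW (T_gt0 k)); apply: mulr_ge0; last exact: exprn_ge0 (ltW s0).
    exact: mulr_ge0 (ltW mu_gt0) _.
  apply: (le_trans (ler_wpM2l P (V_le k t0'))).
  rewrite [leLHS](_ : _ = mu * m%:R * c2 * U k t *
    (s k t ^+ m.-1 * ((T k)^-1 * r k `^ (- (2 * sigma))))); last by ring.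
  rewrite [leRHS](_ : _ = mu * m%:R * c2 * U k t * (s k t ^+ m0 * r k ^- 2)); last by ring.
  apply: ler_wpM2l; first by rewrite !mulr_ge0// (ltW mu_gt0).
  apply: ler_pM => //; first by rewrite exprn_ge0// (ltW s0).
    by rewrite mulr_ge0 ?powR_ge0// invr_ge0 (ltW (T_gt0 k)).
  rewrite r2 /T -powRN -powRD ?(gt_eqF r0) ?implybT// ler_powR//.
  by have := kappa_ge; move: (kappa) => a ?; lra.
have B3 : m%:R / T k * (m.-1%:R / T k) * s k t ^+ m0 * U k t <=
    m%:R * m%:R * r k ^- 2 * s k t ^+ m0 * U k t.
  rewrite [leLHS](_ : _ = m%:R * (s k t ^+ m0 * U k t) *
    (m.-1%:R * ((T k)^-1 * (T k)^-1))); last by ring.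
  rewrite [leRHS](_ : _ = m%:R * (s k t ^+ m0 * U k t) * (m%:R * r k ^- 2)); last by ring.
  apply: ler_wpM2l; first by rewrite !mulr_ge0.
  apply: ler_pM => //; first by rewrite mulr_ge0// invr_ge0 (ltW (T_gt0 k)).
    by rewrite ler_nat leq_pred.
  rewrite r2 /T -powRN -powRD ?(gt_eqF r0) ?implybT// ler_powR//.
  by have := kappa_ge1; move: (kappa) => a ?; lra.
have E : C0 * r k ^- 2 * s k t ^+ m0 * U k t =
    c1 * r k ^- 2 * s k t ^+ m0 * U k t +
    mu * m%:R * c2 * r k ^- 2 * s k t ^+ m0 * U k t +
    m%:R * m%:R * r k ^- 2 * s k t ^+ m0 * U k t by rewrite /C0; ring.
rewrite mulrN in B1; rewrite /F' mulrBl mul1r; move: L B1 B2 B3; rewrite {}E.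
move: (c1 * _ * _ * _) (mu * m%:R * _ * _ * _ * _) (m%:R * m%:R * _ * _ * _) => x y z.
move: (s k t ^+ m * D k t) (m%:R / _ * _ * (mu * _)) (m%:R / _ * _ * _ * _) => x' y' z'.
move: (C lam / _) (s k t ^+ m * _) => b c *; lra.
Qed.

Let F_increment k a b lam : 0 <= a -> a <= b -> b <= T k -> 0 < lam ->
  (forall t, a < t -> t < b -> (1 - lam) * (s k t ^+ m * g k t) >= 0) ->
  - (C lam / T k) * (b - a) <= F k b - F k a.
Proof.
move=> a0 ab bT lam0 pos; have [F1 [dF1 F1E]] := dF k.
apply: (half_line_increment dF1 a0 ab) => t at_ tb.
have t0 := le_lt_trans a0 at_; rewrite F1E//.
have := F'_ge t0 (lt_le_trans tb bT) lam0; apply: le_trans.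
by rewrite lerDr pos.
Qed.

(** Antiderivatives [G] keep the argument within derivatives, without integrals
    in time. The sign of [c] is free: [c > 0] extracts a bound on [g], and
    [c < 0] spends one. *)
Let F_G_increment k G a b lam c : half_line_derive G (g k) ->
  0 <= a -> a <= b -> b <= T k -> 0 < lam ->
  (forall t, a < t -> t < b -> c * g k t <= (1 - lam) * (s k t ^+ m * g k t)) ->
  - (C lam / T k) * (b - a) + c * (G b - G a) <= F k b - F k a.
Proof.
move=> dG a0 ab bT lam0 pos; have [F1 [dF1 F1E]] := dF k.
have dH := half_line_deriveB dF1 (half_line_deriveZ c dG).
have : - (C lam / T k) * (b - a) <= (F k b - c * G b) - (F k a - c * G a).
  apply: (half_line_increment dH a0 ab) => t at_ tb.
  have t0 := le_lt_trans a0 at_; rewrite F1E//.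
  have := F'_ge t0 (lt_le_trans tb bT) lam0; have := pos t at_ tb.
  move: (c * _) ((1 - lam) * _) (C lam / _) => *; lra.
move: (- _ * _) => *; lra.
Qed.

Let F0 k : (k0 <= k)%N -> eps <= F k 0.
Proof.
move=> k0k; rewrite /F /s mul0r subr0 !expr1n mul1r mulr1.
by rewrite (le_trans (W0_ge k0k))// lerDl mulr_ge0 ?U_ge0// divr_ge0// (ltW (T_gt0 k)).
Qed.

Let FT k : F k (T k) = 0.
Proof.
by rewrite /F /s divff ?(gt_eqF (T_gt0 k))// subrr /m/= !expr0n/= mul0r mulr0 mul0r addr0.
Qed.

Let T_unbounded A : exists l, forall k, (l <= k)%N -> A <= T k.
Proof.
exists (Num.truncn `|A|) => k lk.
apply: le_trans (ler_norm A) _.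
apply: (@le_trans _ _ (r k)).
  by rewrite ltW// (lt_le_trans (truncnS_gt _))// /r ler_nat.
by rewrite -[leLHS]powRr1 ?(ltW (r_gt0 k))// /T ler_powR.
Qed.

(** [g] is not assumed continuous, but it is [W' - D], and [D] has an
    antiderivative since it is differentiable. *)
Let G_exists k : exists G, half_line_derive G (g k) /\ G 0 = 0.
Proof.
have [D1 dD] := cD k; have [I dI I0] := half_line_antiderivative dD.
exists (fun t => W k t - W k 0 - I t); split; last by rewrite subrr I0 subr0.
apply: half_line_derive_eq.
  apply: half_line_deriveB dI; apply: half_line_deriveB (dW k) _.
  exact: half_line_derive_cst.
by move=> t _ /=; rewrite subr0 addrK.
Qed.

Let C_small e : 0 < e -> exists2 lam, 1 <= lam & C lam <= e.
Proof.
move=> e0; pose A := C0 * c3 + 1.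
have Cc : 0 <= C0 * c3 by rewrite mulr_ge0// (ltW C0_gt0).
have A0 : 0 < A by rewrite ltr_wpDl.
pose B := (A / e) `^ q^-1; have B0 : 0 < B by rewrite powR_gt0// divr_gt0.
exists (Num.max 1 (C0 * B)); first by rewrite le_max lexx.
set lam := Num.max _ _; have lamB : B <= lam / C0.
  by rewrite ler_pdivlMr// mulrC /lam le_max lexx orbT.
have Bq : B `^ q = A / e.
  by rewrite /B -powRrM mulVf ?(gt_eqF q_gt0)// powRr1// divr_ge0// ltW.
have H : (lam / C0) `^ (- q) <= e / A.
  rewrite powRN -[leRHS]invf_div lef_pV2 ?posrE ?divr_gt0//; last first.
    by rewrite powR_gt0// (lt_le_trans B0).
  rewrite -Bq ge0_ler_powR ?nnegrE ?(ltW q_gt0) ?(ltW B0)//.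
  exact: le_trans (ltW B0) lamB.
apply: (le_trans (ler_wpM2l Cc H)).
by rewrite mulrA ler_pdivrMr// mulrC ler_wpM2l ?(ltW e0)// /A lerDl.
Qed.

(** The integrals [E k] of [g k] over [[0, T k / 2]] are bounded. At the critical
    exponent this is not yet contradictory, since the error [C lam] does not
    decay with [k]. By monotonicity in [k], their supremum is nearly reached on
    some fixed interval [[0, K]], simultaneously for all large [k]; on [[K, T k]]
    little of [g k] is left, and a large [lam] can be afforded. *)
Lemma no_global_growth : False.
Proof.
have /choice[G GP] := G_exists.
have dG k := (GP k).1; have G0 k := (GP k).2.
have G_incr k l a b : (k <= l)%N -> 0 <= a -> a <= b ->
    G k b - G k a <= G l b - G l a.
  move=> kl a0 ab; have dH := half_line_deriveB (dG l) (dG k).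
  have := @half_line_increment _ _ _ a b 0 dH a0 ab.
  rewrite mul0r => /(_ _)/wrap[|]; last by lra.
  by move=> t at_ _; rewrite subr_ge0 g_mono// ltW// (le_lt_trans a0).
have G_nd k a b : 0 <= a -> a <= b -> G k a <= G k b.
  move=> a0 ab; rewrite -subr_ge0 -(mul0r (b - a)).
  apply: (half_line_increment (dG k) a0 ab) => t at_ _.
  by rewrite g_ge0// ltW// (le_lt_trans a0).
(* Boundedness of [E]: [lam = 1 / 2] leaves half of [s ^ m g], and [s >= 1 / 2]
   on the first half of [[0, T]]. *)
have half0 : 0 < 2^-1 :> R by rewrite invr_gt0.
have C1_ge0 := C_ge0 2^-1; set C1 := C 2^-1 in C1_ge0.
pose E k := G k (T k / 2).
have T2 k : 0 <= T k / 2 by rewrite divr_ge0// (ltW (T_gt0 k)).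
have T21 k : T k / 2 <= T k by have := T_gt0 k; move: (T k) => *; lra.
have E_bnd k : (k0 <= k)%N -> E k <= 2 ^+ m.+1 * C1.
  move=> k0k.
  have h1 := @F_G_increment k (G k) 0 (T k / 2) 2^-1 (2 ^- m.+1) (dG k) (lexx 0) (T2 k)
     (T21 k) half0.
  have h2 := @F_increment k (T k / 2) (T k) 2^-1 (T2 k) (T21 k) (lexx _) half0.
  have {}h1 : - (C1 / T k) * (T k / 2) + 2 ^- m.+1 * E k <= F k (T k / 2) - F k 0.
    move: h1; rewrite subr0 G0 subr0; apply => t t0 tT.
    have -> : 1 - 2^-1 = 2^-1 :> R by lra.
    rewrite mulrA ler_wpM2r ?g_ge0 ?(ltW t0)// exprS invfM ler_wpM2l ?invr_ge0//.
    rewrite -exprVn lerXn2r ?nnegrE ?invr_ge0//.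
      have /andP[s0 _] := s_bnd t0 (lt_le_trans tT (T21 k)); exact: ltW.
    rewrite /s lerBrDr -lerBrDl ler_pdivrMr//.
    have -> : 1 - 2^-1 = 2^-1 :> R by lra.
    by rewrite mulrC ltW.
  have {}h2 : - (C1 / T k) * (T k - T k / 2) <= F k (T k) - F k (T k / 2).
    apply: h2 => t t0 tT; have -> : 1 - 2^-1 = 2^-1 :> R by lra.
    have t0' := le_lt_trans (T2 k) t0.
    have /andP[s0 _] := s_bnd t0' tT.
    by rewrite mulr_ge0// mulr_ge0 ?g_ge0 ?(ltW t0')// exprn_ge0// (ltW s0).
  have := F0 k0k; rewrite FT in h2.
  have e1 : (C1 / T k) * (T k / 2) = C1 / 2 by field; rewrite (gt_eqF (T_gt0 k)).
  have e2 : (C1 / T k) * (T k - T k / 2) = C1 / 2 by field; rewrite (gt_eqF (T_gt0 k)).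
  rewrite mulNr e1 in h1; rewrite mulNr e2 in h2 => h3.
  have : 2 ^- m.+1 * E k <= C1 by move: (2 ^- _ * _) h1 eps_gt0 => *; lra.
  by rewrite mulrC ler_pdivrMr ?exprn_gt0// mulrC.
pose S := [set E k | k in [set k | (k0 <= k)%N]].
have supS : has_sup S.
  split; first by exists (E k0), k0 => /=.
  by exists (2 ^+ m.+1 * C1) => _ [k /= k0k <-]; exact: E_bnd.
(* The contradiction splits [[0, T k]] at [K]; each of the three error terms
   [h3], [h4] and [h5] uses up a quarter of [eps]. *)
have e4 : 0 < eps / 4 by rewrite divr_gt0.
have [lam lam1 Clam] := C_small e4.
have lam0 : 0 < lam by apply: lt_le_trans lam1.
have d0 : 0 < eps / 4 / lam by rewrite divr_gt0.
have [_ [k1 /= k01 <-] Ek1] := sup_adherent d0 supS.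
pose K := T k1 / 2.
have K0 : 0 <= K := T2 k1.
have [l1 l1P] := T_unbounded (Num.max K (C1 * K / (eps / 4))).
pose k := maxn k1 l1.
have k1k : (k1 <= k)%N by rewrite leq_maxl.
have := l1P k (leq_maxr _ _); rewrite ge_max => /andP[KT CKT].
have [l2 l2P] := T_unbounded (T k * 2).
(* [g k] has little mass on [[0, T k]] because [g k'] has little on
   [[0, T k' / 2]], for [k'] so large that the second interval contains the first. *)
pose k' := maxn k l2.
have kk' : (k <= k')%N by rewrite leq_maxl.
have Tk' : T k <= T k' / 2.
  by have := l2P k' (leq_maxr _ _); rewrite ler_pdivlMr.
have GT : G k (T k) <= sup S.
  have := G_incr k k' 0 (T k) kk' (lexx _) (ltW (T_gt0 k)); rewrite !G0 !subr0.
  move=> /le_trans; apply; apply: (le_trans (G_nd k' _ _ (ltW (T_gt0 k)) Tk')).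
  apply: (sup_upper_bound supS); exists k' => //=.
  by rewrite (leq_trans k01)// (leq_trans k1k).
have GK : sup S - eps / 4 / lam < G k K.
  apply: (lt_le_trans Ek1).
  by have := G_incr k1 k 0 K k1k (lexx _) K0; rewrite !G0 !subr0.
have h1 : - (C1 / T k) * K <= F k K - F k 0.
  have := @F_increment k 0 K 2^-1 (lexx _) K0 KT half0; rewrite subr0; apply.
  move=> t t0 tK; have -> : 1 - 2^-1 = 2^-1 :> R by lra.
  have /andP[s0 _] := s_bnd t0 (lt_le_trans tK KT).
  by rewrite mulr_ge0// mulr_ge0 ?g_ge0 ?(ltW t0)// exprn_ge0// (ltW s0).
have h2 : - (C lam / T k) * (T k - K) + - lam * (G k (T k) - G k K) <= F k (T k) - F k K.
  apply: (F_G_increment (dG k)) => // t Kt tT.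
  have t0 := le_lt_trans K0 Kt; have /andP[s0 s1] := s_bnd t0 tT.
  rewrite mulrA ler_wpM2r ?g_ge0 ?(ltW t0)//.
  have : s k t ^+ m <= 1 by rewrite exprn_ile1// ltW.
  have : 0 <= s k t ^+ m by rewrite exprn_ge0// ltW.
  move: (s k t ^+ m) => z z0 z1; nra.
have h3 : C lam / T k * (T k - K) <= eps / 4.
  apply: le_trans Clam; rewrite mulrAC ler_pdivrMr// ler_wpM2l ?C_ge0//.
  by rewrite gerBl.
have h4 : C1 / T k * K <= eps / 4.
  rewrite mulrAC ler_pdivrMr//; move: CKT; rewrite ler_pdivrMr//.
  by rewrite [leRHS]mulrC.
have h5 : lam * (G k (T k) - G k K) <= eps / 4.
  rewrite mulrC -ler_pdivlMr//; move: (eps / 4 / lam) GT GK => *; lra.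
have h6 := F0 (leq_trans k01 k1k); rewrite FT in h2.
rewrite !mulNr in h1 h2.
move: h1 h2 h3 h4 h5 h6.
move: (C1 / _ * _) (C lam / _ * _) (lam * _) eps_gt0 => *; lra.
Qed.

End blowup.

(** * Gaussian integrals *)

Section gaussian1.
Context {R : realType}.
Local Notation leb := (@lebesgue_measure R).

Definition gauss1 (b y : R) : R := expR (- (b * y ^+ 2)).

Let ltr0n2 : (0 : R) < 2. Proof. by []. Qed.

Lemma gauss1_gt0 b y : 0 < gauss1 b y. Proof. exact: expR_gt0. Qed.

Lemma continuous_gauss1 b : continuous (gauss1 b).
Proof.
move=> y; apply: continuous_comp; last exact: continuous_expR.
apply: cvgN; apply: cvgMr; exact: exprn_continuous.
Qed.

Lemma measurable_gauss1 b : measurable_fun setT (gauss1 b).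
Proof. by apply: continuous_measurable_fun; exact: continuous_gauss1. Qed.

Lemma lebesgue_integrable_dominated (f g : R -> R) : continuous f ->
  (forall y, `|f y| <= g y) -> leb.-integrable setT (EFin \o g) ->
  leb.-integrable setT (EFin \o f).
Proof.
move=> cf fg; apply: (@integrable_dominated _ _ R leb _ g) => //.
exact: continuous_measurable_fun.
Qed.

Lemma lebesgue_integrableZl (f : R -> R) (c : R) : leb.-integrable setT (EFin \o f) ->
  leb.-integrable setT (EFin \o (fun y => c * f y)).
Proof.
exact: (@real_integrableZl _ _ R leb).
Qed.

Lemma is_derive_gauss1 (b y : R) :
  is_derive y 1 (gauss1 b) (- (2 * b * y) * gauss1 b y).
Proof.
have h : is_derive y 1 (fun z : R => - (b * z ^+ 2)) (- (2 * b * y)).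
  have h2 : is_derive y 1 (fun z : R => - (b * (z * z))) (- (2 * b * y)).
    by apply: is_derive_eq; rewrite /GRing.scale/=; ring.
  exact: h2.
have := is_derive1_comp (f := expR) (g := fun z : R => - (b * z ^+ 2)).
move=> /(_ y _ _ _ h); rewrite -/(gauss1 b _) mulrC; apply.
Qed.

Lemma integral_gauss1 b : 0 < b ->
  leb.-integrable setT (EFin \o gauss1 b) /\
  \int[leb]_y gauss1 b y = Num.sqrt (pi / b).
Proof.
move=> b0; pose s : R := Num.sqrt (2 * b)^-1.
have s2 : s ^+ 2 = (2 * b)^-1 by rewrite sqr_sqrtr// invr_ge0 mulr_ge0// ltW.
have s0 : 0 < s by rewrite sqrtr_gt0 invr_gt0 mulr_gt0.
have sn0 : s != 0 by rewrite gt_eqF.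
have E y : gauss1 b y = Num.sqrt (pi / b) * normal_pdf 0 s y.
  rewrite normal_pdfE// /normal_peak /normal_fun subr0 s2.
  have -> : (2 * b)^-1 * pi *+ 2 = pi / b :> R by rewrite -mulr_natl; field; lra.
  rewrite mulrA divff ?mul1r; last first.
    by rewrite gt_eqF// sqrtr_gt0 divr_gt0// pi_gt0.
  congr expR; rewrite -[_^-1 *+ 2]mulr_natl; field; lra.
have ip := @integrable_normal_pdf R 0 s.
have -> : gauss1 b = fun y => Num.sqrt (pi / b) * normal_pdf 0 s y.
  by apply/funext => y.
split.
  rewrite (_ : EFin \o _ = fun y => ((Num.sqrt (pi / b))%:E * (normal_pdf 0 s y)%:E)%E).
    exact: integrableZl.
  by apply/funext.
by rewrite RintegralZl// /Rintegral integral_normal_pdf mulr1.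
Qed.

(** Halving the exponent of a Gaussian pays for polynomial factors. *)
Lemma sqr_gauss1_le b y : 0 < b ->
  (1 + y ^+ 2) * gauss1 b y <= (1 + 2 / b) * gauss1 (b / 2) y.
Proof.
move=> b0; have -> : gauss1 b y = gauss1 (b / 2) y * gauss1 (b / 2) y.
  by rewrite /gauss1 -expRD; congr expR; field.
rewrite mulrA ler_wpM2r ?(ltW (gauss1_gt0 _ _))//.
rewrite {1}/gauss1 expRN ler_pdivrMr ?expR_gt0//.
have h : 1 + b / 2 * y ^+ 2 <= expR (b / 2 * y ^+ 2) by exact: expR_ge1Dx.
have b1 : 0 <= 1 + 2 / b by rewrite addr_ge0// divr_ge0// ltW.
apply: le_trans (ler_wpM2l b1 h).
have -> : (1 + 2 / b) * (1 + b / 2 * y ^+ 2) =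
   1 + y ^+ 2 + (2 / b + b / 2 * y ^+ 2) by field; lra.
rewrite lerDl; apply: addr_ge0; first by rewrite divr_ge0 ?(ltW b0).
by rewrite mulr_ge0 ?sqr_ge0// divr_ge0 ?(ltW b0).
Qed.

Lemma Rintegral_derive0 (F f G : R -> R) :
  (forall y : R, is_derive y 1 F (f y)) -> continuous f ->
  leb.-integrable setT (EFin \o G) -> (forall y, `|f y| <= G y) ->
  F n%:R @[n --> \oo] --> 0 -> F (- n%:R) @[n --> \oo] --> 0 ->
  \int[leb]_y f y = 0.
Proof.
move=> dF cf iG fG Fy FNy.
pose fn n y := f y * \1_(`[- n%:R, n%:R]%classic : set R) y.
have mfn n : measurable_fun setT (fn n).
  by apply: measurable_funM; [exact: continuous_measurable_fun | exact: measurable_indic].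
have [|y|n y||_ cvgI] := @Rintegral_dct _ _ R leb fn f G.
- exact: mfn.
- apply: cvg_near_cst; near=> n.
  rewrite /fn indicE mem_set ?mulr1//= in_itv/= -ler_norml ltW//.
  apply: (lt_le_trans (truncnS_gt _)); rewrite ler_nat; near: n.
  exact: nbhs_infty_ge.
- rewrite /fn normrM; apply: le_trans (fG y).
  by rewrite ler_piMr// indicE; case: (_ \in _); rewrite ?normr1 ?normr0.
- exact: iG.
have E n : \int[leb]_y fn n.+1 y = F n.+1%:R - F (- n.+1%:R).
  have n0 : - n.+1%:R < n.+1%:R :> R.
    by apply: (@lt_trans _ _ 0); rewrite ?oppr_lt0 ltr0n.
  have := @continuous_FTC2 R f F (- n.+1%:R) n.+1%:R n0.
  have dc t : {for t, continuous F}.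
    apply: differentiable_continuous; apply/derivable1_diffP.
    by have [] := dF t.
  move=> H; rewrite /Rintegral.
  have -> : (\int[leb]_y (fn n.+1 y)%:E)%E =
      (\int[leb]_(y in `[(- n.+1%:R)%R, n.+1%:R]) (f y)%:E)%E.
    rewrite [RHS]integral_mkcond; apply: eq_integral => y _.
    by rewrite patchE /fn indicE; case: ifPn; rewrite ?mulr1 ?mulr0.
  rewrite H//.
  - exact: continuous_subspaceT.
  - split => [t _||]; first by have [] := dF t.
      exact/cvg_at_right_filter/dc.
    exact/cvg_at_left_filter/dc.
  - by move=> t _; rewrite derive1E; have [] := dF t.
have h1 : (\int[leb]_y fn n.+1 y) @[n --> \oo] --> \int[leb]_y f y.
  by rewrite (cvg_shiftS (fun n => \int[leb]_y fn n y)).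
have Fy' : F n.+1%:R @[n --> \oo] --> (0 : R) by rewrite (cvg_shiftS (fun n => F n%:R)).
have FNy' : F (- n.+1%:R) @[n --> \oo] --> (0 : R).
  by rewrite (cvg_shiftS (fun n => F (- n%:R))).
have h2 : (\int[leb]_y fn n.+1 y) @[n --> \oo] --> (0 - 0 : R).
  rewrite (_ : (fun n => _) = (fun n => F n.+1%:R - F (- n.+1%:R))).
    exact: cvgB.
  by apply/funext => n; exact: E.
by rewrite -(cvg_lim _ h1)// (cvg_lim _ h2)// subr0.
Unshelve. all: by end_near. Qed.

Lemma norm_gauss1_le b y : 0 < b -> `|y| * gauss1 b y <= (1 + 2 / b) * gauss1 (b / 2) y.
Proof.
move=> b0; apply: le_trans (sqr_gauss1_le y b0).
rewrite ler_wpM2r ?(ltW (gauss1_gt0 _ _))//.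
have : 0 <= (`|y| - 1) ^+ 2 by exact: sqr_ge0.
have : `|y| ^+ 2 = y ^+ 2 by rewrite real_normK// num_real.
have : 0 <= `|y| by [].
move: (`|y|) (y ^+ 2) => u v; rewrite sqrrB mulr1 expr1n => *.
nra.
Qed.

Lemma cvg_gauss1_0 b : 0 < b -> gauss1 b n%:R @[n --> \oo] --> 0.
Proof.
move=> b0; apply/cvgr0Pnorm_le => e e0; near=> n.
rewrite ger0_norm ?(ltW (gauss1_gt0 _ _))//.
have n0 : 0 < n%:R :> R by rewrite ltr0n; near: n; exact: nbhs_infty_gt.
have n1 : 1 <= n%:R :> R by rewrite ler1n -(ltr0n R).
have bn : 0 < b * n%:R ^+ 2 by rewrite mulr_gt0// exprn_gt0.
rewrite /gauss1 expRN -[e]invrK lef_pV2 ?posrE ?expR_gt0 ?invr_gt0//.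
apply: le_trans (expR_ge1Dx _).
have h : (e * b)^-1 <= n%:R.
  apply: (@le_trans _ _ (Num.truncn (e * b)^-1).+1%:R); first exact/ltW/truncnS_gt.
  by rewrite ler_nat; near: n; exact: nbhs_infty_ge.
have h2 : (e * b)^-1 <= n%:R ^+ 2.
  by apply: le_trans h _; rewrite expr2 ler_peMr// ltW.
have : b * (e * b)^-1 <= b * n%:R ^+ 2 by rewrite ler_wpM2l// ltW.
have -> : b * (e * b)^-1 = e^-1 by field; rewrite !gt_eqF.
by move/le_trans; apply; rewrite lerDr.
Unshelve. all: by end_near. Qed.

Lemma is_derive_cos_affine (x t y : R) :
  is_derive y 1 (fun z => cos (x * z + t)) (- x * sin (x * y + t)).
Proof.
have h : is_derive y 1 (fun z : R => x * z + t) x.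
  by apply: is_derive_eq; rewrite /GRing.scale/=; ring.
have := is_derive1_comp (f := cos) (g := fun z : R => x * z + t).
by move=> /(_ y _ _ _ h); rewrite mulNr mulrC -mulNr; apply.
Qed.

Lemma is_derive_sin_affine (x t y : R) :
  is_derive y 1 (fun z => sin (x * z + t)) (x * cos (x * y + t)).
Proof.
have h : is_derive y 1 (fun z : R => x * z + t) x.
  by apply: is_derive_eq; rewrite /GRing.scale/=; ring.
have := is_derive1_comp (f := sin) (g := fun z : R => x * z + t).
by move=> /(_ y _ _ _ h); rewrite mulrC; apply.
Qed.

Lemma normr_cos_le1 (x : R) : `|cos x| <= 1.
Proof. by rewrite ler_norml cos_geN1 cos_le1. Qed.

Lemma normr_sin_le1 (x : R) : `|sin x| <= 1.
Proof. by rewrite ler_norml sin_geN1 sin_le1. Qed.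

Lemma continuous_affine (x t : R) : continuous (fun y : R => x * y + t).
Proof. by move=> y; apply: cvgD; [apply: cvgMr; exact: cvg_id|exact: cvg_cst]. Qed.

Lemma continuous_cos_affine (x t : R) : continuous (fun y : R => cos (x * y + t)).
Proof.
move=> y; apply: (@continuous_comp _ _ _ (fun y : R => x * y + t) cos).
  exact: continuous_affine.
exact: continuous_cos.
Qed.

Lemma continuous_sin_affine (x t : R) : continuous (fun y : R => sin (x * y + t)).
Proof.
move=> y; apply: (@continuous_comp _ _ _ (fun y : R => x * y + t) sin).
  exact: continuous_affine.
exact: continuous_sin.
Qed.

Lemma integrable_gauss1_cos b x t : 0 < b ->
  leb.-integrable setT (EFin \o (fun y => gauss1 b y * cos (x * y + t))).
Proof.
move=> b0; apply: (@integrable_dominated _ _ R leb _ (gauss1 b)).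
- apply: measurable_funM; first exact: measurable_gauss1.
  by apply: continuous_measurable_fun; exact: continuous_cos_affine.
- move=> y; rewrite normrM ger0_norm ?(ltW (gauss1_gt0 _ _))//.
  by rewrite ler_piMr ?normr_cos_le1// (ltW (gauss1_gt0 _ _)).
- by have [] := integral_gauss1 b0.
Qed.

(** The derivative of [gauss1 b y * sin (x y + t)] has integral zero. *)
Lemma gauss1_parts b x t : 0 < b ->
  2 * b * \int[leb]_y (y * gauss1 b y * sin (x * y + t)) =
  x * \int[leb]_y (gauss1 b y * cos (x * y + t)).
Proof.
move=> b0.
pose F y := gauss1 b y * sin (x * y + t).
pose f1 y := y * gauss1 b y * sin (x * y + t).
pose f2 y := gauss1 b y * cos (x * y + t).
have cf1 : continuous f1.
  move=> y; apply: cvgM; last exact: continuous_sin_affine.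
  by apply: cvgM; [exact: cvg_id|exact: continuous_gauss1].
have cf2 : continuous f2.
  by move=> y; apply: cvgM; [exact: continuous_gauss1|exact: continuous_cos_affine].
have [ig2 _] := @integral_gauss1 (b / 2) (divr_gt0 b0 ltr0n2).
have [ig _] := integral_gauss1 b0.
have f1g y : `|f1 y| <= (1 + 2 / b) * gauss1 (b / 2) y.
  rewrite /f1 !normrM (ger0_norm (ltW (gauss1_gt0 _ _))).
  apply: le_trans (norm_gauss1_le y b0); rewrite ler_piMr ?normr_sin_le1//.
  by rewrite mulr_ge0// (ltW (gauss1_gt0 _ _)).
have f2g y : `|f2 y| <= gauss1 b y.
  rewrite /f2 normrM (ger0_norm (ltW (gauss1_gt0 _ _))).
  by rewrite ler_piMr ?normr_cos_le1// (ltW (gauss1_gt0 _ _)).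
have ig2' := lebesgue_integrableZl (1 + 2 / b) ig2.
have if1 := lebesgue_integrable_dominated cf1 f1g ig2'.
have if2 := lebesgue_integrable_dominated cf2 f2g ig.
have F0 n : `|F n%:R| <= gauss1 b n%:R.
  rewrite /F normrM (ger0_norm (ltW (gauss1_gt0 _ _))).
  by rewrite ler_piMr ?normr_sin_le1// (ltW (gauss1_gt0 _ _)).
have FN0 n : `|F (- n%:R)| <= gauss1 b n%:R.
  rewrite /F normrM (ger0_norm (ltW (gauss1_gt0 _ _))) /gauss1 sqrrN.
  by rewrite ler_piMr ?normr_sin_le1// expR_ge0.
have sq (G : nat -> R) : (forall n, `|G n| <= gauss1 b n%:R) -> G n @[n --> \oo] --> 0.
  move=> Gg; apply/norm_cvg0P.
  apply: (squeeze_cvgr (f := cst 0) (h := fun n => gauss1 b n%:R)).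
  - by apply: nearW => n; rewrite normr_ge0 Gg.
  - exact: cvg_cst.
  - exact: cvg_gauss1_0.
have := @Rintegral_derive0 F (fun y => - (2 * b) * f1 y + x * f2 y)
  (fun y => (2 * b) * ((1 + 2 / b) * gauss1 (b / 2) y) + `|x| * gauss1 b y).
have -> : \int[leb]_y (- (2 * b) * f1 y + x * f2 y) =
    - (2 * b) * (\int[leb]_y f1 y) + x * (\int[leb]_y f2 y).
  by rewrite RintegralD ?RintegralZl//; exact: lebesgue_integrableZl.
move=> H; apply/eqP; rewrite eq_sym -subr_eq0 addrC -mulNr; apply/eqP; apply: H.
- move=> y; have h1 := is_derive_gauss1 b y; have h2 := is_derive_sin_affine x t y.
  apply: is_derive_eq; rewrite /GRing.scale/= /f1 /f2; ring.
- by move=> y; apply: cvgD; apply: cvgMr; [exact: cf1|exact: cf2].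
- rewrite (_ : EFin \o _ = ((fun y => ((2 * b)%:E * ((1 + 2 / b) * gauss1 (b / 2) y)%:E)) \+
     (fun y => `|x|%:E * (gauss1 b y)%:E))%E); last by apply/funext.
  by apply: integrableD => //; exact: lebesgue_integrableZl.
- move=> y; apply: (le_trans (ler_normD _ _)); rewrite (normrM (- (2 * b))) (normrM x) normrN.
  apply: lerD; last by rewrite ler_wpM2l.
  by rewrite (ger0_norm (mulr_ge0 _ (ltW b0)))// ler_wpM2l// mulr_ge0// ltW.
- exact: sq.
- exact: sq.
Qed.

(** As a function of [x], the integral [h] solves [h' = - (x / (2 b)) h], by
    differentiation under the integral sign and [gauss1_parts]. *)
Lemma Rintegral_gauss1_cos b x t : 0 < b ->
  \int[leb]_y (gauss1 b y * cos (x * y + t)) =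
  cos t * (Num.sqrt (pi / b) * gauss1 (4 * b)^-1 x).
Proof.
move=> b0; pose h x := \int[leb]_y (gauss1 b y * cos (x * y + t)).
have [ig Eg] := integral_gauss1 b0.
have [ig2 _] := @integral_gauss1 (b / 2) (divr_gt0 b0 ltr0n2).
have ig2' := lebesgue_integrableZl (1 + 2 / b) ig2.
have dh (z : R) : is_derive z 1 h (- (z / (2 * b)) * h z).
  pose f (x y : R) := gauss1 b y * cos (x * y + t).
  have df (x' y : R) : is_derive x' 1 (f ^~ y) (- (y * gauss1 b y * sin (x' * y + t))).
    have h1 := is_derive_cos_affine y t x'.
    have -> : f ^~ y = fun x' => gauss1 b y * cos (y * x' + t).
      by apply/funext => ?; rewrite /f [y * _]mulrC.
    apply: is_derive_eq; rewrite /GRing.scale/= [y * x']mulrC; ring.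
  have pf (x' y : R) : partial1of2 f x' y = - (y * gauss1 b y * sin (x' * y + t)).
    by rewrite partial1of2E; have [] := df x' y.
  have Iz : `]z - 1, z + 1[%classic z.
    by rewrite /= in_itv/= ltrDl ltrBlDr ltrDl ltr01.
  have G_ub (x' y : R) : `|partial1of2 f x' y| <= (1 + 2 / b) * gauss1 (b / 2) y.
    rewrite pf normrN !normrM (ger0_norm (ltW (gauss1_gt0 _ _))).
    apply: le_trans (norm_gauss1_le y b0); rewrite ler_piMr ?normr_sin_le1//.
    by rewrite mulr_ge0// (ltW (gauss1_gt0 _ _)).
  have G_ge0 y : 0 <= (1 + 2 / b) * gauss1 (b / 2) y.
    by apply: mulr_ge0 (ltW (gauss1_gt0 _ _)); rewrite addr_ge0 ?divr_ge0 ?(ltW b0).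
  have hd := @derivable_under_integral R _ _ leb f setT measurableT z
    (z - 1) (z + 1) Iz (fun x' _ => integrable_gauss1_cos x' t b0)
    (fun x' y _ _ => @ex_derive _ _ _ _ _ _ _ (df x' y))
    (fun y => (1 + 2 / b) * gauss1 (b / 2) y) G_ge0 ig2' (fun x' y _ _ => G_ub x' y).
  have hE := @differentiation_under_integral R _ _ leb f setT measurableT z
    (z - 1) (z + 1) Iz (fun x' _ => integrable_gauss1_cos x' t b0)
    (fun x' y _ _ => @ex_derive _ _ _ _ _ _ _ (df x' y))
    (fun y => (1 + 2 / b) * gauss1 (b / 2) y) G_ge0 ig2' (fun x' y _ _ => G_ub x' y).
  apply: DeriveDef => //; rewrite -derive1E [LHS]hE.
  have -> : partial1of2 f z = fun y => -1 * (y * gauss1 b y * sin (z * y + t)).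
    by apply/funext => y; rewrite pf mulN1r.
  rewrite RintegralZl//.
    have := gauss1_parts z t b0.
    rewrite -/(h z); set I := \int[_]_y _ => e; rewrite mulN1r mulNr; congr (- _).
    by apply: (mulfI (_ : 2 * b != 0)); rewrite ?e; [rewrite gt_eqF// mulr_gt0|field; lra].
  apply: (lebesgue_integrable_dominated _ _ ig2').
    move=> y; apply: cvgM; last exact: continuous_sin_affine.
    by apply: cvgM; [exact: cvg_id|exact: continuous_gauss1].
  by move=> y; rewrite -normrN -pf.
(* The quotient by the expected answer has a vanishing derivative. *)
pose k x := h x * gauss1 (- (4 * b)^-1) x.
have kE : k x = k 0.
  apply: is_derive_0_is_cst => z; have h1 := dh z.
  have h2 := is_derive_gauss1 (- (4 * b)^-1) z.
  apply: is_derive_eq; rewrite /GRing.scale/=; field; lra.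
have k0 : k 0 = cos t * Num.sqrt (pi / b).
  rewrite /k /h /gauss1 expr0n/= mulr0 oppr0 expR0 mulr1.
  under eq_Rintegral do rewrite mul0r add0r.
  by rewrite RintegralZr// Eg mulrC.
rewrite mulrA -k0 -kE /k -mulrA /gauss1 -expRD mulNr opprK subrr expR0 mulr1.
by [].
Qed.

End gaussian1.

Section gaussian.
Context {R : realType}.
Local Notation leb := (@lebesgue_measure R).
Local Notation lam n := (@lebesgue_rV R n).

Definition gauss n (b : R) (x : 'rV[R]_n) : R := expR (- (b * dot x x)).

Lemma gauss_prod n b (x : 'rV[R]_n) : gauss b x = \prod_i gauss1 b (x ord0 i).
Proof.
rewrite /gauss /dot mulr_sumr -sumrN expR_sum.
by apply: eq_bigr => i _; rewrite /gauss1 expr2.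
Qed.

Lemma gauss_ge0 n b (x : 'rV[R]_n) : 0 <= gauss b x.
Proof. exact: expR_ge0. Qed.

Lemma dot_ge0 n (x : 'rV[R]_n) : 0 <= dot x x.
Proof. by rewrite /dot sumr_ge0// => i _; rewrite -expr2 sqr_ge0. Qed.

Lemma gauss_le1 n b (x : 'rV[R]_n) : 0 <= b -> gauss b x <= 1.
Proof. by move=> b0; rewrite -expR0 ler_expR oppr_le0 mulr_ge0 ?dot_ge0. Qed.

Lemma measurable_dot n (x : 'rV[R]_n) : measurable_fun setT (dot x).
Proof.
apply: measurable_sum => i.
by apply: measurable_funM => //; exact: (@measurable_coord R n i).
Qed.

Lemma measurable_dot_self n : measurable_fun setT (fun x : 'rV[R]_n => dot x x).
Proof.
apply: measurable_sum => i.
by apply: measurable_funM; exact: (@measurable_coord R n i).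
Qed.

Lemma measurable_gauss n b : measurable_fun setT (@gauss n b).
Proof.
apply: measurableT_comp => //; apply: measurableT_comp => //.
by apply: measurable_funM => //; exact: measurable_dot_self.
Qed.

Lemma integral_gauss n b : 0 < b ->
  (lam n).-integrable setT (EFin \o @gauss n b) /\
  \int[lam n]_x gauss b x = Num.sqrt (pi / b) ^+ n.
Proof.
move=> b0; have [ig Eg] := @integral_gauss1 R b b0.
have [] := @Rintegral_prod R n (fun=> gauss1 b) (fun=> ig).
rewrite Eg prodr_const card_ord.
have -> // : (fun x : 'rV[R]_n => \prod_i gauss1 b (x ord0 i)) = @gauss n b.
by apply/funext => x; rewrite gauss_prod.
Qed.

Lemma dot_cons n (x : 'rV[R]_n.+1) a (v : 'rV[R]_n) :
  dot x (cons_rV (a, v)) = x ord0 ord0 * a + dot (behead_rV x) v.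
Proof.
rewrite /dot big_ord_recl mxE unlift_none; congr (_ + _).
by apply: eq_bigr => i _; rewrite !mxE liftK.
Qed.

Lemma gauss_cons n b a (v : 'rV[R]_n) : gauss b (cons_rV (a, v)) = gauss1 b a * gauss b v.
Proof.
rewrite !gauss_prod big_ord_recl mxE unlift_none; congr (_ * _).
by apply: eq_bigr => i _; rewrite mxE liftK.
Qed.

Lemma gauss_behead n b (x : 'rV[R]_n.+1) :
  gauss b x = gauss1 b (x ord0 ord0) * gauss b (behead_rV x).
Proof.
by rewrite !gauss_prod big_ord_recl; under [in RHS]eq_bigr do rewrite mxE.
Qed.

Lemma measurable_cos_dot n (x : 'rV[R]_n) t :
  measurable_fun setT (fun y => cos (dot x y + t)).
Proof.
apply: (@measurableT_comp _ _ _ _ _ _ (@cos R)).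
  by apply: continuous_measurable_fun; exact: continuous_cos.
by apply: measurable_funD => //; exact: measurable_dot.
Qed.

Lemma integrable_gauss_cos n b (x : 'rV[R]_n) t : 0 < b ->
  (lam n).-integrable setT (EFin \o (fun y => gauss b y * cos (dot x y + t))).
Proof.
move=> b0; have [ig _] := @integral_gauss n b b0.
apply: (integrable_dominated _ _ ig).
  by apply: measurable_funM; [exact: measurable_gauss|exact: measurable_cos_dot].
by move=> y; rewrite normrM ger0_norm ?gauss_ge0// ler_piMr ?gauss_ge0// normr_cos_le1.
Qed.

(** A phase [t] in the cosine makes the induction on the dimension go through
    without separating sine and cosine integrals. *)
Lemma Rintegral_gauss_cos n b (x : 'rV[R]_n) t : 0 < b ->
  \int[lam n]_y (gauss b y * cos (dot x y + t)) =
  cos t * (Num.sqrt (pi / b) ^+ n * gauss (4 * b)^-1 x).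
Proof.
move=> b0; elim: n x t => [|n IH] x t.
  have [|_ ->] := @Rintegral_rV0 R (fun y => gauss b y * cos (dot x y + t)).
    by apply: measurable_funM; [exact: measurable_gauss|exact: measurable_cos_dot].
  by rewrite /gauss /dot !big_ord0 !mulr0 oppr0 expR0 add0r expr0 !mul1r mulr1.
set f := fun y => gauss b y * cos (dot x y + t).
have mf : measurable_fun setT f.
  by apply: measurable_funM; [exact: measurable_gauss|exact: measurable_cos_dot].
have [ig1 _] := @integral_gauss1 R b b0.
have [ign _] := @integral_gauss n b b0.
have mfc : measurable_fun setT ((EFin \o f) \o @cons_rV R n).
  by apply/measurable_EFinP; apply: measurableT_comp => //; exact: measurable_cons_rV.
have intf : (leb \x lam n)%E.-integrable setT ((EFin \o f) \o @cons_rV R n).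
  apply: le_integrable (integrable_tensor ig1 ign) => //.
  move=> [a v] _ /=; rewrite lee_fin /f gauss_cons !normrM.
  by rewrite ler_piMr ?mulr_ge0// normr_cos_le1.
rewrite /Rintegral integral_cons//; last exact/measurable_EFinP.
rewrite -integral21_prod_meas1// /fubini_G/=.
have E v : (\int[leb]_a (f (cons_rV (a, v)))%:E)%E =
   ((Num.sqrt (pi / b) * gauss1 (4 * b)^-1 (x ord0 ord0)) *
    (gauss b v * cos (dot (behead_rV x) v + t)))%:E.
  rewrite (_ : (fun a => _) = (fun a => (gauss b v *
     (gauss1 b a * cos (x ord0 ord0 * a + (dot (behead_rV x) v + t))))%:E)).
    rewrite -[LHS]fineK; last first.
      apply: integrable_fin_num => //; apply: lebesgue_integrableZl.
      exact: integrable_gauss1_cos.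
    rewrite -[fine _]/(Rintegral _ _ _) RintegralZl//; last first.
      exact: integrable_gauss1_cos.
    by rewrite Rintegral_gauss1_cos//; congr EFin; ring.
  by apply/funext => a; rewrite /f gauss_cons dot_cons addrA; congr EFin; ring.
under eq_integral do rewrite E.
rewrite -[fine _]/(Rintegral _ _ _) RintegralZl//; last first.
  exact: integrable_gauss_cos.
by rewrite IH gauss_behead exprS; ring.
Qed.

End gaussian.

(** * The Fourier transform of square-integrable functions tested on Gaussians *)

Section Lnorm_mono.
Context d (T : measurableType d) (R : realType).
Variable mu : {measure set T -> \bar R}.

Lemma Lnorm2_le (f g : T -> R) : measurable_fun setT f -> measurable_fun setT g ->
  (forall x, `|f x| <= `|g x|) ->
  ('N[mu]_2%:E[EFin \o f] <= 'N[mu]_2%:E[EFin \o g])%E.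
Proof.
move=> mf mg fg; rewrite unlock.
have m2 (h : T -> R) : measurable_fun setT h ->
    measurable_fun setT (fun x => (`|(EFin \o h) x| `^ 2)%E).
  move=> mh; rewrite (_ : (fun x => _) = (fun x => (h x ^+ 2)%:E)).
    by apply/measurable_EFinP; exact: measurable_funX.
  apply/funext => x /=; rewrite powR_mulrn//.
  by rewrite real_normK// num_real.
apply: gt0_ler_poweR => //.
- by rewrite in_itv/= leey integral_ge0.
- by rewrite in_itv/= leey integral_ge0.
apply: ge0_le_integral => //.
- by move=> x _; exact: poweR_ge0.
- exact: m2.
- exact: m2.
- move=> x _ /=; rewrite lee_fin !powR_mulrn// lerXn2r// ?nnegrE//.
Qed.

End Lnorm_mono.

Section pairing.
Context {R : realType} {n : nat}.
Local Notation E := 'rV[R]_n.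
Local Notation lam := (@lebesgue_rV R n).
Implicit Types (g m : E -> R).

Lemma measurable_dot2 : measurable_fun setT (fun p : E * E => dot p.1 p.2).
Proof.
apply: measurable_sum => i; apply: measurable_funM.
  exact: (measurableT_comp (@measurable_coord R n i) measurable_fst).
exact: (measurableT_comp (@measurable_coord R n i) measurable_snd).
Qed.

Section kernel.
Variables (w : R -> R) (cw : continuous w) (w1 : forall x, `|w x| <= 1).
Variables (g m : E -> R).
Hypothesis ig : lam.-integrable setT (EFin \o g).
Hypothesis im : lam.-integrable setT (EFin \o m).

Let h (p : E * E) := g p.1 * m p.2 * w (dot p.1 p.2).

Let mg : measurable_fun setT g := integrable_measurable ig.
Let mm : measurable_fun setT m := integrable_measurable im.
Let mw : measurable_fun setT w := continuous_measurable_fun cw.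

Let mh : measurable_fun setT h.
Proof.
apply: measurable_funM; last by apply: measurableT_comp => //; exact: measurable_dot2.
by apply: measurable_funM; exact: measurableT_comp.
Qed.

Let ih : (lam \x lam)%E.-integrable setT (EFin \o h).
Proof.
apply: (le_integrable measurableT _ _ (integrable_tensor ig im)).
  exact/measurable_EFinP.
by move=> p _ /=; rewrite lee_fin /h normrM ler_piMr.
Qed.

Let iw1 xi : lam.-integrable setT (EFin \o (fun x => g x * w (dot x xi))).
Proof.
apply: (integrable_dominated (g := fun x => `|g x|)) => //.
- apply: measurable_funM => //; apply: measurableT_comp => //.
  rewrite (_ : (fun x => dot x xi) = dot xi); first exact: measurable_dot.
  by apply/funext => x; apply: eq_bigr => i _; rewrite mulrC.
- by move=> x; rewrite normrM ler_piMr.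
- by have := integrable_norm ig.
Qed.

Let iw2 x : lam.-integrable setT (EFin \o (fun xi => m xi * w (dot x xi))).
Proof.
apply: (integrable_dominated (g := fun x => `|m x|)) => //.
- apply: measurable_funM => //; apply: measurableT_comp => //.
  exact: measurable_dot.
- by move=> xi; rewrite normrM ler_piMr.
- by have := integrable_norm im.
Qed.

Lemma Rintegral_kernel_swap :
  measurable_fun setT (fun xi => m xi * \int[lam]_x (g x * w (dot x xi))) /\
  \int[lam]_xi (m xi * \int[lam]_x (g x * w (dot x xi))) =
  \int[lam]_x (g x * \int[lam]_xi (m xi * w (dot x xi))).
Proof.
have e1 xi : (\int[lam]_x (h (x, xi))%:E)%E =
    (m xi * \int[lam]_x (g x * w (dot x xi)))%:E.
  rewrite -[X in X = _]fineK -?RintegralZl//; last first.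
    apply: integrable_fin_num => //.
    rewrite (_ : (fun x => _) = (fun x => ((m xi)%:E * (g x * w (dot x xi))%:E)%E)).
      by apply: integrableZl => //; exact: iw1.
    by apply/funext => x; rewrite -EFinM /h/=; congr EFin; ring.
  congr EFin; congr fine; apply: eq_integral => x _.
  by rewrite /h/=; congr EFin; ring.
have e2 x : (\int[lam]_xi (h (x, xi))%:E)%E =
    (g x * \int[lam]_xi (m xi * w (dot x xi)))%:E.
  rewrite -[X in X = _]fineK -?RintegralZl//; last first.
    apply: integrable_fin_num => //.
    rewrite (_ : (fun x => _) = (fun xi => ((g x)%:E * (m xi * w (dot x xi))%:E)%E)).
      by apply: integrableZl => //; exact: iw2.
    by apply/funext => xi; rewrite -EFinM /h/=; congr EFin; ring.
  congr EFin; congr fine; apply: eq_integral => xi _.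
  by rewrite /h/=; congr EFin; ring.
split.
  have := measurable_fubini_G ih; rewrite /fubini_G.
  by under eq_fun do rewrite e1; move/measurable_EFinP.
have := Fubini ih => /=.
under eq_integral do rewrite e2.
by under [in X in _ = X]eq_integral do rewrite e1; move=> e; rewrite /Rintegral e.
Qed.

End kernel.

(** Fubini yields the measurability of the integral times an integrable weight;
    a Gaussian weight is integrable and can be divided out. *)
Lemma measurable_kernel (w : R -> R) g : continuous w -> (forall x, `|w x| <= 1) ->
  lam.-integrable setT (EFin \o g) ->
  measurable_fun setT (fun xi => \int[lam]_x (g x * w (dot x xi))).
Proof.
move=> cw w1 ig; have [i1 _] := @integral_gauss R n 1 ltr01.
have [mk _] := Rintegral_kernel_swap cw w1 ig i1.
rewrite (_ : (fun xi => _) = (fun xi => expR (1 * dot xi xi) *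
    (gauss 1 xi * \int[lam]_x (g x * w (dot x xi))))).
  apply: measurable_funM => //; apply: measurableT_comp => //.
  by apply: measurable_funM => //; exact: measurable_dot_self.
by apply/funext => xi; rewrite mulrA /gauss -expRD addrN expR0 mul1r.
Qed.

Definition euclid_ball (r : R) : set E := [set x | enorm x <= r].

Lemma measurable_enorm : measurable_fun setT (@enorm R n).
Proof.
apply: (@measurableT_comp _ _ _ _ _ _ (@Num.sqrt R)).
  by apply: continuous_measurable_fun; exact: sqrt_continuous.
exact: measurable_dot_self.
Qed.

Lemma measurable_euclid_ball r : measurable (euclid_ball r).
Proof.
rewrite (_ : euclid_ball r = setT `&` (@enorm R n) @^-1` `]-oo, r]%classic).
  by apply: measurable_enorm => //; exact: measurable_itv.
by apply/seteqP; split => x; rewrite /euclid_ball /= in_itv/=; [split|case].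
Qed.

Lemma enorm_ge0 (x : E) : 0 <= enorm x. Proof. exact: sqrtr_ge0. Qed.

Lemma enorm_sqr (x : E) : enorm x ^+ 2 = dot x x.
Proof. by rewrite sqr_sqrtr// dot_ge0. Qed.

Lemma gauss_L2 b : 0 < b -> L2 (@gauss R n b).
Proof.
move=> b0; apply/Lfun2P; split; first exact: measurable_gauss.
have [ig _] := @integral_gauss R n (2 * b) (mulr_gt0 (ltr0Sn _ _) b0).
rewrite (_ : (fun x => _) = gauss (2 * b))//; apply/funext => x.
by rewrite /gauss expr2 -expRD; congr expR; ring.
Qed.

Lemma indic_ball_L2 r : L2 (\1_(euclid_ball r) : E -> R).
Proof.
apply: (@Lfun2_dominated _ _ _ _ _ (fun x => expR (r ^+ 2) * gauss 1 x)).
- by apply: measurable_indic; exact: measurable_euclid_ball.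
- move=> x; rewrite indicE; have [|_] := boolP (x \in _); last first.
    by rewrite normr0 mulr_ge0 ?expR_ge0.
  rewrite inE => xr; rewrite normr1 /gauss -expRD mul1r.
  rewrite -[leLHS]expR0 ler_expR subr_ge0.
  rewrite -enorm_sqr lerXn2r ?nnegrE ?enorm_ge0//.
  exact: le_trans (enorm_ge0 x) xr.
- by apply: Lfun2Zl; exact: gauss_L2.
Qed.

(** For [g] truncated to balls this is Fubini; the radius is then sent to
    infinity. On the left-hand side the limit is one of dominated convergence,
    on the right-hand side it is the limit in L^2 that defines the transform
    [G]. The cosines and the real weight [m] see only the real part of [G]. *)
Lemma fourier_pairing g G m : fourier_L2 g G ->
  lam.-integrable setT (EFin \o m) -> L2 m ->
  let M x := \int[lam]_xi (m xi * cos (dot x xi)) in L2 M ->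
  \int[lam]_x (g x * M x) = \int[lam]_xi (m xi * complex.Re (G xi)).
Proof.
move=> [lg [lGr lGi] cvgG] im lm M lM.
pose gk k x := g x * \1_(euclid_ball k%:R) x.
have igk k : lam.-integrable setT (EFin \o gk k).
  exact: Lfun2_mul_integrable lg (indic_ball_L2 _).
pose c k xi := \int[lam]_x (gk k x * cos (dot x xi)).
pose s k xi := \int[lam]_x (gk k x * sin (dot x xi)).
have fbE k xi : fourier_ball g k%:R xi = Complex (c k xi) (- s k xi).
  rewrite /fourier_ball; congr Complex; last congr (- _).
    rewrite Rintegral_mkcond; apply: eq_Rintegral => x _.
    by rewrite patchE /gk indicE /euclid_ball; case: ifPn; rewrite ?mulr1 ?mulr0 ?mul0r.
  rewrite Rintegral_mkcond; apply: eq_Rintegral => x _.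
  by rewrite patchE /gk indicE /euclid_ball; case: ifPn; rewrite ?mulr1 ?mulr0 ?mul0r.
have mc k : measurable_fun setT (c k).
  by apply: measurable_kernel => //; [exact: continuous_cos|exact: normr_cos_le1].
have ms k : measurable_fun setT (s k).
  by apply: measurable_kernel => //; [exact: continuous_sin|exact: normr_sin_le1].
have mGr := Lfun2_measurable lGr; have mGi := Lfun2_measurable lGi.
pose N k xi := Normc.normc (G xi - fourier_ball g k%:R xi).
have NE k xi : N k xi = Num.sqrt ((complex.Re (G xi) - c k xi) ^+ 2 +
                                  (complex.Im (G xi) + s k xi) ^+ 2).
  by rewrite /N fbE; case: (G xi) => a b /=; rewrite opprK.
have mN k : measurable_fun setT (N k).
  rewrite (_ : N k = fun xi => Num.sqrt ((complex.Re (G xi) - c k xi) ^+ 2 +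
                                  (complex.Im (G xi) + s k xi) ^+ 2)); last first.
    by apply/funext => xi; exact: NE.
  apply: (@measurableT_comp _ _ _ _ _ _ (@Num.sqrt R)).
    by apply: continuous_measurable_fun; exact: sqrt_continuous.
  apply: measurable_funD; apply: measurable_funX.
    exact: measurable_funB.
  exact: measurable_funD.
pose D k xi := complex.Re (G xi) - c k xi.
have mD k : measurable_fun setT (D k) by exact: measurable_funB.
have DN k : (L2_norm (D k) <= L2_norm (N k))%E.
  apply: Lnorm2_le => // xi; rewrite NE [leRHS]ger0_norm ?sqrtr_ge0//.
  by rewrite -sqrtr_sqr ler_wsqrtr// lerDl sqr_ge0.
have N0 : (L2_norm (N k) @[k --> \oo] --> 0)%E.
  by apply: (cvg_comp _ _ _ cvgG); exact: cvgr_idn.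
have D0 : (L2_norm (D k) @[k --> \oo] --> 0)%E.
  apply: (squeeze_cvge (f := cst 0%E) (h := fun k => L2_norm (N k))) => //.
    by apply: nearW => k; rewrite Lnorm_ge0 DN.
  exact: cvg_cst.
have lD : \forall k \near \oo, D k \in Lfun lam 2%:E.
  have /fine_cvgP[Dfin _] := D0.
  near=> k; rewrite inE; apply/andP; split; rewrite inE//=.
  rewrite /finite_norm -ge0_fin_numE ?Lnorm_ge0//.
  by near: k; exact: Dfin.
have pD : \int[lam]_xi (D k xi * m xi) @[k --> \oo] --> 0.
  exact: Lfun2_pair_cvg lD lm D0.
have ck k : \int[lam]_xi (m xi * c k xi) = \int[lam]_x (gk k x * M x).
  by have [] := Rintegral_kernel_swap (@continuous_cos R) (@normr_cos_le1 R) (igk k) im.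
have igM := Lfun2_mul_integrable lg lM.
have cvg1 : \int[lam]_x (gk k x * M x) @[k --> \oo] --> \int[lam]_x (g x * M x).
  have [||||] // := @Rintegral_dct _ _ _ lam (fun k x => gk k x * M x)
    (fun x => g x * M x) (fun x => `|g x * M x|).
  - move=> k; apply: measurable_funM; last exact: Lfun2_measurable lM.
    exact: integrable_measurable (igk k).
  - move=> x; apply: cvg_near_cst; near=> k.
    rewrite /gk indicE mem_set ?mulr1//= /euclid_ball/=.
    apply: (@le_trans _ _ (Num.truncn (enorm x)).+1%:R); first exact/ltW/truncnS_gt.
    by rewrite ler_nat; near: k; exact: nbhs_infty_ge.
  - move=> k x; rewrite /gk !normrM ler_wpM2r// ler_piMr// indicE.
    by case: (_ \in _); rewrite ?normr1 ?normr0.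
  - by have := integrable_norm igM.
have imG := Lfun2_mul_integrable lm lGr.
have cvg2 : \int[lam]_x (gk k x * M x) @[k --> \oo] -->
    \int[lam]_xi (m xi * complex.Re (G xi)).
  have : (\int[lam]_xi (m xi * complex.Re (G xi)) - \int[lam]_xi (D k xi * m xi))
      @[k --> \oo] --> \int[lam]_xi (m xi * complex.Re (G xi)) - 0.
    by apply: cvgB => //; exact: cvg_cst.
  rewrite subr0; apply: cvg_trans; apply: near_eq_cvg; near=> k.
  have lDk : D k \in Lfun lam 2%:E by near: k; exact: lD.
  have iDm := Lfun2_mul_integrable lDk lm.
  rewrite -ck -RintegralB//; apply: eq_Rintegral => xi _.
  by rewrite /D; ring.
by rewrite -(cvg_lim _ cvg1)// (cvg_lim _ cvg2).
Unshelve. all: by end_near. Qed.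

End pairing.

(** * Fractional powers as mixtures of exponentials *)

Section subordination.
Context {R : realType}.
Local Notation leb := (@lebesgue_measure R).

Lemma integrable_oneDsqrV : leb.-integrable setT (EFin \o (fun y : R => (1 + y ^+ 2)^-1)).
Proof.
have c1 : continuous (fun y : R => (1 + y ^+ 2)^-1) by exact: continuous_oneDsqrV.
apply/integrableP; split.
  by apply/measurable_EFinP; exact: continuous_measurable_fun c1.
have p0 y : 0 <= (1 + y ^+ 2)^-1 :> R by rewrite invr_ge0 addr_ge0// sqr_ge0.
under eq_integral do rewrite /= ger0_norm//.
rewrite ge0_symfun_integralT//; last by move=> y /=; rewrite sqrrN.
by rewrite -set_itvcy integral0y_oneDsqr -EFinM ltry.
Qed.

Lemma one_sub_expRN_le (z : R) : 1 - expR (- z) <= z.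
Proof. by have := expR_ge1Dx (- z); lra. Qed.

Lemma one_sub_expRN_ge0 (z : R) : 0 <= z -> 0 <= 1 - expR (- z).
Proof. by move=> z0; rewrite subr_ge0 -expR0 ler_expR oppr_le0. Qed.

Lemma one_sub_expRN_le1 (z : R) : 1 - expR (- z) <= 1.
Proof. by rewrite gerBl expR_ge0. Qed.

(** In the variable [s = exp tau] this is the measure
    [(1 - exp (- y s)) s ^ (- 1 - sigma) ds], whose total mass is proportional to
    [y ^ sigma]. The logarithmic variable makes this homogeneity a translation
    invariance. *)
Definition levy (sigma y tau : R) : R :=
  (1 - expR (- (y * expR tau))) * expR (- (sigma * tau)).

Lemma levy_ge0 sigma y tau : 0 <= y -> 0 <= levy sigma y tau.
Proof.
by move=> y0; rewrite /levy mulr_ge0 ?expR_ge0// one_sub_expRN_ge0// mulr_ge0// expR_ge0.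
Qed.

Lemma continuous_levy sigma y : continuous (levy sigma y).
Proof.
have ce : continuous (@expR R) by exact: continuous_expR.
move=> t; rewrite /levy; apply: cvgM.
  apply: cvgB; first exact: cvg_cst.
  apply: (@cvg_comp _ _ _ (fun t => - (y * expR t)) expR _ (nbhs (- (y * expR t)))).
    by apply: cvgN; apply: cvgMr; exact: ce.
  exact: ce.
apply: (@cvg_comp _ _ _ (fun t => - (sigma * t)) expR _ (nbhs (- (sigma * t)))).
  by apply: cvgN; apply: cvgMr; exact: cvg_id.
exact: ce.
Qed.

Lemma sqr_le_expR (d t : R) : 0 <= d -> 0 <= t -> 1 + (d * t) ^+ 2 / 4 <= expR (d * t).
Proof.
move=> d0 t0; have dt : 0 <= d * t by rewrite mulr_ge0.
have -> : expR (d * t) = expR (d * t / 2) ^+ 2 by rewrite expr2 -expRD -splitr.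
have h := expR_ge1Dx (d * t / 2).
apply: (@le_trans _ _ ((1 + d * t / 2) ^+ 2)); last first.
  by rewrite lerXn2r// ?nnegrE ?expR_ge0// addr_ge0// divr_ge0.
have -> : (1 + d * t / 2) ^+ 2 = 1 + (d * t) ^+ 2 / 4 + d * t by field.
by rewrite lerDl.
Qed.

(** The decay is exponential at both ends, with rates [sigma] at [+oo] and
    [1 - sigma] at [-oo]. *)
Lemma integrable_levy sigma : 0 < sigma -> sigma < 1 ->
  leb.-integrable setT (EFin \o levy sigma 1).
Proof.
move=> s0 s1; pose d := Num.min sigma (1 - sigma).
have d0 : 0 < d by rewrite lt_min s0 subr_gt0.
have dsigma : d <= sigma by rewrite ge_min lexx.
have d1sigma : d <= 1 - sigma by rewrite ge_min lexx orbT.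
have d2 : 0 < d ^+ 2 by rewrite exprn_gt0.
apply: (lebesgue_integrable_dominated (@continuous_levy _ _) _
         (lebesgue_integrableZl (1 + 4 / d ^+ 2) integrable_oneDsqrV)) => t.
rewrite ger0_norm ?levy_ge0// ler_pdivlMr; last by rewrite ltr_pwDl ?sqr_ge0.
apply: (@le_trans _ _ (expR (- (d * `|t|)) * (1 + t ^+ 2))).
  rewrite ler_wpM2r ?addr_ge0 ?sqr_ge0// /levy mul1r.
  have [t0|t0] := leP 0 t.
    rewrite ger0_norm// -[leRHS]mul1r ler_pM ?expR_ge0 ?one_sub_expRN_ge0 ?expR_ge0//.
    by rewrite ler_expR lerN2 ler_wpM2r.
  rewrite ltr0_norm//; apply: (@le_trans _ _ (expR t * expR (- (sigma * t)))).
    by rewrite ler_wpM2r ?expR_ge0// one_sub_expRN_le.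
  rewrite -expRD ler_expR mulrN opprK -[X in X - _]mul1r -mulrBl.
  by rewrite ler_wnM2r// ltW.
rewrite expRN mulrC ler_pdivrMr ?expR_gt0//.
have h := sqr_le_expR (ltW d0) (normr_ge0 t).
have t2 : `|t| ^+ 2 = t ^+ 2 by rewrite real_normK// num_real.
have c0 : 0 <= 1 + 4 / d ^+ 2 by rewrite addr_ge0// divr_ge0// ltW.
apply: le_trans (ler_wpM2l c0 h).
rewrite exprMn t2.
have -> : (1 + 4 / d ^+ 2) * (1 + d ^+ 2 * t ^+ 2 / 4) =
   1 + t ^+ 2 + (4 / d ^+ 2 + d ^+ 2 * t ^+ 2 / 4) by field; rewrite gt_eqF.
rewrite lerDl; apply: addr_ge0; first by rewrite divr_ge0// ltW.
by rewrite divr_ge0// mulr_ge0 ?sqr_ge0.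
Qed.

Definition levy_mass sigma : R := \int[leb]_t levy sigma 1 t.

(** The substitution [tau := tau - ln y] reduces to [y = 1]. *)
Lemma integral_levy sigma y : 0 < sigma -> sigma < 1 -> 0 <= y ->
  leb.-integrable setT (EFin \o levy sigma y) /\
  \int[leb]_t levy sigma y t = y `^ sigma * levy_mass sigma.
Proof.
move=> s0 s1; rewrite le_eqVlt => /predU1P[<-|y0].
  have -> : levy sigma 0 = cst 0.
    by apply/funext => t; rewrite /levy mul0r oppr0 expR0 subrr mul0r.
  split; first exact: integrable0.
  by rewrite Rintegral_cst// mul0r powR0 ?gt_eqF// mul0r.
have E t : levy sigma 1 t = y `^ (- sigma) * levy sigma y (t + - ln y).
  have e1 : y * expR (t + - ln y) = 1 * expR t.
    rewrite expRD -lnV ?posrE// lnK ?posrE ?invr_gt0//.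
    by field; rewrite gt_eqF.
  have e2 : expR (- (sigma * (t + - ln y))) = expR (- (sigma * t)) * y `^ sigma.
    by rewrite /powR gt_eqF// -expRD; congr expR; ring.
  by rewrite /levy e1 e2 powRN; field; rewrite gt_eqF// powR_gt0.
have i1 := integrable_levy s0 s1.
have shift : (\int[leb]_t (levy sigma y t)%:E =
    \int[leb]_t (levy sigma y (t + - ln y))%:E)%E.
  have d1 (t : R) : is_derive t 1 (fun t => t + - ln y) 1.
    have := is_deriveD (is_derive_id t (1 : R)) (is_derive_cst (- ln y) t (1 : R)).
    by rewrite addr0.
  have D1 : (fun t : R => t + - ln y)^`()%classic = cst 1.
    by apply/funext => t; rewrite derive1E; have [] := d1 t.
  rewrite (@increasing_ge0_integration_by_substitutionT R (fun t => t + - ln y)).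
  - by apply: eq_integral => t _; rewrite D1 /= mulr1.
  - by move=> u v uv; rewrite ltrD2r.
  - by rewrite D1 => t; exact: cvg_cst.
  - by rewrite D1; apply/cvg_ex; exists 1; exact: cvg_cst.
  - by rewrite D1; apply/cvg_ex; exists 1; exact: cvg_cst.
  - by move=> t; have [] := d1 t.
  - exact/cvg_addrr_Ny.
  - exact/cvg_addrr.
  - exact: continuous_levy.
  - by move=> t; rewrite levy_ge0// ltW.
have yi : y `^ (- sigma) != 0 by rewrite gt_eqF// powR_gt0.
have iy' : leb.-integrable setT (EFin \o (fun t => levy sigma y (t + - ln y))).
  rewrite (_ : (fun t => _) = fun t => y `^ sigma * levy sigma 1 t).
    exact: lebesgue_integrableZl.
  by apply/funext => t; rewrite E powRN mulrA divff ?mul1r// -invr_eq0 -powRN.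
split.
  apply/integrableP; split.
    apply/measurable_EFinP; apply: continuous_measurable_fun.
    exact: continuous_levy.
  case/integrableP : iy' => _.
  rewrite (_ : (fun t => _) = (fun t : R => (levy sigma y (t + - ln y))%:E)); last first.
    by apply/funext => t /=; rewrite ger0_norm// levy_ge0// ltW.
  rewrite (_ : (fun t => `|(EFin \o levy sigma y) t|%E) = (fun t => (levy sigma y t)%:E)).
    by rewrite shift.
  by apply/funext => t /=; rewrite ger0_norm// levy_ge0// ltW.
rewrite /levy_mass {2}/Rintegral.
have -> : (fun t => (levy sigma 1 t)%:E) =
    (fun t => (y `^ (- sigma) * levy sigma y (t + - ln y))%:E).
  by apply/funext => t; rewrite E.
rewrite -[fine _]/(Rintegral _ _ _) RintegralZl// mulrA powRN divff ?mul1r; last first.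
  by rewrite -invr_eq0 -powRN.
by rewrite /Rintegral shift.
Qed.

Lemma levy_mass_gt0 sigma : 0 < sigma -> sigma < 1 -> 0 < levy_mass sigma.
Proof.
move=> s0 s1; pose c : R := (1 - expR (-1)) * expR (- sigma).
have e1 : expR (-1) < 1 :> R by rewrite -[ltRHS]expR0 ltr_expR; lra.
have c0 : 0 < c by rewrite mulr_gt0 ?expR_gt0// subr_gt0.
have mi : measurable_fun setT (\1_(`[0, 1]%classic : set R) : R -> R) by exact: measurable_indic.
have I1 : \int[leb]_t \1_(`[0, 1]%classic : set R) t = 1 :> R.
  by rewrite /Rintegral integral_indic//= setIT lebesgue_measure_itv/= lte_fin ltr01 sube0.
have i1 : leb.-integrable setT (EFin \o (\1_(`[0, 1]%classic : set R) : R -> R)).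
  apply/integrableP; split; first exact/measurable_EFinP.
  under eq_integral do rewrite /= ger0_norm//.
  by rewrite integral_indic//= setIT lebesgue_measure_itv/= lte_fin ltr01 sube0 ltry.
apply: (lt_le_trans c0); rewrite -[leLHS]mulr1 -{1}I1 -RintegralZl//.
apply: le_Rintegral => //; [exact: lebesgue_integrableZl | exact: integrable_levy|].
move=> t _; rewrite indicE; have [|_] := boolP (_ \in _); last first.
  by rewrite mulr0 levy_ge0.
rewrite inE/= in_itv/= => /andP[t0 t1]; rewrite mulr1 /c /levy mul1r.
apply: ler_pM; rewrite ?expR_ge0//.
- by rewrite lerD2l lerN2 ler_expR lerN2 -expR0 ler_expR.
- by rewrite ler_expR lerN2 ler_piMr// ltW.
Qed.

End subordination.

Section bernstein.
Context d (T : measurableType d) (R : realType).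
Variable mu : {sigma_finite_measure set T -> \bar R}.
Local Notation leb := (@lebesgue_measure R).
Variables (q phi : T -> R).
Hypothesis (mq : measurable_fun setT q) (q_ge0 : forall x, 0 <= q x).
Hypothesis iphi : mu.-integrable setT (EFin \o phi).
Hypothesis iphiq : mu.-integrable setT (EFin \o (fun x => phi x * q x)).

Let mphi : measurable_fun setT phi := integrable_measurable iphi.

Let measurable_one_sub s : measurable_fun setT (fun x => 1 - expR (- (s * q x))).
Proof.
apply: measurable_funB => //; apply: measurableT_comp => //.
by apply: measurableT_comp => //; exact: measurable_funM.
Qed.

Lemma powR_le_oneD (sigma y : R) : 0 < sigma -> sigma <= 1 -> 0 <= y -> y `^ sigma <= 1 + y.
Proof.
move=> s0 s1 y0; have [y1|y1] := leP y 1.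
  apply: (@le_trans _ _ (1 `^ sigma)); last by rewrite powR1 lerDl.
  by rewrite ge0_ler_powR ?nnegrE// ltW.
apply: (@le_trans _ _ (y `^ 1)); first by rewrite ler_powR// ltW.
by rewrite powRr1// lerDr.
Qed.

Let integrable_one_sub s : 0 <= s ->
  mu.-integrable setT (EFin \o (fun x => phi x * (1 - expR (- (s * q x))))).
Proof.
move=> s0; apply: (integrable_dominated (g := fun x => `|phi x|)).
- by apply: measurable_funM => //; exact: measurable_one_sub.
- move=> x; rewrite normrM ler_piMr//.
  by rewrite ger0_norm ?one_sub_expRN_le1// one_sub_expRN_ge0// mulr_ge0.
- by have := integrable_norm iphi.
Qed.

Lemma cvg_one_sub_expRN (z : R) : 0 <= z ->
  k.+1%:R * (1 - expR (- (k.+1%:R^-1 * z))) @[k --> \oo] --> z.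
Proof.
move=> z0; apply: (squeeze_cvgr (f := fun k => z - z ^+ 2 * harmonic k) (h := cst z)).
- apply: nearW => k; rewrite /harmonic/=.
  have k0 : 0 < k.+1%:R :> R by rewrite ltr0Sn.
  have kn0 : k.+1%:R != 0 :> R by rewrite gt_eqF.
  set u := k.+1%:R^-1 * z; have u0 : 0 <= u by rewrite mulr_ge0// invr_ge0 ltW.
  have zu : z = k.+1%:R * u by rewrite /u mulrA divff// mul1r.
  rewrite [X in _ && (_ <= X)]zu [X in X - _]zu (_ : z ^+ 2 / _ = k.+1%:R * u ^+ 2); last first.
    by rewrite zu; field.
  rewrite -mulrBr !ler_pM2l// one_sub_expRN_le andbT.
  have v0 : 0 < 1 + u by rewrite ltr_pwDl.
  have : expR (- u) <= (1 + u)^-1.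
    by rewrite expRN lef_pV2 ?posrE ?expR_gt0// expR_ge1Dx.
  have : (1 + u)^-1 <= 1 - u + u ^+ 2.
    rewrite -[leLHS]mul1r ler_pdivrMr//.
    have -> : (1 - u + u ^+ 2) * (1 + u) = 1 + u ^+ 3 by ring.
    by rewrite lerDl exprn_ge0.
  move: (expR _) (_^-1) => *; lra.
- rewrite -[X in _ --> X]subr0 -(mulr0 (z ^+ 2)).
  apply: cvgB; first exact: cvg_cst.
  by apply: cvgMr; exact: cvg_harmonic.
- exact: cvg_cst.
Qed.

Lemma integrable_powR (sigma : R) : 0 < sigma -> sigma <= 1 ->
  mu.-integrable setT (EFin \o (fun x => phi x * q x `^ sigma)).
Proof.
move=> s0 s1; apply: (integrable_dominated (g := fun x => `|phi x| + `|phi x * q x|)).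
- apply: measurable_funM => //.
  exact: (measurableT_comp (measurable_powR sigma) mq).
- move=> x; rewrite !normrM (ger0_norm (q_ge0 x)) (ger0_norm (powR_ge0 _ _)).
  rewrite -[X in X + _]mulr1 -mulrDr ler_wpM2l//; exact: powR_le_oneD.
- rewrite (_ : EFin \o _ = ((fun x => `|(phi x)%:E|) \+ (fun x => `|(phi x * q x)%:E|))%E).
    by apply: integrableD => //; exact: integrable_norm.
  by apply/funext.
Qed.

(** The function [y |-> y `^ sigma] is a positive mixture of the functions
    [1 - exp (- s y)] (a derivative of them at [s = 0] when [sigma = 1]), so that
    an inequality for all of these passes to it. *)
Lemma bernstein_le (sigma A y : R) : 0 < sigma -> sigma <= 1 -> 0 <= y ->
  (forall s, 0 < s ->
    \int[mu]_x (phi x * (1 - expR (- (s * q x)))) <= A * (1 - expR (- (s * y)))) ->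
  \int[mu]_x (phi x * q x `^ sigma) <= A * y `^ sigma.
Proof.
move=> s0; rewrite le_eqVlt => /predU1P[->|s1] y0 H.
  (* For [sigma = 1], the mixture degenerates to [k (1 - exp (- y / k))]. *)
  have := @Rintegral_dct _ _ R mu
    (fun k x => phi x * (k.+1%:R * (1 - expR (- (k.+1%:R^-1 * q x)))))
    (fun x => phi x * q x) (fun x => `|phi x * q x|).
  case=> [k|x|k x||_ cvgI].
  - apply: measurable_funM => //; apply: measurable_funM => //; exact: measurable_one_sub.
  - by apply: cvgMr; exact: cvg_one_sub_expRN.
  - rewrite !normrM ler_wpM2l// (ger0_norm (q_ge0 x)) normr_nat ger0_norm; last first.
      by rewrite one_sub_expRN_ge0// mulr_ge0// invr_ge0.
    by rewrite mulrC -ler_pdivlMr// mulrC; exact: one_sub_expRN_le.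
  - by have := integrable_norm iphiq.
  have -> : (fun x => phi x * q x `^ 1) = (fun x => phi x * q x).
    by apply/funext => x; rewrite powRr1.
  rewrite powRr1//.
  apply: (ler_cvg_to cvgI (g := fun k => A * (k.+1%:R * (1 - expR (- (k.+1%:R^-1 * y)))))).
    by apply: cvgMr; exact: cvg_one_sub_expRN.
  apply: nearW => k.
  have k0 : 0 < k.+1%:R^-1 :> R by rewrite invr_gt0.
  have := H _ k0; rewrite -(ler_pM2l (ltr0Sn R k)) -RintegralZl//; last first.
    exact: integrable_one_sub (ltW k0).
  rewrite mulrCA; apply: le_trans; rewrite le_eqVlt; apply/orP; left; apply/eqP.
  by apply: eq_Rintegral => x _; rewrite mulrCA.
have J0 := levy_mass_gt0 s0 s1.
pose F (p : R * T) := phi p.2 * levy sigma (q p.2) p.1.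
have mF : measurable_fun setT F.
  apply: measurable_funM; first exact: measurableT_comp.
  apply: measurable_funM.
    apply: measurable_funB => //; apply: measurableT_comp => //.
    apply: measurableT_comp => //; apply: measurable_funM.
      exact: measurableT_comp.
    exact: measurableT_comp.
  apply: measurableT_comp => //; apply: measurableT_comp => //.
  by apply: measurable_funM.
have il x := @integral_levy R sigma (q x) s0 s1 (q_ge0 x).
(* Both sides are written as integrals over [tau] of the hypothesis at
   [s = exp tau]; Fubini exchanges [tau] and [x]. *)
have e0 x c : (\int[leb]_t (c * levy sigma (q x) t)%:E =
    (levy_mass sigma * (c * q x `^ sigma))%:E)%E.
  have [i1 E1] := il x.
  have i2 := lebesgue_integrableZl c i1.
  rewrite -[LHS]fineK; last exact: integrable_fin_num.
  by rewrite -[fine _]/(Rintegral _ _ _) RintegralZl// E1; congr EFin; ring.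
have e1 x : (\int[leb]_t `|(F (t, x))%:E| =
    (levy_mass sigma)%:E * `|(phi x * q x `^ sigma)%:E|)%E.
  rewrite -EFinM normrM (ger0_norm (powR_ge0 _ _)) -e0.
  by apply: eq_integral => t _; rewrite /F/= normrM (ger0_norm (levy_ge0 _ _ _)).
have ip := integrable_powR s0 (ltW s1).
have iF : (leb \x mu)%E.-integrable setT (EFin \o F).
  apply/integrable21ltyP; first exact/measurable_EFinP.
  under eq_integral do rewrite e1.
  rewrite ge0_integralZl//; last 2 first.
  - by apply: measurableT_comp => //; exact: measurable_int ip.
  - by rewrite lee_fin ltW.
  case/integrableP : ip => _ ip.
  by rewrite lte_mul_pinfty// lee_fin ltW.
have e2 t : (\int[mu]_x (F (t, x))%:E = (expR (- (sigma * t)) *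
    \int[mu]_x (phi x * (1 - expR (- (expR t * q x)))))%:E)%E.
  have i1 := integrable_one_sub (expR_ge0 t).
  rewrite -RintegralZl// -[LHS]fineK.
    congr EFin; congr fine; apply: eq_integral => x _.
    by rewrite /F/levy/= [q x * _]mulrC; congr EFin; ring.
  apply: integrable_fin_num => //.
  rewrite (_ : (fun x => _) = (fun x => ((expR (- (sigma * t)))%:E *
      (phi x * (1 - expR (- (expR t * q x))))%:E)%E)).
    exact: integrableZl.
  by apply/funext => x; rewrite -EFinM /F/levy/= [q x * _]mulrC; congr EFin; ring.
have [iy Ey] := integral_levy s0 s1 y0.
have iG := integrable_fubini_F iF.
have {}iG : leb.-integrable setT (EFin \o (fun t => expR (- (sigma * t)) *
    \int[mu]_x (phi x * (1 - expR (- (expR t * q x)))))).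
  rewrite (_ : EFin \o _ = fubini_F mu (EFin \o F)); first exact: iG.
  by apply/funext => t; exact/esym/e2.
have le1 : \int[leb]_t (expR (- (sigma * t)) *
    \int[mu]_x (phi x * (1 - expR (- (expR t * q x))))) <=
    \int[leb]_t (A * levy sigma y t).
  apply: le_Rintegral => //; first exact: lebesgue_integrableZl.
  move=> t _; rewrite /levy mulrA [leRHS]mulrC ler_wpM2l ?expR_ge0// [y * _]mulrC.
  by apply: H; exact: expR_gt0.
rewrite -(ler_pM2l J0); apply: le_trans (_ : _ <= \int[leb]_t (A * levy sigma y t)) _.
  apply: le_trans le1; rewrite -RintegralZl// /Rintegral.
  have := Fubini iF => /= h; rewrite le_eqVlt; apply/orP; left; apply/eqP.
  congr fine; transitivity (\int[mu]_x \int[leb]_t (F (t, x))%:E)%E.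
    by apply: eq_integral => x _; rewrite -e0.
  by rewrite -h; apply: eq_integral => t _; exact: e2.
rewrite RintegralZl// Ey le_eqVlt; apply/orP; left; apply/eqP; ring.
Qed.

End bernstein.

(** * The fractional Laplacian of a Gaussian *)

Section fractional_gaussian.
Context {R : realType} {n : nat}.
Local Notation E := 'rV[R]_n.
Local Notation lam := (@lebesgue_rV R n).
Local Notation leb := (@lebesgue_measure R).

(** The Fourier integral of [gauss b], in closed form; see [gaussFE]. The
    parameter [b] is also heat time: the heat flow sends [gaussF b] to
    [gaussF (b + s)]. *)
Definition gaussF (b : R) (x : E) : R := Num.sqrt (pi / b) ^+ n * gauss (4 * b)^-1 x.

(** [(-Delta)^sigma] applied to [gaussF b]. *)
Definition riesz_gaussF (b sigma : R) (x : E) : R :=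
  \int[lam]_xi (gauss b xi * dot xi xi `^ sigma * cos (dot x xi)).

(** A square-integrable function that dominates, uniformly in [s >= 0], the
    Gaussians produced by the heat flow; see [gauss_tail]. *)
Definition tail_bound (b : R) (x : E) : R :=
  \prod_i Num.sqrt (4 * pi / (4 * b + x ord0 i ^+ 2)).

Lemma gaussF_ge0 b x : 0 <= gaussF b x.
Proof. by rewrite mulr_ge0 ?gauss_ge0// exprn_ge0// sqrtr_ge0. Qed.

Lemma measurable_gaussF b : measurable_fun setT (gaussF b).
Proof. by apply: measurable_funM => //; exact: measurable_gauss. Qed.

Lemma gaussFE b x : 0 < b -> gaussF b x = \int[lam]_xi (gauss b xi * cos (dot x xi)).
Proof.
move=> b0; have := Rintegral_gauss_cos x 0 b0.
by rewrite cos0 mul1r /gaussF => <-; apply: eq_Rintegral => xi _; rewrite addr0.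
Qed.

Lemma one_sub_expRN_mul_le (c s : R) : 0 <= c -> 0 <= s ->
  1 - expR (- (s * c)) <= (1 + c) * (1 - expR (- s)).
Proof.
move=> c0 s0; have s1 : 0 < 1 + s by rewrite ltr_pwDl.
have h : s / (1 + s) <= 1 - expR (- s).
  have : expR (- s) <= (1 + s)^-1.
    by rewrite expRN lef_pV2 ?posrE ?expR_gt0// expR_ge1Dx.
  have -> : s / (1 + s) = 1 - (1 + s)^-1 by field; rewrite gt_eqF.
  by move: (expR _) (_^-1) => *; lra.
have c1 : 0 <= 1 + c by rewrite addr_ge0.
apply: le_trans (ler_wpM2l c1 h).
rewrite mulrA ler_pdivlMr//; have [sc|sc] := leP (s * c) 1.
  apply: (@le_trans _ _ (s * c * (1 + s))); last by nra.
  by rewrite ler_wpM2r ?(ltW s1)// one_sub_expRN_le.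
apply: (@le_trans _ _ (1 * (1 + s))); last by nra.
by rewrite ler_wpM2r ?(ltW s1)// one_sub_expRN_le1.
Qed.

(** The exponent only becomes flatter with [s], and the normalisation loses
    [(1 + s / b) ^ (n / 2) <= exp (s n / (2 b))]. *)
Lemma gaussF_decay b s x : 0 < b -> 0 <= s ->
  expR (- (s * (n%:R / (2 * b)))) * gaussF b x <= gaussF (b + s) x.
Proof.
move=> b0 s0; have bs0 : 0 < b + s by rewrite ltr_wpDr.
rewrite /gaussF mulrA; apply: ler_pM.
- by rewrite mulr_ge0 ?expR_ge0// exprn_ge0// sqrtr_ge0.
- exact: gauss_ge0.
- have -> : expR (- (s * (n%:R / (2 * b)))) = expR (- (s / (2 * b))) ^+ n.
    by rewrite -expRM_natl; congr expR; ring.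
  rewrite -exprMn lerXn2r ?nnegrE ?mulr_ge0 ?expR_ge0 ?sqrtr_ge0//.
  have e1 : expR (- (s / (2 * b))) = Num.sqrt (expR (- (s / b))).
    have -> : expR (- (s / b)) = expR (- (s / (2 * b))) ^+ 2.
      by rewrite expr2 -expRD; congr expR; field; rewrite gt_eqF.
    by rewrite sqrtr_sqr ger0_norm ?expR_ge0.
  rewrite e1 -sqrtrM ?expR_ge0// ler_wsqrtr//.
  rewrite expRN mulrC ler_pdivrMr ?expR_gt0//.
  have h : 1 + s / b <= expR (s / b) by exact: expR_ge1Dx.
  have p0 : 0 <= pi / (b + s) :> R by rewrite divr_ge0 ?pi_ge0// ltW.
  apply: le_trans (ler_wpM2l p0 h).
  by rewrite le_eqVlt; apply/orP; left; apply/eqP; field; rewrite !gt_eqF.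
- rewrite ler_expR lerN2 ler_wpM2r ?dot_ge0// lef_pV2 ?posrE ?mulr_gt0//.
  by rewrite ler_pM2l// lerDl.
Qed.

(** The normalisation decreases with [s], so that only the exponent contributes;
    half of it pays for the factor [|x|^2] that comes out. With [gaussF_decay],
    this bounds the increments of the heat flow from both sides. *)
Lemma gaussF_growth b s x : 0 < b -> 0 <= s ->
  gaussF (b + s) x - gaussF b x <= (1 - expR (- s)) * ((1 + 2 / b) *
    (Num.sqrt (pi / (b + s)) ^+ n * gauss (8 * (b + s))^-1 x)).
Proof.
move=> b0 s0; have bs0 : 0 < b + s by rewrite ltr_wpDr.
pose z := dot x x / (4 * (b + s)).
have z0 : 0 <= z by rewrite divr_ge0 ?dot_ge0// mulr_ge0// ltW.
have g1 : gauss (4 * (b + s))^-1 x = expR (- z) by rewrite /gauss mulrC.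
have g2 : gauss (8 * (b + s))^-1 x = expR (- (z / 2)).
  by rewrite /gauss /z; congr expR; field; rewrite gt_eqF.
have g3 : gauss (4 * b)^-1 x = expR (- z) * expR (- (s * (z / b))).
  rewrite -expRD /gauss /z; congr expR; field; rewrite !gt_eqF//.
have K0 : 0 <= Num.sqrt (pi / (b + s)) ^+ n by rewrite exprn_ge0// sqrtr_ge0.
rewrite /gaussF g1 g2 g3.
apply: (@le_trans _ _ (Num.sqrt (pi / (b + s)) ^+ n *
    (expR (- z) * (1 - expR (- (s * (z / b))))))).
  rewrite mulrBr mulr1 mulrBr lerB// ler_wpM2r ?mulr_ge0 ?expR_ge0//.
  rewrite lerXn2r ?nnegrE ?sqrtr_ge0// ler_wsqrtr// ler_wpM2l ?pi_ge0//.
  by rewrite lef_pV2 ?posrE// lerDl.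
rewrite [leRHS](_ : _ = Num.sqrt (pi / (b + s)) ^+ n *
  ((1 - expR (- s)) * ((1 + 2 / b) * expR (- (z / 2))))); last by ring.
apply: ler_wpM2l => //.
have zb : 0 <= z / b by rewrite divr_ge0// ltW.
apply: (le_trans (ler_wpM2l (expR_ge0 (- z)) (one_sub_expRN_mul_le zb s0))).
rewrite mulrA mulrC ler_wpM2l ?one_sub_expRN_ge0//.
have -> : expR (- z) = expR (- (z / 2)) * expR (- (z / 2)).
  by rewrite -expRD; congr expR; field.
rewrite -mulrA [leRHS]mulrC ler_wpM2l ?expR_ge0// expRN mulrC ler_pdivrMr ?expR_gt0//.
have h : 1 + z / 2 <= expR (z / 2) by exact: expR_ge1Dx.
have b2 : 0 <= 1 + 2 / b by rewrite addr_ge0// divr_ge0// ltW.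
apply: le_trans (ler_wpM2l b2 h).
have -> : (1 + 2 / b) * (1 + z / 2) = 1 + z / b + (2 / b + z / 2) by field; rewrite gt_eqF.
by rewrite lerDl addr_ge0// divr_ge0// ltW.
Qed.

(** In each coordinate [1 + z <= exp z] at [z = y^2 / (4 (b + s))]. *)
Lemma gauss_tail b s x : 0 < b -> 0 <= s ->
  Num.sqrt (pi / (b + s)) ^+ n * gauss (8 * (b + s))^-1 x <= tail_bound b x.
Proof.
move=> b0 s0; have bs0 : 0 < b + s by rewrite ltr_wpDr.
rewrite gauss_prod -[X in X ^+ n]/(Num.sqrt (pi / (b + s))).
have -> : Num.sqrt (pi / (b + s)) ^+ n = \prod_(i < n) Num.sqrt (pi / (b + s)).
  by rewrite prodr_const card_ord.
rewrite -big_split/= /tail_bound; apply: ler_prod => i _.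
rewrite mulr_ge0 ?sqrtr_ge0 ?(ltW (gauss1_gt0 _ _))//=.
move: (x ord0 i : R) => y; have y0 : 0 <= y ^+ 2 by exact: sqr_ge0.
have e1 : gauss1 (8 * (b + s))^-1 y = Num.sqrt (expR (- (y ^+ 2 / (4 * (b + s))))).
  have -> : expR (- (y ^+ 2 / (4 * (b + s)))) = gauss1 (8 * (b + s))^-1 y ^+ 2.
    by rewrite /gauss1 [RHS]expr2 -expRD; congr expR; field; rewrite gt_eqF.
  by rewrite sqrtr_sqr ger0_norm// ltW// gauss1_gt0.
rewrite e1 -sqrtrM; last by rewrite divr_ge0 ?pi_ge0// ltW.
rewrite ler_wsqrtr// expRN ler_pdivrMr ?expR_gt0//.
have h : 1 + y ^+ 2 / (4 * (b + s)) <= expR (y ^+ 2 / (4 * (b + s))) by exact: expR_ge1Dx.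
have by0 : 0 < 4 * b + y ^+ 2 by rewrite ltr_wpDr// mulr_gt0.
have p0 : 0 <= 4 * pi / (4 * b + y ^+ 2) :> R.
  by rewrite divr_ge0 ?mulr_ge0 ?pi_ge0// ltW.
apply: le_trans (ler_wpM2l p0 h).
have -> : 4 * pi / (4 * b + y ^+ 2) * (1 + y ^+ 2 / (4 * (b + s))) =
   pi / (b + s) * ((4 * (b + s) + y ^+ 2) / (4 * b + y ^+ 2)).
  by field; rewrite !gt_eqF.
rewrite ler_peMr ?divr_ge0 ?pi_ge0 ?(ltW bs0)// ler_pdivlMr// mul1r lerD2r.
by rewrite ler_pM2l// lerDl.
Qed.

Lemma tail_bound_ge0 b x : 0 <= tail_bound b x.
Proof. by apply: prodr_ge0 => i _; exact: sqrtr_ge0. Qed.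

Lemma gaussF_le_tail b x : 0 < b -> gaussF b x <= tail_bound b x.
Proof.
move=> b0; have := gauss_tail x b0 (lexx 0); rewrite addr0; apply: le_trans.
rewrite /gaussF ler_wpM2l ?exprn_ge0 ?sqrtr_ge0// ler_expR lerN2 ler_wpM2r ?dot_ge0//.
by rewrite lef_pV2 ?posrE ?mulr_gt0// ler_pM2r// ler_nat.
Qed.

Lemma tail_bound_L2 b : 0 < b -> L2 (tail_bound b).
Proof.
move=> b0.
pose h (y : R) := 4 * pi / (4 * b + y ^+ 2).
have d0 y : 0 < 4 * b + y ^+ 2 by rewrite ltr_wpDr ?sqr_ge0// mulr_gt0.
have h0 y : 0 <= h y by rewrite divr_ge0 ?mulr_ge0 ?pi_ge0// ltW.
have ch : continuous h.
  move=> y; apply: cvgM; first exact: cvg_cst.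
  apply: cvgV; first by rewrite gt_eqF.
  by apply: cvgD; [exact: cvg_cst|exact: exprn_continuous].
have ih : leb.-integrable setT (EFin \o h).
  pose C := 4 * pi * (1 + (4 * b)^-1).
  apply: (lebesgue_integrable_dominated ch _ (lebesgue_integrableZl C integrable_oneDsqrV)).
  move=> y; rewrite ger0_norm// /h /C.
  rewrite [leRHS](_ : _ = 4 * pi * ((1 + (4 * b)^-1) / (1 + y ^+ 2))); last by rewrite mulrA.
  rewrite ler_wpM2l ?mulr_ge0 ?pi_ge0//.
  have y1 : 0 < 1 + y ^+ 2 by rewrite ltr_pwDl ?sqr_ge0.
  rewrite ler_pdivlMr// mulrC ler_pdivrMr//.
  have -> : (1 + (4 * b)^-1) * (4 * b + y ^+ 2) = 1 + y ^+ 2 + (4 * b + y ^+ 2 / (4 * b)).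
    by field; rewrite gt_eqF.
  by rewrite lerDl addr_ge0 ?divr_ge0 ?sqr_ge0// mulr_ge0// ltW.
have ms : measurable_fun setT (fun y : R => Num.sqrt (h y)).
  apply: (@measurableT_comp _ _ _ _ _ _ (@Num.sqrt R)).
    by apply: continuous_measurable_fun; exact: sqrt_continuous.
  exact: continuous_measurable_fun ch.
apply/Lfun2P; split; first exact: (@measurable_prod_coord R n (fun=> fun y => Num.sqrt (h y))).
have [i1 _] := @Rintegral_prod R n (fun=> h) (fun=> ih).
rewrite (_ : (fun x => tail_bound b x ^+ 2) = (fun x : E => \prod_i h (x ord0 i)))//.
apply/funext => x; rewrite /tail_bound -prodrXl; apply: eq_bigr => i _.
by rewrite sqr_sqrtr//; exact: h0.
Qed.

Lemma gauss_dot_le b (x : E) : 0 < b -> gauss b x * dot x x <= 2 / b * gauss (b / 2) x.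
Proof.
move=> b0; have -> : gauss b x = gauss (b / 2) x * gauss (b / 2) x.
  by rewrite /gauss -expRD; congr expR; field.
rewrite -mulrA [leRHS]mulrC ler_wpM2l ?gauss_ge0// {1}/gauss expRN mulrC.
rewrite ler_pdivrMr ?expR_gt0//.
have h : 1 + b / 2 * dot x x <= expR (b / 2 * dot x x) by exact: expR_ge1Dx.
have b2 : 0 <= 2 / b by rewrite divr_ge0// ltW.
apply: le_trans (ler_wpM2l b2 h).
have -> : 2 / b * (1 + b / 2 * dot x x) = dot x x + 2 / b by field; rewrite gt_eqF.
by rewrite lerDl.
Qed.

Section symbol.
Variables (b sigma : R).
Hypotheses (b0 : 0 < b) (s0 : 0 < sigma) (s1 : sigma <= 1).

Let mdot : measurable_fun setT (fun x : E => dot x x) := @measurable_dot_self R n.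

Let igauss_dot : lam.-integrable setT (EFin \o (fun xi : E => gauss b xi * dot xi xi)).
Proof.
have [i1 _] := @integral_gauss R n (b / 2) (divr_gt0 b0 (ltr0Sn R 1)).
apply: (integrable_dominated (g := fun xi => 2 / b * gauss (b / 2) xi)).
- by apply: measurable_funM => //; exact: measurable_gauss.
- by move=> xi; rewrite ger0_norm ?gauss_dot_le// mulr_ge0 ?gauss_ge0 ?dot_ge0.
- exact: real_integrableZl.
Qed.

Lemma integrable_symbol :
  lam.-integrable setT (EFin \o (fun xi : E => gauss b xi * dot xi xi `^ sigma)).
Proof.
have [i1 _] := @integral_gauss R n b b0.
by apply: integrable_powR => //; exact: dot_ge0.
Qed.

Lemma symbol_L2 : L2 (fun xi : E => gauss b xi * dot xi xi `^ sigma).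
Proof.
apply: (@Lfun2_dominated _ _ _ _ _ (fun xi => (1 + 2 / b) * gauss (b / 2) xi)).
- exact: integrable_measurable integrable_symbol.
- move=> xi; rewrite ger0_norm ?mulr_ge0 ?gauss_ge0 ?powR_ge0//.
  apply: (@le_trans _ _ (gauss b xi * (1 + dot xi xi))).
    by rewrite ler_wpM2l ?gauss_ge0// powR_le_oneD// dot_ge0.
  rewrite mulrDr mulr1 mulrDl mul1r lerD ?gauss_dot_le//.
  rewrite ler_expR lerN2 ler_wpM2r ?dot_ge0// ler_pdivrMr// ler_peMr// ?ltW//.
  by rewrite ltr1n.
- by apply: Lfun2Zl; apply: gauss_L2; rewrite divr_gt0.
Qed.

(* The factor [c] is [1] or [-1]: [bernstein_le] is an upper bound, used with
   both signs in [riesz_gaussF_abs_le]. *)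
Let phi (c : R) (x xi : E) := gauss b xi * (c * cos (dot x xi)).

Let mcos c x : measurable_fun setT (fun xi : E => c * cos (dot x xi)).
Proof.
have := @measurable_cos_dot R n x 0; under eq_fun do rewrite addr0.
by move=> m; exact: measurable_funM.
Qed.

Let iphi c x : lam.-integrable setT (EFin \o phi c x).
Proof.
have [i1 _] := @integral_gauss R n b b0.
apply: (integrable_dominated (g := fun xi => `|c| * gauss b xi)).
- by apply: measurable_funM => //; exact: measurable_gauss.
- move=> xi; rewrite /phi !normrM mulrC (ger0_norm (gauss_ge0 _ _)).
  by rewrite ler_wpM2r ?gauss_ge0// ler_piMr ?normr_cos_le1.
- exact: real_integrableZl.
Qed.

Let iphiq c x : lam.-integrable setT (EFin \o (fun xi => phi c x xi * dot xi xi)).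
Proof.
apply: (integrable_dominated (g := fun xi => `|c| * (gauss b xi * dot xi xi))).
- by apply: measurable_funM => //; exact: integrable_measurable (iphi c x).
- move=> xi; rewrite /phi !normrM (ger0_norm (gauss_ge0 _ _)) (ger0_norm (dot_ge0 _)).
  rewrite [leRHS]mulrA ler_wpM2r ?dot_ge0// mulrC ler_wpM2r ?gauss_ge0//.
  by rewrite ler_piMr ?normr_cos_le1.
- exact: real_integrableZl.
Qed.

Let phi_heat c x s : 0 < s ->
  \int[lam]_xi (phi c x xi * (1 - expR (- (s * dot xi xi)))) =
  c * (gaussF b x - gaussF (b + s) x).
Proof.
move=> sp; have bs0 : 0 < b + s by rewrite addr_gt0.
rewrite !gaussFE// -RintegralB//; first last.
- have := integrable_gauss_cos x 0 bs0.
  by rewrite /comp; under eq_fun do rewrite addr0.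
- have := integrable_gauss_cos x 0 b0.
  by rewrite /comp; under eq_fun do rewrite addr0.
rewrite -RintegralZl//; last first.
  have i1 := integrable_gauss_cos x 0 b0.
  have i2 := integrable_gauss_cos x 0 bs0.
  have := real_integrableB i1 i2.
  by rewrite /comp; under eq_fun do rewrite !addr0.
apply: eq_Rintegral => xi _; rewrite /phi.
have -> : gauss (b + s) xi = gauss b xi * expR (- (s * dot xi xi)).
  by rewrite /gauss -expRD; congr expR; ring.
ring.
Qed.

Let rieszE c x : \int[lam]_xi (phi c x xi * dot xi xi `^ sigma) = c * riesz_gaussF b sigma x.
Proof.
rewrite /riesz_gaussF -RintegralZl//; last first.
  have := integrable_powR mdot (@dot_ge0 R n) (iphi 1 x) (iphiq 1 x) s0 s1.
  rewrite /phi/=; apply: eq_integrable => // xi _ /=; congr EFin; ring.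
by apply: eq_Rintegral => xi _; rewrite /phi; ring.
Qed.

(** [bernstein_le] applied to the decay of the heat flow. *)
Lemma riesz_gaussF_le x :
  riesz_gaussF b sigma x <= gaussF b x * (n%:R / (2 * b)) `^ sigma.
Proof.
rewrite -[leLHS]mul1r -rieszE.
apply: (bernstein_le mdot (@dot_ge0 R n) (iphi 1 x) (iphiq 1 x)) => //.
  by rewrite divr_ge0// mulr_ge0// ltW.
move=> s sp; rewrite phi_heat// mul1r.
have := gaussF_decay x b0 (ltW sp); move: (expR _) (gaussF b x) (gaussF _ x) => *; lra.
Qed.

(** Rough, but enough for square integrability. As [1 - exp (- s)] is the
    mixture's integrand at [y = 1], bounds for the heat flow by multiples of it
    pass to [riesz_gaussF] with the same constant. *)
Lemma riesz_gaussF_abs_le :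
  exists2 C, 0 <= C & forall x, `|riesz_gaussF b sigma x| <= C * tail_bound b x.
Proof.
pose c := n%:R / (2 * b).
have c0 : 0 <= c by rewrite divr_ge0// mulr_ge0// ltW.
have b2 : 0 <= 2 / b by rewrite divr_ge0// ltW.
exists ((1 + c) + (1 + 2 / b)); first by rewrite !addr_ge0.
move=> x; set A := _ * tail_bound b x.
have t0 := tail_bound_ge0 b x.
have A1 : (1 + c) * tail_bound b x <= A.
  by rewrite ler_wpM2r// lerDl addr_ge0.
have A2 : (1 + 2 / b) * tail_bound b x <= A.
  by rewrite ler_wpM2r// lerDr addr_ge0.
have d (s : R) : 0 < s -> 0 <= 1 - expR (- s).
  by move=> sp; rewrite one_sub_expRN_ge0// ltW.
have ub a : (forall s, 0 < s ->
    a * (gaussF b x - gaussF (b + s) x) <= A * (1 - expR (- s))) ->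
    a * riesz_gaussF b sigma x <= A.
  move=> H; rewrite -rieszE (_ : A = A * 1 `^ sigma); last by rewrite powR1 mulr1.
  apply: (bernstein_le mdot (@dot_ge0 R n) (iphi a x) (iphiq a x)) => // s sp.
  by rewrite phi_heat// mulr1 H.
rewrite ler_norml lerNl -mulN1r -[X in _ && (X <= _)]mul1r.
apply/andP; split; apply: ub => s sp; rewrite ?mul1r ?mulN1r ?opprB.
- apply: (le_trans (gaussF_growth x b0 (ltW sp))).
  rewrite [leLHS]mulrC ler_wpM2r ?d//; apply: le_trans A2.
  by rewrite ler_wpM2l ?addr_ge0// gauss_tail// ltW.
- apply: (@le_trans _ _ ((1 - expR (- (s * c))) * gaussF b x)).
    have := gaussF_decay x b0 (ltW sp).
    rewrite -/c; move: (expR _) (gaussF b x) (gaussF _ x) => *; lra.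
  apply: (@le_trans _ _ ((1 + c) * (1 - expR (- s)) * gaussF b x)).
    by rewrite ler_wpM2r ?gaussF_ge0// one_sub_expRN_mul_le// ltW.
  rewrite [leLHS]mulrAC ler_wpM2r ?d//; apply: le_trans A1.
  by rewrite ler_wpM2l ?addr_ge0// gaussF_le_tail.
Qed.

Lemma measurable_riesz_gaussF : measurable_fun setT (riesz_gaussF b sigma).
Proof.
have := measurable_kernel (@continuous_cos R) (@normr_cos_le1 R) integrable_symbol.
rewrite (_ : (fun x => _) = riesz_gaussF b sigma)//.
apply/funext => x; apply: eq_Rintegral => xi _; congr (_ * cos _).
by apply: eq_bigr => i _; rewrite mulrC.
Qed.

Lemma riesz_gaussF_L2 : L2 (riesz_gaussF b sigma).
Proof.
have [C C0 HC] := riesz_gaussF_abs_le.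
apply: (Lfun2_dominated measurable_riesz_gaussF HC).
by apply: Lfun2Zl; exact: tail_bound_L2.
Qed.

Lemma gaussF_L2 : L2 (gaussF b).
Proof.
apply: (@Lfun2_dominated _ _ _ _ _ (tail_bound b)); last exact: tail_bound_L2.
  exact: measurable_gaussF.
by move=> x; rewrite ger0_norm ?gaussF_ge0// gaussF_le_tail.
Qed.

(** On the Fourier side both integrals are that of
    [gauss b xi * |xi| ^ (2 sigma) * Re (F xi)]. *)
Lemma frac_laplacian_pairing f g : frac_laplacian sigma f g ->
  \int[lam]_x (g x * gaussF b x) = \int[lam]_x (f x * riesz_gaussF b sigma x).
Proof.
move=> [F fF gF]; have [ig _] := @integral_gauss R n b b0.
have gE : gaussF b = fun x => \int[lam]_xi (gauss b xi * cos (dot x xi)).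
  by apply/funext => x; rewrite gaussFE.
have lM : L2 (fun x => \int[lam]_xi (gauss b xi * cos (dot x xi))).
  by rewrite -gE; exact: gaussF_L2.
have := fourier_pairing gF ig (gauss_L2 b0) => /= /(_ lM).
rewrite {1}gE => ->.
have := fourier_pairing fF integrable_symbol symbol_L2 => /= /(_ riesz_gaussF_L2) ->.
apply: eq_Rintegral => xi _; rewrite -mulrA; congr (_ * _).
have -> : enorm xi `^ (2 * sigma) = dot xi xi `^ sigma.
  by rewrite powRrM -enorm_sqr powR_mulrn// enorm_ge0.
by case: (F xi) => u v /=; rewrite mul0r subr0.
Qed.

End symbol.

End fractional_gaussian.

(** * Gaussians as test functions for the distributional Laplacian *)

Section smooth_line.
Context {R : realType}.
Implicit Types f g : R -> R.

Fixpoint diffn k f : Prop :=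
  if k is k'.+1 then (forall x, derivable f x 1) /\ diffn k' f^`()%classic else True.

Lemma diffnS k f df : (forall x : R, is_derive x 1 f (df x)) -> diffn k df -> diffn k.+1 f.
Proof.
move=> fdf kdf; split; first by move=> x; have [] := fdf x.
rewrite (_ : f^`()%classic = df)//; apply/funext => x.
by rewrite derive1E; have [] := fdf x.
Qed.

Lemma diffn_is_derive k f : diffn k.+1 f -> forall x : R, is_derive x 1 f (f^`()%classic x).
Proof. by move=> [df _] x; apply: DeriveDef => //; rewrite derive1E. Qed.

Lemma diffn_pred k f : diffn k.+1 f -> diffn k f.
Proof.
elim: k f => //= k IH f [df [ddf kf]]; split=> //.
exact: IH.
Qed.

Lemma diffnD k f g : diffn k f -> diffn k g -> diffn k (fun x => f x + g x).
Proof.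
elim: k f g => // k IH f g hf hg.
apply: diffnS; last first.
  exact: (IH (f^`()%classic) (g^`()%classic) hf.2 hg.2).
move=> x; have := diffn_is_derive hf x; have := diffn_is_derive hg x.
by move=> *; exact: is_deriveD.
Qed.

Lemma diffnM k f g : diffn k f -> diffn k g -> diffn k (fun x => f x * g x).
Proof.
elim: k f g => // k IH f g hf hg.
apply: (@diffnS _ _ (fun x => f x * g^`()%classic x + f^`()%classic x * g x)); last first.
  apply: diffnD; apply: IH => //; [exact: diffn_pred|exact: hg.2|exact: hf.2|].
  exact: diffn_pred.
move=> x; have h1 := diffn_is_derive hf x; have h2 := diffn_is_derive hg x.
by apply: is_derive_eq; rewrite /GRing.scale/= [g x * _]mulrC.
Qed.

Lemma diffn_cst k c : diffn k (fun=> c).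
Proof.
by elim: k c => // k IH c; apply: (@diffnS _ _ (fun=> 0)); last exact: IH.
Qed.

Lemma diffn_id k : diffn k (fun x => x).
Proof.
by case: k => // k; apply: (@diffnS _ _ (fun=> 1)); last exact: diffn_cst.
Qed.

Lemma is_derive_affine (a b x : R) : is_derive x 1 (fun z => a * z + b) a.
Proof. by apply: is_derive_eq; rewrite /GRing.scale/=; ring. Qed.

Lemma is_derive_comp_affine (a b x : R) f (df : R) : is_derive (a * x + b) 1 f df ->
  is_derive x 1 (fun z => f (a * z + b)) (a * df).
Proof.
move=> fdf; have h := is_derive_affine a b x.
have := is_derive1_comp (f := f) (g := fun z : R => a * z + b).
by move=> /(_ x _ _ fdf h); rewrite mulrC; apply.
Qed.

Lemma diffn_affine k (a b : R) f : diffn k f -> diffn k (fun x => f (a * x + b)).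
Proof.
elim: k f => // k IH f hf.
apply: (@diffnS _ _ (fun x => a * f^`()%classic (a * x + b))); last first.
  by apply: diffnM; [exact: diffn_cst|apply: (IH f^`()%classic); exact: hf.2].
by move=> x; apply: is_derive_comp_affine; exact: diffn_is_derive hf _.
Qed.

Lemma diffn_gauss1 k b : diffn k (gauss1 b).
Proof.
elim: k => // k IH; apply: (@diffnS _ _ (fun x => (- 2 * b) * x * gauss1 b x)).
  by move=> x; rewrite !mulNr -mulNr; exact: is_derive_gauss1.
by apply: diffnM => //; apply: diffnM; [exact: diffn_cst|exact: diffn_id].
Qed.

Lemma diffn_continuous f : diffn 1 f -> continuous f.
Proof.
move=> [df _] x; apply: differentiable_continuous; exact/derivable1_diffP.
Qed.

(** A polynomial in [1 / y] is kept as a factor so that the class is stable under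
    derivation, which makes smoothness at [0] an induction. *)
Definition flat (P : {poly R}) (y : R) : R :=
  if 0 < y then P.[y^-1] * expR (- y^-1) else 0.

Lemma pow_le_expR (i : nat) (z : R) : 0 <= z -> z ^+ i <= (i%:R ^+ i + 1) * expR z.
Proof.
move=> z0; case: i => [|i].
  rewrite !expr0 (@le_trans _ _ (expR z))//.
    by rewrite -[leLHS]expR0 ler_expR.
  by rewrite ler_peMl ?expR_ge0// lerDl.
have i0 : 0 < i.+1%:R :> R by [].
have h : z / i.+1%:R <= expR (z / i.+1%:R).
  by apply: le_trans (expR_ge1Dx _); rewrite lerDr.
have : (z / i.+1%:R) ^+ i.+1 <= expR (z / i.+1%:R) ^+ i.+1.
  by rewrite lerXn2r ?nnegrE ?expR_ge0// divr_ge0.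
rewrite -expRM_natl mulrCA divff ?gt_eqF// mulr1 exprMn exprVn.
rewrite ler_pdivrMr ?exprn_gt0// mulrC => /le_trans; apply.
by rewrite ler_wpM2r ?expR_ge0// lerDl.
Qed.

Lemma flat_bounded P : exists2 C, 0 <= C & forall y, `|flat P y| <= C.
Proof.
exists (\sum_(i < size P) `|P`_i| * (i%:R ^+ i + 1)).
  by apply: sumr_ge0 => i _; rewrite mulr_ge0// addr_ge0// exprn_ge0.
move=> y; rewrite /flat; case: ifPn => [y0|_]; last first.
  by rewrite normr0; apply: sumr_ge0 => i _; rewrite mulr_ge0// addr_ge0// exprn_ge0.
have z0 : 0 <= y^-1 by rewrite invr_ge0 ltW.
rewrite horner_coef mulr_suml (le_trans (ler_norm_sum _ _ _))//.
apply: ler_sum => i _; rewrite !normrM -mulrA ler_wpM2l//.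
rewrite (ger0_norm (expR_ge0 _)) ger0_norm ?exprn_ge0// expRN.
by rewrite ler_pdivrMr ?expR_gt0// pow_le_expR.
Qed.

Lemma is_derive_flat P (y : R) :
  is_derive y 1 (flat P) (flat ('X^2 * (P - P^`())) y).
Proof.
have [y0|y0|<-] := ltgtP 0 y.
- have h : is_derive y 1 (fun y => P.[y^-1] * expR (- y^-1)) (flat ('X^2 * (P - P^`())) y).
    have yn0 : y != 0 by rewrite gt_eqF.
    have d1 : is_derive y 1 (fun y : R => y^-1) (- y ^- 2).
      have := is_deriveV (f := id) yn0 (is_derive_id y (1 : R)).
      by rewrite /GRing.scale/= mulr1; apply.
    have d2 : is_derive y 1 (fun y : R => P.[y^-1]) (P^`().[y^-1] * - y ^- 2).
      have := is_derive1_comp (f := horner P) (g := fun z : R => z^-1).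
      by apply.
    have d3 : is_derive y 1 (fun y : R => expR (- y^-1)) (expR (- y^-1) * y ^- 2).
      have d4 : is_derive y 1 (fun y : R => - y^-1) (y ^- 2).
        by rewrite -[y ^- 2]opprK; exact: is_deriveN.
      have := is_derive1_comp (f := expR) (g := fun z : R => - z^-1).
      by apply.
    apply: is_derive_eq; rewrite /flat y0 !hornerE/= /GRing.scale/= exprVn; ring.
  apply: near_eq_is_derive h; near=> z.
  by rewrite /flat ifT//; near: z; exact: lt_nbhsr.
- have h : is_derive y 1 (fun=> 0 : R) (flat ('X^2 * (P - P^`())) y).
    rewrite /flat ifF; last by apply/negbTE; rewrite -leNgt ltW.
    exact: is_derive_cst.
  apply: near_eq_is_derive h; near=> z.
  rewrite /flat ifF//; apply/negbTE; rewrite -leNgt ltW//; near: z.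
  exact: lt_nbhsl.
- have -> : flat ('X^2 * (P - P^`())) 0 = 0 by rewrite /flat ltxx.
  have [C C0 HC] := flat_bounded ('X^2 * P).
  (* At [0], [flat P y] is [y^2] times the bounded function [flat ('X^2 P) y]. *)
  have quad (z : R) : `|flat P z| <= C * z ^+ 2.
    have := HC z; rewrite /flat; case: ifPn => [z0|_ _]; last first.
      by rewrite normr0 mulr_ge0// sqr_ge0.
    rewrite hornerM hornerXn -mulrA normrM.
    rewrite (ger0_norm (exprn_ge0 _ (_ : 0 <= z^-1))) ?invr_ge0 ?(ltW z0)//.
    by rewrite exprVn mulrC ler_pdivrMr ?exprn_gt0.
  have lim : (h^-1 *: (flat P (h *: 1 + 0) - flat P 0)) @[h --> 0^'] --> (0 : R).
    apply/cvgr0Pnorm_le => e e0; near=> h.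
    have hn0 : h != 0 by near: h; exact: nbhs_dnbhs_neq.
    rewrite /GRing.scale/= mulr1 addr0 {2}/flat ltxx subr0 normrM normfV.
    rewrite ler_pdivrMl ?normr_gt0// (le_trans (quad h))//.
    have -> : h ^+ 2 = `|h| * `|h| by rewrite -expr2 real_normK// num_real.
    rewrite mulrCA ler_wpM2l//.
    have : `|h| <= e / (C + 1).
      near: h; apply: dnbhs0_le; rewrite divr_gt0// ltr_wpDl//.
    rewrite ler_pdivlMr ?ltr_wpDl// mulrDr mulr1 mulrC => /(le_trans _); apply.
    by rewrite lerDl.
  apply: DeriveDef; first by apply/cvg_ex; exists 0; exact: lim.
  exact: cvg_lim.
Unshelve. all: by end_near. Qed.

Lemma diffn_flat k P : diffn k (flat P).
Proof.
elim: k P => // k IH P.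
apply: (@diffnS _ _ (flat ('X^2 * (P - P^`())))); last exact: IH.
by move=> x; exact: is_derive_flat.
Qed.

End smooth_line.

Section tensor_products.
Context {R : realType} {n : nat}.
Local Notation E := 'rV[R]_n.
Implicit Types (f : 'I_n -> R -> R) (x : E).

(** Products of functions of one coordinate are stable under partial
    derivatives, so that their smoothness is a question on the line. *)
Definition tensor f (x : E) : R := \prod_j f j (x ord0 j).

Definition tensor_derive (i : 'I_n) f : 'I_n -> R -> R :=
  fun j => if j == i then (f j)^`()%classic else f j.

Lemma is_derive_tensor f i x : (forall j y, derivable (f j) y 1) ->
  is_derive x (delta_mx ord0 i) (tensor f) (tensor (tensor_derive i f) x).
Proof.
move=> df.
pose c := \prod_(j | j != i) f j (x ord0 j).
have E h : tensor f (h *: delta_mx ord0 i + x) = f i (h + x ord0 i) * c.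
  rewrite /tensor (bigD1 i)//= !mxE !eqxx mulr1; congr (_ * _).
  by apply: eq_bigr => j /negbTE ji; rewrite !mxE ji andbF mulr0 add0r.
have E' : tensor (tensor_derive i f) x = (f i)^`()%classic (x ord0 i) * c.
  rewrite /tensor (bigD1 i)//= /tensor_derive eqxx; congr (_ * _).
  by apply: eq_bigr => j /negbTE ji; rewrite ji.
have E0 : tensor f x = f i (x ord0 i) * c.
  by have := E 0; rewrite scale0r !add0r.
have lim : (h^-1 *: (tensor f (h *: delta_mx ord0 i + x) - tensor f x)) @[h --> 0^']
    --> (tensor (tensor_derive i f) x).
  rewrite E' E0.
  rewrite (_ : (fun h => _) = (fun h : R =>
     (h^-1 *: (f i (h *: 1 + x ord0 i) - f i (x ord0 i))) * c)); last first.
    by apply/funext => h; rewrite E /GRing.scale/= mulr1 -mulrBl mulrA.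
  apply: cvgMl; rewrite derive1E; exact: df.
apply: DeriveDef; first by apply/cvg_ex; eexists; exact: lim.
exact: cvg_lim.
Qed.

Lemma continuous_tensor f : (forall j, continuous (f j)) -> continuous (tensor f).
Proof.
move=> cf; apply: (continuous_big (@mul_continuous R)) => j _.
move=> x; apply: continuous_comp; first exact: coord_continuous.
exact: cf.
Qed.

Lemma tensor_partials f s : (forall j k, diffn k (f j)) ->
  exists2 g, (forall j k, diffn k (g j)) & partials s (tensor f) = tensor g.
Proof.
move=> kf; elim: s => [|i s [g kg Eg]]; first by exists f.
exists (tensor_derive i g).
  move=> j k; rewrite /tensor_derive; case: ifPn => // _.
  exact: (kg j k.+1).2.
rewrite /= Eg; apply/funext => x; rewrite /partial.
by have [] := is_derive_tensor i x (fun j => (kg j 1).1).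
Qed.

Lemma smooth_tensor f : (forall j k, diffn k (f j)) -> smooth (tensor f).
Proof.
move=> kf s; have [g kg ->] := tensor_partials s kf; split.
  by apply: continuous_tensor => j; apply: diffn_continuous; exact: kg.
move=> i x; have [] := is_derive_tensor i x (fun j => (kg j 1).1).
by [].
Qed.

Lemma Cc_infty_tensor f (r : R) : (forall j k, diffn k (f j)) ->
  (forall j y, f j y != 0 -> `|y| <= r) -> Cc_infty (tensor f).
Proof.
move=> kf fr; split; first exact: smooth_tensor.
have cB : compact [set x : E | forall i, `[- r, r]%classic (x ord0 i)].
  by apply: (@rV_compact R n (fun=> `[- r, r]%classic)) => i; exact: segment_compact.
apply: (subclosed_compact _ cB); first exact: closed_closure.
have clB := compact_closed (@norm_hausdorff _ _) cB.
rewrite [X in _ `<=` X](closure_id _).1//; apply: closure_subset => x /= fx i.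
rewrite in_itv/= -ler_norml; apply: (fr i).
by apply: contraNN fx => /eqP fi; rewrite /tensor (bigD1 i)//= fi mul0r.
Qed.

Lemma laplacian_tensor f : (forall j k, diffn k (f j)) -> forall x,
  laplacian (tensor f) x = \sum_i tensor (tensor_derive i (tensor_derive i f)) x.
Proof.
move=> kf x; apply: eq_bigr => i _.
have [g kg Eg] := tensor_partials [:: i; i] kf.
have -> : partial i (partial i (tensor f)) = partials [:: i; i] (tensor f) by [].
have k1 j k : diffn k (tensor_derive i f j).
  rewrite /tensor_derive; case: ifPn => // _; exact: (kf j k.+1).2.
rewrite /=; have -> : partial i (tensor f) = tensor (tensor_derive i f).
  by apply/funext => y; have [] := is_derive_tensor i y (fun j => (kf j 1).1).
by have [] := is_derive_tensor i x (fun j => (k1 j 1).1).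
Qed.

Lemma tensor_derive2 f i : tensor_derive i (tensor_derive i f) =
  fun j => if j == i then (f j)^`()%classic^`()%classic else f j.
Proof. by apply/funext => j; rewrite /tensor_derive; case: eqP. Qed.

Lemma cvg_tensor (f : nat -> 'I_n -> R -> R) g x :
  (forall j y, f k j y @[k --> \oo] --> g j y) ->
  tensor (f k) x @[k --> \oo] --> tensor g x.
Proof.
by move=> fg; apply: (cvg_big (@mul_continuous R)) => j _; exact: fg.
Qed.

Lemma tensor_le f (g : R -> R) x : (forall j y, `|f j y| <= g y) ->
  `|tensor f x| <= tensor (fun=> g) x.
Proof.
move=> fg; rewrite /tensor normr_prod; apply: ler_prod => j _.
by rewrite normr_ge0 fg.
Qed.

End tensor_products.

Section cutoff.
Context {R : realType}.

Let p1 : {poly R} := 'X^2 * (1 - 1^`()).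
Let p2 : {poly R} := 'X^2 * (p1 - p1^`()).

(* The arguments are in the form [a * y + b] of [is_derive_comp_affine]. *)
Definition bump (y : R) : R := flat 1 (1 * y + 1) * flat 1 (-1 * y + 1).
Definition bump1 (y : R) : R :=
  flat p1 (1 * y + 1) * flat 1 (-1 * y + 1) - flat 1 (1 * y + 1) * flat p1 (-1 * y + 1).
Definition bump2 (y : R) : R :=
  flat p2 (1 * y + 1) * flat 1 (-1 * y + 1) - 2 * (flat p1 (1 * y + 1) * flat p1 (-1 * y + 1))
  + flat 1 (1 * y + 1) * flat p2 (-1 * y + 1).

Lemma is_derive_bump (y : R) : is_derive y 1 bump (bump1 y).
Proof.
have h1 := is_derive_comp_affine (is_derive_flat 1 (1 * y + 1)).
have h2 := is_derive_comp_affine (is_derive_flat 1 (-1 * y + 1)).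
apply: is_derive_eq; rewrite /GRing.scale/= /bump1 -/p1; ring.
Qed.

Lemma is_derive_bump1 (y : R) : is_derive y 1 bump1 (bump2 y).
Proof.
have h1 := is_derive_comp_affine (is_derive_flat 1 (1 * y + 1)).
have h2 := is_derive_comp_affine (is_derive_flat 1 (-1 * y + 1)).
have h3 := is_derive_comp_affine (is_derive_flat p1 (1 * y + 1)).
have h4 := is_derive_comp_affine (is_derive_flat p1 (-1 * y + 1)).
apply: is_derive_eq; rewrite /GRing.scale/= /bump2 -/p1 -/p2; ring.
Qed.

Lemma bump_bounded : exists2 C : R, 0 <= C &
  forall y, [/\ `|bump y| <= C, `|bump1 y| <= C & `|bump2 y| <= C].
Proof.
have [A A0 HA] := @flat_bounded R 1; have [B B0 HB] := flat_bounded p1.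
have [D D0 HD] := flat_bounded p2.
exists (A * A + 2 * (A * B) + 2 * (A * D) + 2 * (B * B)).
  by rewrite !addr_ge0 ?mulr_ge0.
have M := (mulr_ge0 A0 A0, mulr_ge0 A0 B0, mulr_ge0 A0 D0, mulr_ge0 B0 B0).
have pr (u v U V : R) : `|u| <= U -> `|v| <= V -> `|u * v| <= U * V.
  by move=> ? ?; rewrite normrM ler_pM.
move=> y; split.
- by apply: le_trans (pr _ _ _ _ (HA _) (HA _)) _; move: M => [[[? ?] ?] ?]; lra.
- apply: le_trans (ler_normB _ _) _.
  have := pr _ _ _ _ (HB (1 * y + 1)) (HA (-1 * y + 1)).
  have := pr _ _ _ _ (HA (1 * y + 1)) (HB (-1 * y + 1)).
  by move: M => [[[? ?] ?] ?]; move: `|_| `|_| => *; lra.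
- apply: le_trans (ler_normD _ _) _.
  apply: le_trans (lerD (ler_normB _ _) (lexx _)) _.
  rewrite (normrM 2) (ger0_norm (_ : 0 <= 2))//.
  have := pr _ _ _ _ (HD (1 * y + 1)) (HA (-1 * y + 1)).
  have := pr _ _ _ _ (HA (1 * y + 1)) (HD (-1 * y + 1)).
  have := pr _ _ _ _ (HB (1 * y + 1)) (HB (-1 * y + 1)).
  by move: M => [[[? ?] ?] ?]; move: `|_| `|_| `|_| => *; lra.
Qed.

Lemma bump_support (y : R) : bump y != 0 -> `|y| <= 1.
Proof.
apply: contraNT; rewrite -ltNge => y1; rewrite /bump /flat.
have [y0|y0] := leP 0 y.
  rewrite (ger0_norm y0) in y1.
  have -> : 0 < -1 * y + 1 = false by apply/negbTE; rewrite -leNgt; lra.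
  by rewrite mulr0.
rewrite ltr0_norm// in y1.
have -> : 0 < 1 * y + 1 = false by apply/negbTE; rewrite -leNgt; lra.
by rewrite mul0r.
Qed.

Lemma bump0_gt0 : 0 < bump 0.
Proof.
by rewrite /bump /flat !mulr0 add0r ltr01 invr1 hornerC mul1r mulr_gt0 ?expR_gt0.
Qed.

Lemma diffn_bump k : diffn k bump.
Proof.
by apply: diffnM; apply: diffn_affine; exact: diffn_flat.
Qed.

(** The bump is dilated, with value [bump 0], not [1], in the limit. *)
Definition cut_gauss (c : R) (k : nat) (y : R) : R :=
  gauss1 c y * bump (k.+1%:R^-1 * y + 0).

Definition cut_gauss2 (c : R) (k : nat) (y : R) : R :=
  ((4 * c ^+ 2 * y ^+ 2 - 2 * c) * gauss1 c y) * bump (k.+1%:R^-1 * y + 0)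
  + 2 * (- (2 * c * y) * gauss1 c y * (k.+1%:R^-1 * bump1 (k.+1%:R^-1 * y + 0)))
  + gauss1 c y * (k.+1%:R^-1 * (k.+1%:R^-1 * bump2 (k.+1%:R^-1 * y + 0))).

Lemma diffn_cut_gauss c k m : diffn m (cut_gauss c k).
Proof. by apply: diffnM; [exact: diffn_gauss1|apply: diffn_affine; exact: diffn_bump]. Qed.

Lemma cut_gauss_derive2 c k : (cut_gauss c k)^`()%classic^`()%classic = cut_gauss2 c k.
Proof.
pose K : R := k.+1%:R^-1.
have d1 : (cut_gauss c k)^`()%classic = fun y =>
    (- (2 * c * y) * gauss1 c y) * bump (K * y + 0) + gauss1 c y * (K * bump1 (K * y + 0)).
  apply/funext => y; rewrite derive1E.
  have h1 := is_derive_gauss1 c y.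
  have h2 := is_derive_comp_affine (is_derive_bump (K * y + 0)).
  suff [] : is_derive y 1 (cut_gauss c k) ((- (2 * c * y) * gauss1 c y) * bump (K * y + 0)
    + gauss1 c y * (K * bump1 (K * y + 0))) by [].
  by apply: is_derive_eq; rewrite /GRing.scale/= -/K; ring.
rewrite d1; apply/funext => y; rewrite derive1E.
have h1 := is_derive_gauss1 c y.
have h2 := is_derive_comp_affine (is_derive_bump (K * y + 0)).
have h3 := is_derive_comp_affine (is_derive_bump1 (K * y + 0)).
have h4 : is_derive y 1 (fun y : R => - (2 * c * y)) (- (2 * c)).
  by apply: is_derive_eq; rewrite /GRing.scale/=; ring.
set F := fun y : R => _.
suff [] : is_derive y 1 F (cut_gauss2 c k y) by [].
by apply: is_derive_eq; rewrite /GRing.scale/= /cut_gauss2 -/K; ring.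
Qed.

Lemma cut_gauss_support c k y : cut_gauss c k y != 0 -> `|y| <= k.+1%:R.
Proof.
move=> h; have : bump (k.+1%:R^-1 * y + 0) != 0.
  by apply: contraNN h => /eqP e; rewrite /cut_gauss e mulr0.
move/bump_support; rewrite addr0 normrM normfV normr_nat.
by rewrite ler_pdivrMl// mulr1.
Qed.

(** Uniformly in [k]: this is the domination needed to remove the cut-off. *)
Lemma cut_gauss_le c : 0 < c -> exists2 C : R, 0 <= C &
  forall k y, `|cut_gauss c k y| <= C * gauss1 (c / 2) y /\
              `|cut_gauss2 c k y| <= C * gauss1 (c / 2) y.
Proof.
move=> c0; have [B B0 HB] := bump_bounded.
pose A := 1 + 2 / c; have A0 : 0 <= A by rewrite addr_ge0// divr_ge0// ltW.
pose M := 4 * c ^+ 2 + 6 * c + 1.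
have c2 : 0 <= c ^+ 2 by rewrite sqr_ge0.
have M0 : 0 <= M by rewrite !addr_ge0// mulr_ge0// ltW.
exists (M * A * B); first by rewrite !mulr_ge0.
move=> k y; set K := k.+1%:R^-1 : R.
have K0 : 0 <= K by rewrite invr_ge0.
have K1 : K <= 1 by rewrite invf_le1// ler1n.
have [b0 b1 b2] := HB (K * y + 0).
have G := sqr_gauss1_le y c0; have g0 := ltW (gauss1_gt0 c y).
have y2 : 0 <= y ^+ 2 by rewrite sqr_ge0.
have key (t b : R) : `|t| <= M * (1 + y ^+ 2) -> `|b| <= B ->
    `|t| * gauss1 c y * `|b| <= M * A * B * gauss1 (c / 2) y.
  move=> ht hb; rewrite [leRHS](_ : _ = M * (A * gauss1 (c / 2) y) * B); last by ring.
  apply: ler_pM => //; first by rewrite mulr_ge0.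
  apply: (@le_trans _ _ (M * ((1 + y ^+ 2) * gauss1 c y))).
    by rewrite mulrA ler_wpM2r.
  by rewrite ler_wpM2l.
split.
  have := key 1 _ _ b0; rewrite normr1 mul1r /cut_gauss (normrM (gauss1 c y)) (ger0_norm g0); apply.
  rewrite /M; nra.
have ay : `|y| ^+ 2 = y ^+ 2 by rewrite real_normK// num_real.
have Kb1 : `|K * bump1 (K * y + 0)| <= B.
  by rewrite normrM (ger0_norm K0) -[leRHS]mul1r ler_pM.
have Kb2 : `|K * (K * bump2 (K * y + 0))| <= B.
  rewrite !normrM (ger0_norm K0) -[leRHS]mul1r ler_pM// ?mulr_ge0//.
  by rewrite -[leRHS]mul1r ler_pM.
pose t := `|4 * c ^+ 2 * y ^+ 2 - 2 * c| + 2 * `|2 * c * y| + 1.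
have t0 : 0 <= t by rewrite !addr_ge0// mulr_ge0.
apply: (@le_trans _ _ (t * gauss1 c y * B)).
  rewrite /cut_gauss2 -/K (le_trans (ler_normD _ _))//.
  rewrite (le_trans (lerD (ler_normD _ _) (lexx _)))//.
  rewrite [X in _ <= X](_ : _ = `|4 * c ^+ 2 * y ^+ 2 - 2 * c| * gauss1 c y * B
    + 2 * (`|2 * c * y| * gauss1 c y * B) + gauss1 c y * B); last by rewrite /t; ring.
  rewrite lerD//; last first.
    by rewrite normrM (ger0_norm g0) ler_wpM2l.
  rewrite lerD//.
    by rewrite (normrM _ (bump _)) (normrM _ (gauss1 c y)) (ger0_norm g0) ler_wpM2l// mulr_ge0.
  rewrite normrM (ger0_norm (_ : 0 <= 2))// ler_wpM2l//.
  rewrite normrM [X in X * _]normrM normrN (ger0_norm g0) ler_wpM2l//.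
  by rewrite mulr_ge0.
have := key t B; rewrite (ger0_norm t0) (ger0_norm B0); apply => //.
have h1 : `|4 * c ^+ 2 * y ^+ 2 - 2 * c| <= 4 * c ^+ 2 * y ^+ 2 + 2 * c.
  apply: le_trans (ler_normB _ _) _.
  by rewrite (ger0_norm (mulr_ge0 (mulr_ge0 (ler0n R 4) c2) y2))
             (ger0_norm (mulr_ge0 (ler0n R 2) (ltW c0))).
have h2 : 2 * `|2 * c * y| <= 2 * c * (1 + y ^+ 2).
  rewrite !normrM (ger0_norm (ltW c0)) (ger0_norm (_ : 0 <= 2))//.
  rewrite -ay; have := sqr_ge0 (`|y| - 1); have := normr_ge0 y; nra.
have cy : 0 <= c * y ^+ 2 by rewrite mulr_ge0// ltW.
move: h1 h2; rewrite /t /M; move: `|_| `|_| => *; nra.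
Qed.

Lemma cvg_scaled_bump (y : R) (f : R -> R) : continuous f ->
  f (k.+1%:R^-1 * y + 0) @[k --> \oo] --> f 0.
Proof.
move=> cf; apply: (@cvg_comp _ _ _ (fun k => k.+1%:R^-1 * y + 0) f _ (nbhs (0 : R))); last exact: cf.
suff : k.+1%:R^-1 * y + 0 @[k --> \oo] --> 0 * y + 0 by rewrite mul0r addr0.
apply: cvgD; last exact: cvg_cst.
apply: cvgMl; exact: cvg_harmonic.
Qed.

Lemma cvg_cut_gauss c y : cut_gauss c k y @[k --> \oo] --> gauss1 c y * bump 0.
Proof.
apply: cvgM; first exact: cvg_cst.
by apply: cvg_scaled_bump; apply: diffn_continuous; exact: diffn_bump.
Qed.

Lemma cvg_cut_gauss2 c y : cut_gauss2 c k y @[k --> \oo] -->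
  (4 * c ^+ 2 * y ^+ 2 - 2 * c) * gauss1 c y * bump 0.
Proof.
have [B B0 HB] := bump_bounded.
have small (b : R -> R) : (forall y, `|b y| <= B) ->
    k.+1%:R^-1 * b (k.+1%:R^-1 * y + 0) @[k --> \oo] --> (0 : R).
  move=> bB; apply/cvgr0Pnorm_le => e e0.
  have e1 : 0 < e / (B + 1) by rewrite divr_gt0// ltr_wpDl.
  have := @cvg_harmonic R => /cvgr0Pnorm_le /(_ _ e1).
  apply: filterS => k /=; rewrite ler_pdivlMr ?ltr_wpDl// => h.
  rewrite normrM (le_trans _ h)// ler_wpM2l//.
  by rewrite (le_trans (bB _))// lerDl.
rewrite [X in _ --> X](_ : _ = (4 * c ^+ 2 * y ^+ 2 - 2 * c) * gauss1 c y * bump 0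
  + 2 * (- (2 * c * y) * gauss1 c y * 0) + gauss1 c y * (0 * 0)); last by ring.
apply: cvgD; last first.
  apply: cvgM; first exact: cvg_cst.
  by apply: cvgM; [exact: cvg_harmonic|apply: small => z; have [] := HB z].
apply: cvgD.
  apply: cvgM; first exact: cvg_cst.
  by apply: cvg_scaled_bump; apply: diffn_continuous; exact: diffn_bump.
apply: cvgM; first exact: cvg_cst.
apply: cvgM; first exact: cvg_cst.
by apply: small => z; have [] := HB z.
Qed.

End cutoff.

Section weak_laplacian_gauss.
Context {R : realType} {n : nat}.
Local Notation E := 'rV[R]_n.
Local Notation lam := (@lebesgue_rV R n).
Variables (c : R) (c0 : 0 < c).

(** The Laplacian of [gauss c], pointwise. *)
Definition lap_gauss (x : E) : R :=
  (4 * c ^+ 2 * dot x x - 2 * c * n%:R) * gauss c x.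

Let phi k : E -> R := tensor (fun=> cut_gauss c k).

Let phi_test k : Cc_infty (phi k).
Proof.
apply: (@Cc_infty_tensor _ _ _ k.+1%:R) => [j m|j y]; first exact: diffn_cut_gauss.
exact: cut_gauss_support.
Qed.

Let lap_phi k x : laplacian (phi k) x =
  \sum_i tensor (fun j => if j == i then cut_gauss2 c k else cut_gauss c k) x.
Proof.
rewrite /phi laplacian_tensor; last by move=> j m; exact: diffn_cut_gauss.
apply: eq_bigr => i _; rewrite tensor_derive2; congr (tensor _ x).
by apply/funext => j; case: eqP => // _; rewrite cut_gauss_derive2.
Qed.

Let measurable_phi k : measurable_fun setT (phi k).
Proof.
have [sm _] := phi_test k; apply: continuous_measurable_rV.
by have [] := sm [::].
Qed.

Let measurable_lap_phi k : measurable_fun setT (laplacian (phi k)).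
Proof.
have [sm _] := phi_test k; apply: measurable_sum => i.
apply: continuous_measurable_rV.
by have [] := sm [:: i; i].
Qed.

Let tensor_gauss (b C : R) (x : E) : tensor (fun=> (fun y => C * gauss1 b y)) x = C ^+ n * gauss b x.
Proof.
by rewrite /tensor big_split/= prodr_const card_ord -gauss_prod.
Qed.

Let lap_limit (x : E) :
  \sum_i tensor (fun j => if j == i then
       (fun y => (4 * c ^+ 2 * y ^+ 2 - 2 * c) * gauss1 c y * bump 0)
     else (fun y => gauss1 c y * bump 0)) x = lap_gauss x * bump 0 ^+ n.
Proof.
pose a (i : 'I_n) := 4 * c ^+ 2 * x ord0 i ^+ 2 - 2 * c.
transitivity (\sum_i a i * (gauss c x * bump 0 ^+ n)).
  apply: eq_bigr => i _; rewrite /tensor.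
  rewrite (eq_bigr (fun j => (if j == i then a j else 1) * (gauss1 c (x ord0 j) * bump 0))).
    rewrite big_split/= -big_mkcond big_pred1_eq; congr (_ * _).
    by rewrite big_split/= prodr_const card_ord -gauss_prod.
  by move=> j _; case: ifPn => _; rewrite ?mul1r// mulrA.
rewrite -mulr_suml mulrA; congr (_ * _ * _).
rewrite /a sumrB -mulr_sumr sumr_const card_ord mulr_natr; congr (_ * _ - _).
Qed.

Lemma measurable_lap_gauss : measurable_fun setT lap_gauss.
Proof.
apply: measurable_funM; last exact: measurable_gauss.
apply: measurable_funB => //; apply: measurable_funM => //.
exact: measurable_dot_self.
Qed.

Lemma lap_gauss_L2 : L2 lap_gauss.
Proof.
pose C := 8 * c + 2 * c * n%:R.
apply: (@Lfun2_dominated _ _ _ _ _ (fun x => C * gauss (c / 2) x)).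
- exact: measurable_lap_gauss.
- move=> x; rewrite /lap_gauss normrM (ger0_norm (gauss_ge0 _ _)).
  have h1 := gauss_dot_le x c0.
  have h2 : gauss c x <= gauss (c / 2) x.
    rewrite ler_expR lerN2 ler_wpM2r ?dot_ge0//.
    by move: c0; lra.
  have cn : 0 <= 2 * c * n%:R by rewrite !mulr_ge0// ltW.
  have d0 := dot_ge0 x; have g0 := gauss_ge0 c x.
  apply: (@le_trans _ _ (4 * c ^+ 2 * (gauss c x * dot x x) + 2 * c * n%:R * gauss c x)).
    rewrite [leRHS](_ : _ = (4 * c ^+ 2 * dot x x + 2 * c * n%:R) * gauss c x); last by ring.
    rewrite ler_wpM2r// (le_trans (ler_normB _ _))// !ger0_norm//.
    by rewrite mulr_ge0// mulr_ge0// sqr_ge0.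
  rewrite /C [leRHS]mulrDl lerD//; last by rewrite ler_wpM2l.
  rewrite [leRHS](_ : _ = 4 * c ^+ 2 * (2 / c * gauss (c / 2) x)); last first.
    by field; rewrite gt_eqF.
  by rewrite ler_wpM2l// mulr_ge0// sqr_ge0.
- by apply: Lfun2Zl; apply: gauss_L2; rewrite divr_gt0.
Qed.

(** Tensor products of cut-off Gaussians are test functions; they and their
    Laplacians converge pointwise, dominated by a Gaussian, to [bump 0 ^+ n]
    times those of [gauss c]. *)
Lemma weak_laplacian_gauss f g : weak_laplacian f g ->
  \int[lam]_x (g x * gauss c x) = \int[lam]_x (f x * lap_gauss x).
Proof.
move=> [lf lg fg]; have [C C0 HC] := cut_gauss_le c0.
pose dom (x : E) := C ^+ n * gauss (c / 2) x.
have domL2 : L2 dom by apply: Lfun2Zl; apply: gauss_L2; rewrite divr_gt0.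
have dom0 x : 0 <= dom x by rewrite mulr_ge0 ?gauss_ge0// exprn_ge0.
have phi_le k x : `|phi k x| <= dom x.
  rewrite /dom -tensor_gauss; apply: tensor_le => j y.
  by have [] := HC k y.
have lap_le k x : `|laplacian (phi k) x| <= n%:R * dom x.
  rewrite lap_phi (le_trans (ler_norm_sum _ _ _))//.
  rewrite mulr_natl -[X in _ *+ X]card_ord -sumr_const; apply: ler_sum => i _.
  rewrite /dom -tensor_gauss; apply: tensor_le => j y.
  by have [] := HC k y; case: ifP.
have mf := Lfun2_measurable lf; have mg := Lfun2_measurable lg.
have dct h (F : nat -> E -> R) F0 m : L2 h -> (forall k, measurable_fun setT (F k)) ->
    (forall k x, `|F k x| <= m * dom x) -> (forall x, F k x @[k --> \oo] --> F0 x) ->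
    \int[lam]_x (h x * F k x) @[k --> \oo] --> \int[lam]_x (h x * F0 x).
  move=> lh mF Fm FF0; have mh := Lfun2_measurable lh.
  apply: (Rintegral_dct (g := fun x => m * (`|h x| * dom x)) _ _ _ _).2.
  - by move=> k; exact: measurable_funM.
  - by move=> x; apply: cvgM => //; exact: cvg_cst.
  - move=> k x; rewrite normrM mulrCA ler_wpM2l//.
  - by apply: real_integrableZl; apply: Lfun2_mul_integrable => //; exact: Lfun2_abs.
have H1 := dct g phi (fun x => gauss c x * bump 0 ^+ n) 1 lg measurable_phi.
have H2 := dct f (fun k => laplacian (phi k)) (fun x => lap_gauss x * bump 0 ^+ n)
  n%:R lf measurable_lap_phi lap_le.
have E1 : (fun k => \int[lam]_x (f x * laplacian (phi k) x)) =
    (fun k => \int[lam]_x (g x * phi k x)).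
  by apply/funext => k; exact: fg.
have bn0 : bump 0 ^+ n != 0 :> R by rewrite expf_neq0// gt_eqF// bump0_gt0.
have pull h F0 : L2 h -> L2 F0 ->
    \int[lam]_x (h x * (F0 x * bump 0 ^+ n)) = bump 0 ^+ n * \int[lam]_x (h x * F0 x).
  move=> lh lF0; rewrite -RintegralZl//; last exact: Lfun2_mul_integrable.
  by apply: eq_Rintegral => x _; ring.
apply: (mulfI bn0); rewrite -!pull//; [|exact: lap_gauss_L2|exact: gauss_L2].
have {}H1 : \int[lam]_x (g x * phi k x) @[k --> \oo] -->
    \int[lam]_x (g x * (gauss c x * bump 0 ^+ n)).
  apply: H1 => [k x|x]; first by rewrite mul1r.
  rewrite [X in _ --> X](_ : _ = tensor (fun=> (fun y => gauss1 c y * bump 0)) x).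
    by apply: cvg_tensor => j y; exact: cvg_cut_gauss.
  by rewrite /tensor big_split/= prodr_const card_ord -gauss_prod.
rewrite -(cvg_lim _ H1)//; rewrite -E1; apply: cvg_lim => //.
apply: H2 => x; rewrite -lap_limit.
rewrite (_ : (fun k => _) = (fun k => \sum_i tensor (fun j =>
  if j == i then cut_gauss2 c k else cut_gauss c k) x)); last first.
  by apply/funext => k; rewrite lap_phi.
apply: (cvg_big (@add_continuous R)) => i _.
apply: cvg_tensor => j y; case: eqP => _.
  exact: cvg_cut_gauss2.
exact: cvg_cut_gauss.
Qed.

End weak_laplacian_gauss.

(** * Nonexistence of nonnegative global solutions *)

Section pairings.
Context {R : realType} {n : nat}.
Local Notation E := 'rV[R]_n.
Local Notation lam := (@lebesgue_rV R n).
Implicit Types f g h : E -> R.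

(** The pairing with [h] of the difference quotients in L^2. *)
Lemma half_line_derive_pairing (u v : R -> E -> R) h :
  time_derivative L2_space u v -> L2 h ->
  half_line_derive (fun t => \int[lam]_x (u t x * h x))
                   (fun t => \int[lam]_x (v t x * h x)).
Proof.
move=> [uv duv] lh.
pose P t := \int[lam]_x (u t x * h x); pose Q t := \int[lam]_x (v t x * h x).
have ui t : 0 <= t -> lam.-integrable setT (EFin \o (fun x => u t x * h x)).
  by move=> t0; apply: Lfun2_mul_integrable => //; have [] := uv t t0.
have vi t : 0 <= t -> lam.-integrable setT (EFin \o (fun x => v t x * h x)).
  by move=> t0; apply: Lfun2_mul_integrable => //; have [] := uv t t0.
have quot (t e : R) : 0 <= t -> 0 < e -> exists2 d, 0 < d & forall s, 0 <= s -> s != t ->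
    `|t - s| < d -> `|(s - t)^-1 * (P s - P t) - Q t| <= e.
  move=> t0 e0; have [ut vt] := uv t t0.
  have lq s : 0 <= s -> L2 (fun x => (s - t)^-1 * (u s x - u t x) - v t x).
    move=> s0; have [us _] := uv s s0.
    by apply: Lfun2B => //; apply: Lfun2Zl; exact: Lfun2B.
  have qE s : 0 <= s -> \int[lam]_x (((s - t)^-1 * (u s x - u t x) - v t x) * h x) =
      (s - t)^-1 * (P s - P t) - Q t.
    move=> s0; rewrite /P /Q -RintegralB ?ui// -RintegralZl//; last first.
      by apply: real_integrableB; exact: ui.
    rewrite -RintegralB//; [|apply: real_integrableZl|exact: vi].
    - by apply: eq_Rintegral => x _; ring.
    - by apply: real_integrableB; exact: ui.
  have FW : Filter (within [set s : R | 0 <= s] t^') by exact: within_filter.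
  have lqn : \forall s \near within [set s : R | 0 <= s] t^',
      L2 (fun x => (s - t)^-1 * (u s x - u t x) - v t x).
    by near=> s; apply: lq; near: s; exact: withinT.
  have := Lfun2_pair_cvg (FF := FW) lqn lh (duv t t0).
  move=> /cvgr0Pnorm_le /(_ _ e0).
  move=> /nbhs_ballP[d d0 H]; exists d => // s s0 st ts.
  by rewrite -qE//; apply: H.
split.
  have Q0 : (s^-1 * (P s - P 0)) @[s --> 0^'+] --> Q 0.
    apply/cvgrPdist_le => e e0; have [d d0 H] := quot 0 e (lexx 0) e0.
    near=> s; have s0 : 0 < s by near: s; exact: nbhs_right_gt.
    rewrite distrC -[s in s^-1]subr0; apply: H; rewrite ?(ltW s0) ?gt_eqF//.
    rewrite sub0r normrN gtr0_norm//; near: s; exact: nbhs_right_lt.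
  have : P 0 + s * (s^-1 * (P s - P 0)) @[s --> 0^'+] --> P 0 + 0 * Q 0.
    apply: cvgD; first exact: cvg_cst.
    by apply: cvgM => //; apply: cvg_at_right_filter; exact: cvg_id.
  rewrite mul0r addr0; apply: cvg_trans; apply: near_eq_cvg; near=> s.
  have s0 : 0 < s by near: s; exact: nbhs_right_gt.
  by rewrite mulVKf ?gt_eqF// subrKC.
move=> t t0.
have lim : (h^-1 *: (P (h *: 1 + t) - P t)) @[h --> 0^'] --> Q t.
  apply/cvgrPdist_le => e e0; have [d d0 H] := quot t e (ltW t0) e0.
  near=> s; rewrite distrC /GRing.scale/= mulr1.
  have sd : `|s| < d by near: s; exact: dnbhs0_lt.
  have st : `|s| < t by near: s; exact: dnbhs0_lt.
  have sn0 : s != 0 by near: s; exact: nbhs_dnbhs_neq.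
  rewrite -{1}[s](addrK t); apply: H.
  - by have := ler_norm (- s); rewrite normrN => ?; lra.
  - by rewrite -subr_eq0 addrK.
  - by rewrite opprD addrCA subrr addr0 normrN.
apply: DeriveDef; first by apply/cvg_ex; eexists; exact: lim.
exact: cvg_lim.
Unshelve. all: by end_near. Qed.

End pairings.

Section nonnegative_pairings.
Context {R : realType} {n : nat}.
Local Notation E := 'rV[R]_n.
Local Notation lam := (@lebesgue_rV R n).
Implicit Types f g h : E -> R.

Lemma pairing_ge0 f h : L2 f -> L2 h -> {ae lam, forall x, 0 <= f x} ->
  (forall x, 0 <= h x) -> 0 <= \int[lam]_x (f x * h x).
Proof.
move=> lf lh f0 h0; apply: ae_Rintegral_ge0.
  by apply: measurable_funM; [exact: (Lfun2_measurable lf)|exact: (Lfun2_measurable lh)].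
by apply: filterS f0 => x fx; rewrite mulr_ge0.
Qed.

Lemma pairingZ f h c : L2 f -> L2 h ->
  \int[lam]_x (f x * (c * h x)) = c * \int[lam]_x (f x * h x).
Proof.
move=> lf lh; rewrite -RintegralZl//; last exact: Lfun2_mul_integrable.
by apply: eq_Rintegral => x _; rewrite mulrCA.
Qed.

Lemma pairing_le f h1 h2 : L2 f -> L2 h1 -> L2 h2 ->
  {ae lam, forall x, 0 <= f x} -> (forall x, h1 x <= h2 x) ->
  \int[lam]_x (f x * h1 x) <= \int[lam]_x (f x * h2 x).
Proof.
move=> lf l1 l2 f0 h12; rewrite -subr_ge0 -RintegralB//; try exact: Lfun2_mul_integrable.
apply: ae_Rintegral_ge0.
  have := Lfun2_measurable lf; have := Lfun2_measurable l1; have := Lfun2_measurable l2.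
  by move=> *; apply: measurable_funB; apply: measurable_funM.
by apply: filterS f0 => x fx; rewrite -mulrBr mulr_ge0// subr_ge0.
Qed.

(** The real-valued integral is [0] by convention when the integral is infinite,
    so that its positivity contains the integrability. *)
Lemma integrable_of_Rintegral_gt0 f : measurable_fun setT f ->
  0 < \int[lam]_x f x -> lam.-integrable setT (EFin \o f).
Proof.
move=> mf; have mF : measurable_fun setT (EFin \o f) by exact/measurable_EFinP.
rewrite /Rintegral integralE => If.
have p0 : (0 <= \int[lam]_x ((EFin \o f)^\+ x))%E by exact: integral_ge0.
have n0 : (0 <= \int[lam]_x ((EFin \o f)^\- x))%E by exact: integral_ge0.
apply/integrableP; split=> //.
rewrite (_ : (fun x => _) = (EFin \o f)^\+ \+ (EFin \o f)^\-)%E; last first.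
  by rewrite -fune_abse.
rewrite ge0_integralD//; [|exact: measurable_funepos|exact: measurable_funeneg].
move: If p0 n0; case: (integral _ _ _) => [a||]//; case: (integral _ _ _) => [b||]//=;
  rewrite ?ltry ?ltxx//.
Qed.

(** According to whether [|a| ^ (p - 1)] exceeds [1 / l]. *)
Lemma young_powR (p l a : R) : 1 < p -> 0 < l -> 
  a <= l * `|a| `^ p + l `^ (- (p - 1)^-1).
Proof.
move=> p1 l0; have p10 : 0 < p - 1 by rewrite subr_gt0.
set L := l `^ _; have L0 : 0 < L by rewrite powR_gt0.
apply: le_trans (ler_norm a) _.
have [aL|La] := leP `|a| L.
  by rewrite (le_trans aL)// lerDr mulr_ge0 ?powR_ge0// ltW.
have a0 : 0 < `|a| := lt_trans L0 La.
rewrite (@le_trans _ _ (l * `|a| `^ p))//; last by rewrite lerDl ltW.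
have -> : `|a| `^ p = `|a| * `|a| `^ (p - 1).
  by rewrite -{2}(powRr1 (ltW a0)) -powRD ?subrKC// (gt_eqF a0) implybT.
rewrite mulrCA ler_peMr ?(ltW a0)//.
have lL : l * L `^ (p - 1) = 1.
  rewrite /L -powRrM mulNr mulVf ?gt_eqF// powRN powRr1 ?(ltW l0)//.
  by rewrite divff ?gt_eqF.
by rewrite -[leLHS]lL ler_wpM2l ?(ltW l0)// ge0_ler_powR ?nnegrE ?(ltW p10) ?(ltW L0)// ltW.
Qed.

End nonnegative_pairings.

Section test_functions.
Context {R : realType} {n : nat}.
Local Notation E := 'rV[R]_n.
Local Notation lam := (@lebesgue_rV R n).
Implicit Types f g h : E -> R.

(** Normalised to [1] at the origin, hence increasing in [r] and convergent
    to [1]; it is a multiple of [gaussF (r^2)]. *)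
Definition profile (r : R) : E -> R := gauss (4 * r ^+ 2)^-1.

Definition riesz_profile (sigma r : R) (x : E) : R :=
  (Num.sqrt (pi / r ^+ 2) ^+ n)^-1 * riesz_gaussF (r ^+ 2) sigma x.

Variables (sigma r : R).
Hypotheses (s0 : 0 < sigma) (s1 : sigma <= 1) (r0 : 0 < r).

Let r2 : 0 < r ^+ 2. Proof. by rewrite exprn_gt0. Qed.
Let r4 : 0 < (4 * r ^+ 2)^-1. Proof. by rewrite invr_gt0 mulr_gt0. Qed.

Let S := Num.sqrt (pi / r ^+ 2) ^+ n.
Let S0 : 0 < S. Proof. by rewrite exprn_gt0// sqrtr_gt0 divr_gt0 ?pi_gt0. Qed.

Let gaussFE' x : gaussF (r ^+ 2) x = S * profile r x.
Proof. by []. Qed.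

Lemma profile_L2 : L2 (profile r).
Proof. exact: gauss_L2. Qed.

Lemma integral_profile : lam.-integrable setT (EFin \o profile r) /\
  \int[lam]_x profile r x = Num.sqrt (4 * pi) ^+ n * r ^+ n.
Proof.
have [ig ->] := integral_gauss n r4; split=> //.
by rewrite invrK -exprMn mulrCA mulrA sqrtrM ?mulr_ge0 ?pi_ge0// sqrtr_sqr gtr0_norm.
Qed.

Lemma riesz_profile_L2 : L2 (riesz_profile sigma r).
Proof. by apply: Lfun2Zl; exact: riesz_gaussF_L2. Qed.

Lemma riesz_profile_le x :
  riesz_profile sigma r x <= (n%:R / 2) `^ sigma * r `^ (- (2 * sigma)) * profile r x.
Proof.
rewrite /riesz_profile -/S ler_pdivrMl//.
apply: le_trans (riesz_gaussF_le r2 s0 s1 x) _.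
rewrite gaussFE' -(mulrA S) ler_wpM2l ?(ltW S0)// [leRHS]mulrC.
rewrite ler_wpM2l ?gauss_ge0// invfM mulrA powRM ?divr_ge0 ?invr_ge0 ?(ltW r2)//.
by rewrite -(powR_inv1 (ltW r2)) -(powR_mulrn 2 (ltW r0)) -!powRrM mulN1r mulrN.
Qed.

Lemma frac_laplacian_profile f g : frac_laplacian sigma f g ->
  \int[lam]_x (g x * profile r x) = \int[lam]_x (f x * riesz_profile sigma r x).
Proof.
move=> fg; have [F [lf _ _] [lg _ _]] := fg.
have H := frac_laplacian_pairing r2 s0 s1 fg.
apply: (mulfI (lt0r_neq0 S0)).
rewrite -RintegralZl//; last by apply: Lfun2_mul_integrable => //; exact: profile_L2.
rewrite -RintegralZl//; last by apply: Lfun2_mul_integrable => //; exact: riesz_profile_L2.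
transitivity (\int[lam]_x (g x * gaussF (r ^+ 2) x)).
  by apply: eq_Rintegral => x _; rewrite gaussFE' mulrCA.
rewrite H; apply: eq_Rintegral => x _.
by rewrite [RHS]mulrCA /riesz_profile -/S mulVKf ?gt_eqF.
Qed.

Definition lap_profile : E -> R := lap_gauss (4 * r ^+ 2)^-1.

Lemma lap_profile_L2 : L2 lap_profile.
Proof. exact: lap_gauss_L2. Qed.

Lemma lap_profile_ge x : - lap_profile x <= n%:R / 2 / r ^+ 2 * profile r x.
Proof.
rewrite /lap_profile /lap_gauss -mulNr ler_wpM2r ?gauss_ge0// opprB.
set c := (4 * r ^+ 2)^-1.
have -> : n%:R / 2 / r ^+ 2 = 2 * c * n%:R.
  by rewrite /c; field; rewrite gt_eqF.
by rewrite gerBl mulr_ge0 ?dot_ge0// mulr_ge0// sqr_ge0.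
Qed.

Lemma weak_laplacian_profile f g : weak_laplacian f g ->
  \int[lam]_x (g x * profile r x) = \int[lam]_x (f x * lap_profile x).
Proof. exact: weak_laplacian_gauss. Qed.

End test_functions.

Lemma profile_le (R : realType) n (r r' : R) (x : 'rV[R]_n) : 0 < r -> r <= r' ->
  profile r x <= profile r' x.
Proof.
move=> r0 rr'; rewrite ler_expR lerN2 ler_wpM2r ?dot_ge0//.
have r'0 := lt_le_trans r0 rr'.
rewrite lef_pV2 ?posrE ?mulr_gt0 ?exprn_gt0// ler_pM2l//.
by rewrite lerXn2r ?nnegrE ?(ltW r0) ?(ltW r'0).
Qed.

Lemma cvg_profile (R : realType) n (x : 'rV[R]_n) :
  profile k.+1%:R x @[k --> \oo] --> (1 : R).
Proof.
suff : expR (- ((4 * k.+1%:R ^+ 2)^-1 * dot x x)) @[k --> \oo] --> expR (- (0 * dot x x)).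
  by rewrite mul0r oppr0 expR0.
apply: (@cvg_comp _ _ _ (fun k : nat => - ((4 * k.+1%:R ^+ 2)^-1 * dot x x)) expR _
  (nbhs (- (0 * dot x x)))); last exact: continuous_expR.
apply: cvgN; apply: cvgMl.
rewrite (_ : (fun k : nat => _) = (fun k => 4^-1 * (k.+1%:R^-1 * k.+1%:R^-1)) :> (nat -> R)).
  suff : 4^-1 * (k.+1%:R^-1 * k.+1%:R^-1) @[k --> \oo] --> 4^-1 * (0 * 0 : R).
    by rewrite !mulr0.
  apply: cvgM; first exact: cvg_cst.
  by apply: cvgM; exact: cvg_harmonic.
by apply/funext => k; rewrite invfM expr2 invfM.
Qed.

Section nonexistence.
Context {R : realType} {n : nat}.
Local Notation E := 'rV[R]_n.
Local Notation lam := (@lebesgue_rV R n).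
Variables (mu sigma p : R) (u0 u1 : E -> R) (u ut utt : R -> E -> R) (Frac_u0 : E -> R).
Hypotheses (mu_gt0 : 0 < mu) (sigma_gt0 : 0 < sigma) (sigma_le1 : sigma <= 1) (p_gt1 : 1 < p).
Hypothesis p_crit : n%:R + Num.max 1 (2 - 2 * sigma) - 2 <= 2 * (p - 1)^-1.
Hypothesis measurable_u1 : measurable_fun setT u1.
Hypothesis u0_frac : frac_laplacian sigma u0 Frac_u0.
Hypothesis data_gt0 : 0 < \int[lam]_x (u1 x + mu * Frac_u0 x).
Hypotheses (dut : time_derivative L2_space u ut) (dutt : time_derivative L2_space ut utt).
Hypothesis u_0 : {ae lam, forall x, u 0 x = u0 x}.
Hypothesis ut_0 : {ae lam, forall x, ut 0 x = u1 x}.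
Hypothesis equation : forall t, 0 <= t -> exists Lap_u Frac_ut,
  [/\ weak_laplacian (u t) Lap_u, frac_laplacian sigma (ut t) Frac_ut
    & {ae lam, forall x, utt t x - Lap_u x + mu * Frac_ut x = `|u t x| `^ p}].
Hypothesis u_ge0 : nonnegative u.

Local Notation r k := (k.+1%:R : R).
Let r_gt0 k : 0 < r k. Proof. by []. Qed.

Let U k t := \int[lam]_x (u t x * profile (r k) x).
Let U1 k t := \int[lam]_x (ut t x * profile (r k) x).
Let V k t := \int[lam]_x (u t x * riesz_profile sigma (r k) x).
Let D k t := \int[lam]_x (u t x * lap_profile (r k) x).
Let W k t := U1 k t + mu * V k t.
Let g k t := \int[lam]_x (`|u t x| `^ p * profile (r k) x).

Let profL2 k : L2 (profile (r k) : E -> R). Proof. exact: profile_L2. Qed.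
Let rieszL2 k : L2 (riesz_profile sigma (r k) : E -> R).
Proof. exact: riesz_profile_L2. Qed.
Let lapL2 k : L2 (lap_profile (r k) : E -> R). Proof. exact: lap_profile_L2. Qed.

Let u_L2 t : 0 <= t -> L2 (u t). Proof. by move=> t0; have [] := dut.1 t t0. Qed.
Let ut_L2 t : 0 <= t -> L2 (ut t). Proof. by move=> t0; have [] := dut.1 t t0. Qed.
Let utt_L2 t : 0 <= t -> L2 (utt t). Proof. by move=> t0; have [] := dutt.1 t t0. Qed.

Let measurable_power t : 0 <= t -> measurable_fun setT (fun x => `|u t x| `^ p).
Proof.
move=> t0; have mu_ := Lfun2_measurable (u_L2 t0).
apply: (measurableT_comp (measurable_powR p)).
exact: measurableT_comp.
Qed.

(** The equation, multiplied by the test function and integrated. It holds only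
    almost everywhere, and it also provides the integrability of
    [|u| ^ p * profile]. *)
Let pairing_equation k t : 0 <= t ->
  lam.-integrable setT (EFin \o (fun x => `|u t x| `^ p * profile (r k) x)) /\
  g k t + D k t = \int[lam]_x (utt t x * profile (r k) x) +
                mu * \int[lam]_x (ut t x * riesz_profile sigma (r k) x).
Proof.
move=> t0; have [Lap [Frac [wl fr eq]]] := equation t0.
have [_ lLap _] := wl; have [F _ [lFrac _ _]] := fr.
have lp := profL2 k.
have i1 := Lfun2_mul_integrable (utt_L2 t0) lp.
have i2 := Lfun2_mul_integrable lLap lp.
have i3 := Lfun2_mul_integrable lFrac lp.
have i4 := real_integrableB i1 i2.
have i5 := real_integrableZl mu i3.
have i6 := real_integrableD i4 i5.
have m1 := integrable_measurable i6.
have m2 : measurable_fun setT (fun x => `|u t x| `^ p * profile (r k) x).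
  by apply: measurable_funM; [exact: measurable_power|exact: measurable_gauss].
have ae_eq : {ae lam, forall x, utt t x * profile (r k) x - Lap x * profile (r k) x +
    mu * (Frac x * profile (r k) x) = `|u t x| `^ p * profile (r k) x}.
  by apply: filterS eq => x <-; ring.
split; first exact: (ae_integrable m1 m2 ae_eq).
rewrite /g -(ae_eq_Rintegral m1 m2 ae_eq) RintegralD// RintegralB// RintegralZl//.
rewrite (weak_laplacian_profile (r_gt0 k) wl) (frac_laplacian_profile sigma_gt0 sigma_le1 (r_gt0 k) fr).
rewrite /D; ring.
Qed.

Let dW k : half_line_derive (W k) (fun t => g k t + D k t).
Proof.
apply: half_line_derive_eq.
  apply: half_line_deriveD.
    exact: (half_line_derive_pairing dutt (profL2 k)).
  apply: half_line_deriveZ.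
  exact: (half_line_derive_pairing dut (rieszL2 k)).
by move=> t t0 /=; have [_ ->] := pairing_equation k (ltW t0).
Qed.

(** The fractional Laplacian is moved back to [u0], and the profiles tend to [1]
    under the integral of the data. *)
Let W0_limit : W k 0 @[k --> \oo] --> \int[lam]_x (u1 x + mu * Frac_u0 x).
Proof.
have [F [lu0 _ _] [lF _ _]] := u0_frac.
have mF := Lfun2_measurable lF.
pose w x := u1 x + mu * Frac_u0 x.
have mw : measurable_fun setT w.
  by apply: measurable_funD => //; exact: measurable_funM.
have iw := integrable_of_Rintegral_gt0 mw data_gt0.
have W0E k : W k 0 = \int[lam]_x (w x * profile (r k) x).
  have lp := profL2 k; have mp := Lfun2_measurable lp.
  have lr := rieszL2 k.
  have i1 := Lfun2_mul_integrable (ut_L2 (lexx 0)) lp.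
  have m1 : measurable_fun setT (fun x => u1 x * profile (r k) x) by exact: measurable_funM.
  have e1 : {ae lam, forall x, ut 0 x * profile (r k) x = u1 x * profile (r k) x}.
    by apply: filterS ut_0 => x ->.
  have i1' := ae_integrable (integrable_measurable i1) m1 e1 i1.
  have i2 := Lfun2_mul_integrable lu0 lr.
  have e2 : {ae lam, forall x, u 0 x * riesz_profile sigma (r k) x =
                               u0 x * riesz_profile sigma (r k) x}.
    by apply: filterS u_0 => x ->.
  have i3 := Lfun2_mul_integrable (u_L2 (lexx 0)) lr.
  have i4 := Lfun2_mul_integrable lF lp.
  rewrite /W /U1 /V (ae_eq_Rintegral (integrable_measurable i1) m1 e1).
  rewrite (ae_eq_Rintegral (integrable_measurable i3) (integrable_measurable i2) e2).
  rewrite -(frac_laplacian_profile sigma_gt0 sigma_le1 (r_gt0 k) u0_frac).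
  rewrite -RintegralZl// -RintegralD//; last exact: real_integrableZl.
  by apply: eq_Rintegral => x _; rewrite /w; ring.
rewrite (_ : W ^~ 0 = fun k => \int[lam]_x (w x * profile (r k) x)); last exact/funext.
apply: (Rintegral_dct (g := fun x => `|w x|) _ _ _ _).2.
- by move=> k; apply: measurable_funM => //; exact: measurable_gauss.
- move=> x; rewrite -[X in _ --> X]mulr1; apply: cvgM; first exact: cvg_cst.
  exact: cvg_profile.
- move=> k x; rewrite normrM ler_piMr// ger0_norm ?gauss_ge0// gauss_le1//.
- exact: (integrable_norm _).
Qed.

Lemma no_nonnegative_solution : False.
Proof.
have [k0 _ W0_ge] : \forall k \near \oo, (\int[lam]_x (u1 x + mu * Frac_u0 x)) / 2 <= W k 0.
  have I2 : (\int[lam]_x (u1 x + mu * Frac_u0 x)) / 2 < \int[lam]_x (u1 x + mu * Frac_u0 x).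
    by rewrite ltr_pdivrMr// ltr_pMr// ltr1n.
  by near=> k; apply/ltW; near: k; exact: (cvgr_gt _ W0_limit _ I2).
apply: (@no_global_growth R mu sigma p n%:R (n%:R / 2) ((n%:R / 2) `^ sigma)
  (Num.sqrt (4 * pi) ^+ n) ((\int[lam]_x (u1 x + mu * Frac_u0 x)) / 2) U U1 V D W g k0) => //.
- by rewrite divr_gt0.
- by move=> k; exact: (half_line_derive_pairing dut (profL2 k)).
- by move=> k; exists (fun t => \int[lam]_x (ut t x * lap_profile (r k) x));
    exact: (half_line_derive_pairing dut (lapL2 k)).
- move=> k t t0; apply: (pairing_ge0 (u_L2 t0) (profL2 k) (u_ge0 t0)).
  by move=> x; exact: gauss_ge0.
- move=> k t t0.
  rewrite /D /U -mulN1r -!pairingZ ?u_L2//.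
  apply: (pairing_le (u_L2 t0) (Lfun2Zl _ (lapL2 k)) (Lfun2Zl _ (profL2 k)) (u_ge0 t0)).
  by move=> x; rewrite mulN1r lap_profile_ge.
- move=> k t t0.
  rewrite /V /U -pairingZ ?u_L2//.
  apply: (pairing_le (u_L2 t0) (rieszL2 k) (Lfun2Zl _ (profL2 k)) (u_ge0 t0)).
  by move=> x; exact: riesz_profile_le.
- move=> k t t0; apply: Rintegral_ge0 => x _.
  by rewrite mulr_ge0 ?powR_ge0 ?gauss_ge0.
- move=> k l t kl t0; have [ik _] := pairing_equation k t0; have [il _] := pairing_equation l t0.
  apply: le_Rintegral => // x _; rewrite ler_wpM2l ?powR_ge0// profile_le//.
  by rewrite ler_nat ltnS.
- move=> k t l t0 l0; have [ik _] := pairing_equation k t0.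
  have [ip Ip] := @integral_profile R n _ (r_gt0 k).
  set L := l `^ _.
  rewrite -(mulrA L) powR_mulrn// -Ip /U /g -!RintegralZl// -RintegralD//; try exact: real_integrableZl.
  apply: le_Rintegral => //.
  + exact: Lfun2_mul_integrable (u_L2 t0) (profL2 k).
  + by apply: real_integrableD; exact: real_integrableZl.
  + move=> x _; rewrite mulrA -mulrDl ler_wpM2r ?gauss_ge0//.
    exact: young_powR.
Unshelve. all: by end_near. Qed.

End nonexistence.

(** The maximum is [2 - 2 sigma] when [sigma <= 1 / 2], and [1] otherwise. *)
Lemma critical_exponent (R : realType) (n : nat) (sigma p : R) : 1 < p ->
  (sigma <= 2^-1 -> p <= 1 + 2 / (n%:R - 2 * sigma)) ->
  (2^-1 <= sigma -> p <= 1 + 2 / (n%:R - 1)) ->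
  n%:R + Num.max 1 (2 - 2 * sigma) - 2 <= 2 * (p - 1)^-1.
Proof.
move=> p1; have p10 : 0 < p - 1 by rewrite subr_gt0.
have inv m : p <= 1 + 2 / m -> m <= 2 * (p - 1)^-1.
  have [m0|m0] := ltP 0 m; last first.
    by move=> _; rewrite (le_trans m0)// divr_ge0// ltW.
  by rewrite -lerBlDl ler_pdivlMr// ler_pdivlMr// mulrC.
have [s|s] := leP sigma 2^-1.
  move=> /(_ isT) /inv H _; rewrite (max_idPr _); last by lra.
  by rewrite (_ : _ - 2 = n%:R - 2 * sigma)//; ring.
move=> _ /(_ (ltW s)) /inv H; rewrite (max_idPl _); last by lra.
by rewrite (_ : _ - 2 = n%:R - 1)//; ring.
Qed.

Theorem theorem9 (R : realType) (n : nat) (mu sigma p : R)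
    (u0 u1 : 'rV[R]_n -> R)
    (mu_gt0 : 0 < mu) (sigma_gt0 : 0 < sigma) (sigma_le1 : sigma <= 1)
    (n_gt0 : (0 < n)%N) (n_gt1 : 2^-1 <= sigma -> (1 < n)%N)
    (u0_test : Cc_infty u0) (u1_test : Cc_infty u1)
    (data_gt0 : exists2 Frac_u0, frac_laplacian sigma u0 Frac_u0 &
      0 < \int[lebesgue_rV n]_x (u1 x + mu * Frac_u0 x))
    (p_gt1 : 1 < p)
    (p_le_small : sigma <= 2^-1 -> p <= 1 + 2 / (n%:R - 2 * sigma))
    (p_le_large : 2^-1 <= sigma -> p <= 1 + 2 / (n%:R - 1)) :
  ~ exists u : R -> 'rV[R]_n -> R,
      [/\ sufficiently_regular sigma u, global_solution mu sigma p u0 u1 u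
        & nonnegative u].
Proof.
move=> [u [_ [ut [utt [dut dutt u_0 ut_0 equation]]] u_ge0]].
have [Frac_u0 u0_frac I0] := data_gt0.
have mu1 : measurable_fun setT u1.
  by apply: continuous_measurable_rV; have [] := u1_test.1 [::].
exact: (no_nonnegative_solution mu_gt0 sigma_gt0 sigma_le1 p_gt1
  (critical_exponent p_gt1 p_le_small p_le_large)
  mu1 u0_frac I0 dut dutt u_0 ut_0 equation u_ge0).
Qed.
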